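(* Every definite quaternion algebra $A$ over $\mathbb{Q}$ admits at least one conjugacy class of maximal orders whose different is principal.
   Context: $A$ definite means that $A\otimes_{\mathbb{Q}}\mathbb{R}$ is Hamilton's quaternion algebra. Let $D_A$ be the reduced discriminant of $A$ (the product of the primes at which $A$ ramifies). The different of a maximal order $\mathcal{O}$ of $A$ is the unique right ideal of $\mathcal{O}$ of reduced norm $D_A$ (i.e. of index $D_A^2$); it is two-sided. It is principal if it is of the form $\pi\mathcal{O}$ with $\pi\in\mathcal{O}$. *)

(* Defs.v *)
From HB Require Import structures.
From mathcomp Require Import all_boot all_order all_algebra all_field.
From mathcomp Require Import boolp classical_sets fsbigop reals.

Set Implicit Arguments.
Unset Strict Implicit.
Unset Printing Implicit Defensive.

Import Order.TTheory GRing.Theory Num.Theory.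

Local Open Scope ring_scope.
Local Open Scope classical_set_scope.

(* Extension of scalars of a finite-dimensional algebra along a field
   morphism: A (x)_F K is the space of coordinate vectors over K with respect
   to an F-basis of A, multiplied through the structure constants of A.  The
   carrier mentions iota only so that the ring structure can be inferred. *)
Section ScalarExtension.
Variables (F K : fieldType) (iota : {rmorphism F -> K}) (A : falgType F).
Local Notation n := (\dim {:A}).
Local Notation e := (vbasis {:A}).

Definition scalar_ext of {rmorphism F -> K} : Type := 'rV[K]_n.
Local Notation AK := (scalar_ext iota).
HB.instance Definition _ := Vector.copy AK 'rV[K]_n.

Definition struct_const (i j k : 'I_n) : F := coord e k (e`_i * e`_j).

Definition scalar_ext_mul (x y : AK) : AK :=
  \row_k \sum_i \sum_j x 0 i * y 0 j * iota (struct_const i j k).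

(* x |-> x (x) 1 *)
Definition scalar_ext_in (x : A) : AK := \row_k iota (coord e k x).

Let lmx (i : 'I_n) : 'M[F]_n := \matrix_(j, k) struct_const i j k.
Let lmxK (x : AK) : 'M[K]_n := \sum_i x 0 i *: map_mx iota (lmx i).

Fact scalar_ext_mulE x y : scalar_ext_mul x y = y *m lmxK x.
Proof.
apply/rowP => k; rewrite !mxE exchange_big /=; apply: eq_bigr => j _.
rewrite summxE mulr_sumr; apply: eq_bigr => i _.
by rewrite !mxE mulrA [x 0 i * _]mulrC.
Qed.

Let lmxK_linear a x y : lmxK (a *: x + y) = a *: lmxK x + lmxK y.
Proof.
rewrite /lmxK scaler_sumr -big_split /=; apply: eq_bigr => i _.
by rewrite !mxE scalerDl scalerA.
Qed.

Let e_sum (x : A) : x = \sum_k coord e k x *: e`_k.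
Proof. exact: (coord_vbasis (memvf x)). Qed.

Let lmx_mul i j : \sum_k struct_const i j k *: lmx k = lmx j *m lmx i.
Proof.
apply/matrixP => m l; rewrite summxE !mxE.
under eq_bigr do rewrite !mxE.
have -> : \sum_k struct_const i j k * struct_const k m l
    = coord e l ((e`_i * e`_j) * e`_m).
  rewrite [e`_i * e`_j]e_sum mulr_suml linear_sum /=.
  by apply: eq_bigr => k _; rewrite -scalerAl linearZ.
rewrite -mulrA [e`_j * e`_m]e_sum mulr_sumr linear_sum /=.
by apply: eq_bigr => k _; rewrite -scalerAr linearZ !mxE.
Qed.

Let lmxK_mul x y : lmxK (scalar_ext_mul x y) = lmxK y *m lmxK x.
Proof.
rewrite /lmxK mulmx_suml.
under [RHS]eq_bigr do rewrite mulmx_sumr.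
rewrite exchange_big /=.
under [LHS]eq_bigr do rewrite mxE scaler_suml.
rewrite exchange_big /=; apply: eq_bigr => i _.
under [LHS]eq_bigr do rewrite scaler_suml.
rewrite exchange_big /=; apply: eq_bigr => j _.
rewrite -scalemxAl -scalemxAr scalerA -map_mxM -lmx_mul.
rewrite (raddf_sum (map_mx iota)) /= scaler_sumr; apply: eq_bigr => k _.
by rewrite map_mxZ scalerA [x 0 i * _]mulrC.
Qed.

Fact scalar_ext_mulA : associative scalar_ext_mul.
Proof. by move=> x y z; rewrite !scalar_ext_mulE -mulmxA -lmxK_mul scalar_ext_mulE. Qed.

Fact scalar_ext_mulDl : left_distributive scalar_ext_mul +%R.
Proof.
move=> x y z; rewrite !scalar_ext_mulE -[x in x + y]scale1r lmxK_linear.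
by rewrite scale1r mulmxDr.
Qed.

Fact scalar_ext_mulDr : right_distributive scalar_ext_mul +%R.
Proof. by move=> x y z; rewrite !scalar_ext_mulE mulmxDl. Qed.

Fact scalar_ext_inM x y :
  scalar_ext_in (x * y) = scalar_ext_mul (scalar_ext_in x) (scalar_ext_in y).
Proof.
apply/rowP => k; rewrite !mxE {1}[x]e_sum {1}[y]e_sum mulr_suml.
rewrite linear_sum rmorph_sum /=; apply: eq_bigr => i _.
rewrite mulr_sumr linear_sum rmorph_sum /=; apply: eq_bigr => j _.
by rewrite -scalerAl -scalerAr !linearZ !rmorphM !mxE mulrA.
Qed.

Let scalar_ext_in_vbasis (i : 'I_n) : scalar_ext_in e`_i = delta_mx 0 i.
Proof.
apply/rowP => k; rewrite !mxE eqxx /= coord_free ?(basis_free (vbasisP _)) //.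
by rewrite -val_eqE rmorph_nat eq_sym.
Qed.

Let row_sum_in (x : AK) :
  x = \sum_i x 0 i *: (scalar_ext_in e`_i : 'rV_n).
Proof. by rewrite {1}[x]row_sum_delta; apply: eq_bigr => i _; rewrite scalar_ext_in_vbasis. Qed.

Let mulZr x a y : scalar_ext_mul x (a *: y) = a *: scalar_ext_mul x y.
Proof. by rewrite !scalar_ext_mulE -scalemxAl. Qed.

Let mulZl a x y : scalar_ext_mul (a *: x) y = a *: scalar_ext_mul x y.
Proof.
rewrite !scalar_ext_mulE -[a *: x]addr0 lmxK_linear.
rewrite -[X in _ + lmxK X](subrr (0 : AK)).
have -> : lmxK (0 - 0) = 0.
  by rewrite subrr /lmxK big1 // => i _; rewrite mxE scale0r.
by rewrite addr0 -scalemxAr.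
Qed.

Fact scalar_ext_mul1l : left_id (scalar_ext_in 1) scalar_ext_mul.
Proof.
move=> x; rewrite [x]row_sum_in scalar_ext_mulE mulmx_suml.
by apply: eq_bigr => i _; rewrite -scalemxAl -scalar_ext_mulE -scalar_ext_inM mul1r.
Qed.

Fact scalar_ext_mul1r : right_id (scalar_ext_in 1) scalar_ext_mul.
Proof.
move=> x; rewrite [in LHS](row_sum_in x) [in RHS](row_sum_in x).
apply: (big_ind2 (fun u v => scalar_ext_mul u (scalar_ext_in 1) = v)).
- by have := mulZl 0 0 (scalar_ext_in 1); rewrite !scale0r.
- by move=> u u' v v' <- <-; rewrite scalar_ext_mulDl.
- by move=> i _; rewrite mulZl -scalar_ext_inM mulr1.
Qed.

Fact scalar_ext_one_neq0 : scalar_ext_in 1 != 0 :> AK.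
Proof.
apply/eqP => /rowP eq0; have /eqP[] := oner_neq0 A.
rewrite [1]e_sum big1 // => k _; move: (eq0 k); rewrite !mxE => /eqP.
by rewrite fmorph_eq0 => /eqP ->; rewrite scale0r.
Qed.

HB.instance Definition _ := GRing.Zmodule_isNzRing.Build AK
  scalar_ext_mulA scalar_ext_mul1l scalar_ext_mul1r
  scalar_ext_mulDl scalar_ext_mulDr scalar_ext_one_neq0.
HB.instance Definition _ := GRing.Lmodule_isLalgebra.Build K AK
  (fun a x y => esym (mulZl a x y)).
HB.instance Definition _ := GRing.Lalgebra_isAlgebra.Build K AK
  (fun a x y => esym (mulZr x a y)).
HB.instance Definition _ := Algebra_isFalgebra.Build K AK.

End ScalarExtension.

Arguments scalar_ext {F K} A iota.

(* Z_p as the inverse limit of the Z/p^n: a p-adic integer is the sequence of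
   its canonical residues modulo p^n.  The type padic_int carries the primality
   proof so that its integral domain structure can be inferred. *)
Section PadicIntegers.
Variable p : nat.

Definition coherent (x : nat -> int) : Prop :=
  forall n, x n = (x n.+1 %% (p ^ n)%N)%Z.

Fact coherent_mod (f : nat -> int) :
  (forall n, (f n.+1 = f n %[mod (p ^ n)%N])%Z) ->
  coherent (fun n => (f n %% (p ^ n)%N)%Z).
Proof.
move=> fP n; rewrite -fP expnSr PoszM.
rewrite {1}(divz_eq (f n.+1) ((p ^ n)%N%:Z * p)).
by rewrite [_ * Posz p]mulrC mulrA modzMDl.
Qed.

Hypothesis p_pr : prime p.

Definition padic_int of prime p : Type := {x : nat -> int | `[< coherent x >]}.
Local Notation Zp := (padic_int p_pr).
HB.instance Definition _ := SubChoice.copy Zp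
  {x : nat -> int | `[< coherent x >]}.

Definition residue (x : Zp) : nat -> int := val x.

Definition mk_padic (f : nat -> int)
    (fP : forall n, (f n.+1 = f n %[mod (p ^ n)%N])%Z) : Zp :=
  Sub (fun n => (f n %% (p ^ n)%N)%Z) (asboolT (coherent_mod fP)).

Let residueE f fP n : residue (@mk_padic f fP) n = (f n %% (p ^ n)%N)%Z.
Proof. by rewrite /residue SubK. Qed.

Let residueS x n : (residue x n.+1 = residue x n %[mod (p ^ n)%N])%Z.
Proof. by rewrite [residue x n](asboolW (valP x)) modz_mod. Qed.

Let residue_mod x n : (residue x n %% (p ^ n)%N)%Z = residue x n.
Proof. by rewrite [residue x n](asboolW (valP x)) modz_mod. Qed.

Let padicP x y : (forall n, residue x n = residue y n) -> x = y.
Proof. by move=> xy; apply: val_inj; apply/funext. Qed.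

Fact padic_const_subproof (a : int) n :
  ((fun=> a) n.+1 = (fun=> a) n %[mod (p ^ n)%N])%Z.
Proof. by []. Qed.

Fact padic_add_subproof x y n :
  (residue x n.+1 + residue y n.+1
   = residue x n + residue y n %[mod (p ^ n)%N])%Z.
Proof. by rewrite -modzDm !residueS modzDm. Qed.

Fact padic_opp_subproof x n :
  (- residue x n.+1 = - residue x n %[mod (p ^ n)%N])%Z.
Proof. by rewrite -modzNm residueS modzNm. Qed.

Fact padic_mul_subproof x y n :
  (residue x n.+1 * residue y n.+1
   = residue x n * residue y n %[mod (p ^ n)%N])%Z.
Proof. by rewrite -modzMm !residueS modzMm. Qed.

Definition padic_const a : Zp := mk_padic (padic_const_subproof a).
Definition padic_add x y := mk_padic (padic_add_subproof x y).
Definition padic_opp x := mk_padic (padic_opp_subproof x).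
Definition padic_mul x y := mk_padic (padic_mul_subproof x y).

Fact padic_addA : associative padic_add.
Proof.
by move=> x y z; apply: padicP => n; rewrite !residueE modzDmr modzDml addrA.
Qed.

Fact padic_addC : commutative padic_add.
Proof. by move=> x y; apply: padicP => n; rewrite !residueE addrC. Qed.

Fact padic_add0 : left_id (padic_const 0) padic_add.
Proof. by move=> x; apply: padicP => n; rewrite !residueE modzDml add0r residue_mod. Qed.

Fact padic_addN : left_inverse (padic_const 0) padic_opp padic_add.
Proof. by move=> x; apply: padicP => n; rewrite !residueE modzDml addNr. Qed.

HB.instance Definition _ := GRing.isZmodule.Build Zp
  padic_addA padic_addC padic_add0 padic_addN.

Fact padic_mulA : associative padic_mul.
Proof.
by move=> x y z; apply: padicP => n; rewrite !residueE modzMmr modzMml mulrA.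
Qed.

Fact padic_mulC : commutative padic_mul.
Proof. by move=> x y; apply: padicP => n; rewrite !residueE mulrC. Qed.

Fact padic_mul1 : left_id (padic_const 1) padic_mul.
Proof. by move=> x; apply: padicP => n; rewrite !residueE modzMml mul1r residue_mod. Qed.

Fact padic_mulDl : left_distributive padic_mul +%R.
Proof.
move=> x y z; apply: padicP => n.
by rewrite !residueE modzMml modzDm mulrDl.
Qed.

Fact padic_one_neq0 : padic_const 1 != 0.
Proof.
apply/eqP => /(congr1 (fun x => residue x 1)); rewrite !residueE expn1 mod0z.
by move/dvdz_mod0P; rewrite dvdz1 /= => /eqP p1; move: (prime_gt1 p_pr); rewrite p1.
Qed.

HB.instance Definition _ := GRing.Zmodule_isComNzRing.Build Zp
  padic_mulA padic_mulC padic_mul1 padic_mulDl padic_one_neq0.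

Definition padic_unit : {pred Zp} :=
  [pred x | `[< exists y, y * x = 1 >]].

Definition padic_inv (x : Zp) : Zp :=
  if pselect (exists y, y * x = 1) is left ex then sval (cid ex) else x.

Fact padic_mulV : {in padic_unit, left_inverse 1 padic_inv *%R}.
Proof.
move=> x /asboolP ex; rewrite /padic_inv.
case: pselect => [ex'|/(_ ex) //]; exact: svalP (cid ex').
Qed.

Fact padic_unitP (x y : Zp) : y * x = 1 -> padic_unit x.
Proof. by move=> yx1; apply/asboolP; exists y. Qed.

Fact padic_inv_out : {in [predC padic_unit], padic_inv =1 id}.
Proof.
move=> x /asboolPn nex; rewrite /padic_inv.
by case: pselect => // /nex.
Qed.

HB.instance Definition _ := GRing.ComNzRing_hasMulInverse.Build Zp
  padic_mulV padic_unitP padic_inv_out.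

Let residue_modn x n m : (residue x (n + m) = residue x n %[mod (p ^ n)%N])%Z.
Proof.
elim: m => [|m IH]; first by rewrite addn0.
rewrite -IH addnS; have /eqP := residueS x (n + m).
rewrite !eqz_mod_dvd => dvd; apply/eqP; rewrite eqz_mod_dvd.
by apply: dvdz_trans dvd; rewrite expnD PoszM dvdz_mulr.
Qed.

Let padic_neq0 x : x != 0 -> exists n, forall m,
  ~~ ((p ^ n)%N %| residue x (n + m))%Z.
Proof.
move=> x0; apply: contrapT => /forallNP x0'; have /eqP[] := x0; apply: padicP => n.
have [m] : exists m, ((p ^ n)%N %| residue x (n + m))%Z.
  by have /existsNP[m /negP/negPn] := x0' n; exists m.
move=> /dvdz_mod0P; rewrite residue_modn residue_mod => ->.
by rewrite residueE mod0z.
Qed.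

Fact padic_integral : GRing.integral_domain_axiom Zp.
Proof.
move=> x y xy0; apply/norP => -[/padic_neq0[n xn] /padic_neq0[m ym]].
have := congr1 (fun z => residue z (n + m)) xy0.
rewrite !residueE mod0z => /dvdz_mod0P.
have := ym n; have := xn m; rewrite [(m + n)%N]addnC !dvdzE /= abszM.
move: `|residue x _|%N `|residue y _|%N => a b pa pb.
have a0 : (0 < a)%N by case: a pa => //; rewrite dvdn0.
have b0 : (0 < b)%N by case: b pb => //; rewrite dvdn0.
rewrite pfactor_dvdn ?muln_gt0 ?a0 // lognM //.
rewrite !pfactor_dvdn // -!ltnNge in pa pb *.
by rewrite leqNgt -addSn; apply/negP/negPn; rewrite leq_add // ltnW.
Qed.

HB.instance Definition _ := GRing.ComUnitRing_isIntegral.Build Zp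
  padic_integral.

Fact padic_natE k n : residue k%:R n = (k%:Z %% (p ^ n)%N)%Z.
Proof.
elim: k => [|k IH]; first by rewrite residueE.
by rewrite -addn1 natrD residueE IH residueE modzDm PoszD.
Qed.

Fact padic_int_char0 k : (k%:R == 0 :> Zp) = (k == 0)%N.
Proof.
apply/eqP/eqP => [|-> //] /(congr1 (fun x => residue x k)).
rewrite padic_natE residueE mod0z modz_small; first by case.
by rewrite lez_nat /= ltz_nat ltn_expl // prime_gt1.
Qed.

Definition padic : Type := {fraction Zp}.
HB.instance Definition _ := GRing.Field.copy padic {fraction Zp}.

Fact padic_char0 k : (k%:R == 0 :> padic) = (k == 0)%N.
Proof. by rewrite -(rmorph_nat (@FracField.tofrac Zp)) tofrac_eq0 padic_int_char0. Qed.

Definition rat_to_padic : rat -> padic := ratr.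

Let padic_intr_eq0 (z : int) : (z%:~R == 0 :> padic) = (z == 0).
Proof.
case: z => n; first exact: padic_char0.
by rewrite NegzE mulrNz oppr_eq0; apply: padic_char0.
Qed.

Let rat_to_padicP (x : rat) (a b : int) : b != 0 -> x = a%:~R / b%:~R ->
  rat_to_padic x = a%:~R / b%:~R.
Proof.
move=> b0 xE; rewrite /rat_to_padic /ratr; apply/eqP.
rewrite eqr_div ?padic_intr_eq0 ?denq_neq0 // -!intrM.
suff -> : numq x * b = a * denq x by [].
apply/eqP; rewrite -(eqr_int rat) !intrM -eqr_div ?intr_eq0 ?denq_neq0 //.
by rewrite divq_num_den xE.
Qed.

Fact rat_to_padic_is_zmod_morphism : zmod_morphism rat_to_padic.
Proof.
move=> x y.
have nz (z : rat) : (denq z)%:~R != 0 :> padic by rewrite padic_intr_eq0 denq_neq0.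
have nzq (z : rat) : (denq z)%:~R != 0 :> rat by rewrite intr_eq0 denq_neq0.
rewrite (rat_to_padicP (a := numq x * denq y - numq y * denq x)
           (b := denq x * denq y)).
- by rewrite rmorphB !rmorphM /= -mulNr -addf_div // mulNr.
- by rewrite mulf_neq0 ?denq_neq0.
- rewrite rmorphB /= !rmorphM /= -mulNr -addf_div // mulNr.
  by rewrite !divq_num_den.
Qed.

Fact rat_to_padic_is_monoid_morphism : monoid_morphism rat_to_padic.
Proof.
split=> [|x y]; first by rewrite /rat_to_padic /ratr divr1.
rewrite (rat_to_padicP (a := numq x * numq y) (b := denq x * denq y)).
- by rewrite /rat_to_padic /ratr !rmorphM /= mulf_div.
- by rewrite mulf_neq0 ?denq_neq0.
- by rewrite !rmorphM /= -mulf_div !divq_num_den.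
Qed.

HB.instance Definition _ := GRing.isZmodMorphism.Build rat padic rat_to_padic
  rat_to_padic_is_zmod_morphism.
HB.instance Definition _ := GRing.isMonoidMorphism.Build rat padic rat_to_padic
  rat_to_padic_is_monoid_morphism.

End PadicIntegers.

Definition quaternion_basis (F : fieldType) (B : falgType F) (a b : F)
    (i j : B) : Prop :=
  [/\ basis_of {:B} [:: 1; i; j; i * j],
      i * i = a%:A, j * j = b%:A & j * i = - (i * j)].

(* This is the definition of a quaternion algebra in characteristic <> 2. *)
Definition is_quaternion_algebra (F : fieldType) (B : falgType F) : Prop :=
  exists a b : F, [/\ a != 0, b != 0 & exists i j : B, quaternion_basis a b i j].

Definition is_hamilton (F : fieldType) (B : falgType F) : Prop :=
  exists i j : B, quaternion_basis (-1) (-1) i j.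

Definition is_division (F : fieldType) (B : falgType F) : Prop :=
  forall x : B, x != 0 -> x \is a GRing.unit.

Section RationalAlgebras.
Variable A : falgType rat.

Definition is_definite (R : realType) : Prop :=
  is_hamilton (scalar_ext A (@ratr R : {rmorphism rat -> R})).

Definition ramified (p : nat) : Prop :=
  exists p_pr : prime p,
    is_division
      (scalar_ext A (rat_to_padic p_pr : {rmorphism rat -> padic p_pr})).

(* The product over a set is 1 by convention when the set is infinite; only
   finitely many primes are ramified in a quaternion algebra. *)
Definition reduced_disc : nat :=
  \big[muln/1%N]_(p \in [set p | ramified p]) p.

Definition is_lattice (L : set A) : Prop :=
  exists m (s : m.-tuple A), <<s>>%VS = fullv /\ L = [set x | inIntSpan s x].

Definition is_order (Ord : set A) : Prop :=
  [/\ is_lattice Ord, Ord 1 & forall x y, Ord x -> Ord y -> Ord (x * y)].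

Definition is_maximal_order (Ord : set A) : Prop :=
  is_order Ord /\ forall Ord', is_order Ord' -> Ord `<=` Ord' -> Ord' = Ord.

Definition conjugate_set (u : A) (Ord : set A) : set A :=
  [set u * x * u^-1 | x in Ord].

Definition is_maximal_order_class (C : set (set A)) : Prop :=
  exists2 Ord, is_maximal_order Ord &
    C = [set conjugate_set u Ord | u in [set u | u \is a GRing.unit]].

Definition is_right_ideal (Ord I : set A) : Prop :=
  [/\ I `<=` Ord, I 0, forall x y, I x -> I y -> I (x - y)
    & forall x y, I x -> Ord y -> I (x * y)].

(* n elements of Ord form a complete system of representatives of Ord modulo I. *)
Definition has_index (Ord I : set A) (n : nat) : Prop :=
  exists r : 'I_n -> A, (forall k, Ord (r k)) /\
    forall x, Ord x -> exists! k, I (x - r k).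

(* A right ideal of reduced norm N is one of index N ^ 2; the different is the
   unique right ideal of reduced norm reduced_disc. *)
Definition is_different (Ord D : set A) : Prop :=
  unique (fun I => is_right_ideal Ord I /\ has_index Ord I (reduced_disc ^ 2)%N) D.

Definition is_principal (Ord I : set A) : Prop :=
  exists2 pi, Ord pi & I = [set pi * x | x in Ord].

Definition has_principal_different (Ord : set A) : Prop :=
  exists2 D, is_different Ord D & is_principal Ord D.

End RationalAlgebras.

(* Main.v *)
(** A definite quaternion algebra over Q has a basis with i^2 = -D and j^2 = -q,
    where D is squarefree and q is a prime such that q = 7 (mod 8) for odd D and
    q = 3 (mod 8) for even D, such that -q is a non-residue modulo every odd prime
    divisor of D and -D = r^2 (mod q).  Such a q is found with Dirichlet's theorem
    for quadratic characters, where L(1, chi) <> 0 is read off the growth of the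
    Lambert series of chi as t tends to 1, and the basis is then found with two
    applications of Legendre's theorem on ternary forms.

    Put om = (1 + j) / 2 and q c = r^2 + D.  Ibukiyama's order
    O = Z[om] + (r + i) j^-1 Z[om] has reduced norm form
    N(w) + r (w0 s1 - w1 s0) + c N(s), where N is the norm of Z[om].  At a prime p
    dividing D the form N is anisotropic, whence i O = {x in O | D divides nrd x},
    and A is a division algebra over Q_p; at the other primes Hensel's lemma gives
    a zero divisor, so D is the discriminant.  Reduced norms are integral on
    orders, and polarising the norm of x in an order containing O gives i x in O;
    as D divides nrd (i x) this forces x in O, so O is maximal.  A right ideal I of
    index D^2 cannot contain an element whose norm is prime to some p dividing D
    (it would contain an integer prime to p, while O / I has p-torsion), so I is
    contained in i O, and both have index D^2.  Conjugating O by u amounts to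
    conjugating i and j, so this applies to the whole class of O. *)

From HB Require Import structures.
Require Import Defs.
From mathcomp Require Import all_boot all_order all_fingroup all_algebra all_solvable all_field.
From mathcomp Require Import boolp classical_sets fsbigop reals sequences exp.
From mathcomp Require Import ring lra zify.

Set Implicit Arguments.
Unset Strict Implicit.
Unset Printing Implicit Defensive.

Import Order.TTheory GRing.Theory Num.Theory FinRing.Theory.

Local Open Scope ring_scope.

(** * Quadratic reciprocity *)

(** The different has reduced norm D, so a generator of it has reduced norm D; hence the search for
    a basis whose first vector squares to -D, with D the discriminant. D is read off the local signs
    of a basis with squares -gh and -g, and Legendre's theorem takes the place of the classification
    of quaternion algebras by ramification: it turns matching signs at odd primes into explicit
    changes of basis. Legendre's criterion imposes nothing at 2, and a definite algebra ramifies at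
    an odd number of primes. The two facts are reconciled by arranging beforehand that gh is
    squarefree and even: its factor 2 absorbs a sign through the symbol (2/q). All conditions on q,
    its class modulo 8 included, prescribe values of quadratic characters, which is why Dirichlet's
    theorem is needed for real characters only. That D is the discriminant is verified afterwards,
    on the norm form over Z_p. *)

Lemma sign_int_inj (F : fieldType) (a b : int) : 2%:R != 0 :> F ->
  a \in [:: 0; 1; -1] -> b \in [:: 0; 1; -1] -> a%:~R = b%:~R :> F -> a = b.
Proof.
move=> F2; rewrite !inE.
have F1 : 1 != -1 :> F by rewrite -addr_eq0 -mulr2n.
case/or3P=> /eqP ->; case/or3P=> /eqP -> //; rewrite ?mulrN1z ?mulr1z ?mulr0z ?rmorphN //=.
- by move/esym/eqP; rewrite oner_eq0.
- by move/esym/eqP; rewrite oppr_eq0 oner_eq0.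
- by move/eqP; rewrite oner_eq0.
- by move/eqP; rewrite (negPf F1).
- by move/eqP; rewrite oppr_eq0 oner_eq0.
- by move/esym/eqP; rewrite (negPf F1).
Qed.

Section QuadraticCharacter.
Variable F : finFieldType.
Hypothesis F_odd : odd #|F|.

Lemma finField_generator : exists2 g : {unit F}, #[g]%g = #|F|.-1 &
  forall x : F, x != 0 -> exists k, x = val g ^+ k.
Proof.
have /cyclicP[g gE] : cyclic [set: {unit F}].
  exact: field_unit_group_cyclic.
exists g; first by rewrite orderE -gE card_finField_unit.
move=> x x0; have ux : x \is a GRing.unit by rewrite unitfE.
have : FinRing.unit F ux \in <[g]>%g by rewrite -gE inE.
case/cycleP=> k gk; exists k.
by have := congr1 val gk; rewrite val_unitX.
Qed.

Definition qchar (x : F) : int :=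
  if x == 0 then 0 else if [exists y, y ^+ 2 == x] then 1 else -1.

Lemma qchar_sign x : qchar x \in [:: 0; 1; -1].
Proof. by rewrite /qchar; do 2 case: ifP => //. Qed.

Let h := #|F|.-1./2.
Let hE : #|F|.-1 = h.*2.
Proof. by rewrite /h; have := F_odd; case: #|F| => //= n /even_halfK ->. Qed.

Let generator_half (g : {unit F}) : #[g]%g = #|F|.-1 -> val g ^+ h = -1 /\ -1 != 1 :> F.
Proof.
move=> og; have h0 : (0 < h)%N by have := order_gt0 g; rewrite og hE; lia.
have gh1 : val g ^+ h != 1.
  apply/eqP => E; have : (g ^+ h)%g = 1%g by apply: val_inj; rewrite val_unitX E.
  by move/eqP; rewrite -order_dvdn og hE => /dvdn_leq; lia.
have : (val g ^+ h) ^+ 2 == 1.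
  by rewrite -exprM muln2 -hE -og -val_unitX expg_order.
by rewrite sqrf_eq1 (negPf gh1) => /eqP E; split => //; rewrite -E.
Qed.

Lemma finField2_neq0 : 2%:R != 0 :> F.
Proof.
have [g og _] := finField_generator; have [_] := generator_half og.
by rewrite mulr2n addr_eq0 eq_sym.
Qed.

(** Euler's criterion. Writing [x = g ^ k] for a generator [g], a nonsquare has odd [k], and [g ^ h]
    is the square root of 1 other than 1. *)
Lemma qchar_euler x : (qchar x)%:~R = x ^+ #|F|.-1./2.
Proof.
rewrite -/h /qchar; case: eqP => [->|/eqP x0].
  have [g og _] := finField_generator; have := order_gt0 g.
  by rewrite og hE expr0n; case: (h).
have [g og gP] := finField_generator; have [gh _] := generator_half og.
have F1 (y : F) : y != 0 -> y ^+ h.*2 = 1.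
  by move=> /gP[k ->]; rewrite -exprM mulnC exprM -hE -og -val_unitX expg_order expr1n.
have [k xk] := gP x x0.
case: ifP => [/existsP[y /eqP yx]|/negbT/existsPn nsq].
  by rewrite -yx -exprM mul2n F1 // -sqrf_eq0 yx.
have : odd k.
  apply: contraR (nsq (val g ^+ k./2)) => /even_halfK kE.
  by rewrite -exprM muln2 kE xk.
by move=> ok; rewrite xk -exprM mulnC exprM gh -signr_odd ok.
Qed.

Lemma qcharM x y : qchar (x * y) = qchar x * qchar y.
Proof.
apply: (sign_int_inj finField2_neq0); rewrite ?qchar_sign //.
  have := qchar_sign x; have := qchar_sign y; rewrite !inE.
  by do 2 case/or3P=> /eqP ->.
by rewrite rmorphM /= !qchar_euler exprMn.
Qed.

Lemma qchar_eq0 x : (qchar x == 0) = (x == 0).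
Proof. by rewrite /qchar; case: ifP => // _; case: ifP. Qed.

Lemma qchar1 : qchar 1 = 1.
Proof. by rewrite /qchar oner_eq0; case: existsP => // -[]; exists 1; rewrite expr1n. Qed.

Lemma qchar_nonsquare : exists x, qchar x = -1.
Proof.
have [g og gP] := finField_generator; have [gh _] := generator_half og.
exists (val g); apply: (sign_int_inj finField2_neq0); rewrite ?qchar_sign //.
by rewrite qchar_euler -/h gh rmorphN.
Qed.
End QuadraticCharacter.

(** By Euler's theorem [d] divides [r ^ totient d - 1], the order of the cyclic unit group of the
    field with [r ^ totient d] elements. These roots of unity carry the Gauss sums below. *)
Lemma finField_unity_root (r d : nat) : prime r -> (0 < d)%N -> coprime r d ->
  exists (L : finFieldType) (z : L), r \in [pchar L] /\ d.-primitive_root z.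
Proof.
move=> r_pr d0 rd.
have phi0 : (0 < totient d)%N by rewrite totient_gt0.
have [L rL cL] := pPrimePowerField r_pr phi0.
have [g og _] := finField_generator L.
have dg : (d %| #[g]%g)%N.
  by rewrite og cL -subn1 -eqn_mod_dvd ?expn_gt0 ?prime_gt0 //; apply/eqP/Euler_exp_totient.
have dgE := divnK dg.
exists L, (val g ^+ (#[g]%g %/ d)); split => //.
have o : #[(g ^+ (#[g] %/ d))%g]%g = d.
  by rewrite orderXdiv ?dvdn_div ?dvdn_divLR // divnA // mulKn.
apply/andP; split => //; apply/forallP => i; rewrite unity_rootE.
rewrite -val_unitX -val_unitX -val_unit1 (inj_eq val_inj).
rewrite -order_dvdn o; apply/eqP; apply/idP/eqP => [/dvdn_leq|-> //].
by have := ltn_ord i; lia.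
Qed.

Lemma prim_root_nonzero (L : fieldType) n (z : L) : n.-primitive_root z -> z != 0.
Proof.
move=> zn; apply/eqP => z0; have := prim_expr_order zn.
by rewrite z0 expr0n gtn_eqF ?(prim_order_gt0 zn) // => /esym/eqP; rewrite oner_eq0.
Qed.

Definition legendre (p : nat) (n : int) : int := qchar (n%:~R : 'F_p).

Section Legendre.
Variable p : nat.
Hypotheses (p_pr : prime p) (p_odd : odd p).

Let cardF_odd : odd #|'F_p|. Proof. by rewrite card_Fp. Qed.

Lemma legendre_sign n : legendre p n \in [:: 0; 1; -1].
Proof. exact: qchar_sign. Qed.

Lemma legendreM a b : legendre p (a * b) = legendre p a * legendre p b.
Proof. by rewrite /legendre rmorphM /= qcharM. Qed.

Lemma Fp_int_eq0 (n : int) : (n%:~R == 0 :> 'F_p) = (p %| n)%Z.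
Proof.
case: n => n; rewrite ?NegzE ?dvdzN ?rmorphN ?oppr_eq0 /=;
  by rewrite -(dvdn_pcharf (pchar_Fp p_pr)).
Qed.

Lemma legendre_eq0 n : (legendre p n == 0) = (p %| n)%Z.
Proof. by rewrite qchar_eq0 Fp_int_eq0. Qed.

Lemma legendre_nat_eq0 (n : nat) : (legendre p n == 0) = (p %| n)%N.
Proof. exact: legendre_eq0. Qed.

Lemma legendre_mod a b : (a = b %[mod p])%Z -> legendre p a = legendre p b.
Proof.
move/eqP; rewrite eqz_mod_dvd -Fp_int_eq0 rmorphB subr_eq0 => /eqP.
by rewrite /legendre => ->.
Qed.

Lemma legendre1 : legendre p 1 = 1.
Proof. exact: qchar1. Qed.

Lemma Fp_int (x : 'F_p) : exists n : int, x = n%:~R.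
Proof. by exists (val x)%:Z; rewrite -[LHS]natr_Zp. Qed.

Lemma legendre_sqr n : legendre p n = 1 -> exists x : int, (p %| x ^+ 2 - n)%Z.
Proof.
rewrite /legendre /qchar; case: eqP => // _; case: existsP => // -[y /eqP yn] _.
have [x yx] := Fp_int y; exists x.
by rewrite -Fp_int_eq0 rmorphB rmorphXn /= -yx yn subrr.
Qed.

Lemma legendre_square n : ~~ (p %| n)%Z -> legendre p (n ^+ 2) = 1.
Proof.
rewrite expr2 legendreM -legendre_eq0.
by have := legendre_sign n; rewrite !inE => /or3P[] /eqP ->.
Qed.

Lemma legendre_nonresidue : exists n : nat, legendre p n = -1.
Proof.
have [x xP] := qchar_nonsquare cardF_odd; exists (val x).
by rewrite /legendre (_ : _%:~R = x) //; exact: natr_Zp.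
Qed.

(** Symbols are compared inside a field of characteristic [p] containing roots of unity; this form
    of Euler's criterion leads into that field and [sign_int_inj] leads back to the integers. *)
Lemma legendre_euler (L : fieldType) (n : int) : p \in [pchar L] ->
  (legendre p n)%:~R = n%:~R ^+ p.-1./2 :> L.
Proof.
move=> pL; have := qchar_euler cardF_odd (n%:~R : 'F_p).
rewrite card_Fp // -/(legendre p n) -rmorphXn /= => /eqP.
rewrite -subr_eq0 -rmorphB Fp_int_eq0 => /dvdzP[k E].
apply/eqP; rewrite -rmorphXn -subr_eq0 -rmorphB E rmorphM /=.
by rewrite -[p%:~R]/(p%:R) (pcharf0 pL) mulr0.
Qed.

Lemma pchar_odd_neq2 (L : fieldType) : p \in [pchar L] -> 2%:R != 0 :> L.
Proof.
move=> pL; rewrite -(dvdn_pcharf pL); apply/negP => /dvdn_leq p2.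
by have := prime_gt1 p_pr; have := p2 isT; case: p p_odd => [|[|[|]]].
Qed.

Lemma legendreN1 : p = 3 %[mod 4] -> legendre p (-1) = -1.
Proof.
move=> p3; have pF := pchar_Fp p_pr.
apply: (sign_int_inj (pchar_odd_neq2 pF)); rewrite ?legendre_sign //.
rewrite legendre_euler // rmorphN -signr_odd.
suff -> : odd p.-1./2 by rewrite expr1.
lia.
Qed.

(** For a primitive eighth root of unity [z] in characteristic [p], the sum [t = z + 1 / z]
    satisfies [t ^ 2 = 2], so [t ^ p = (2/p) t]. By Frobenius [t ^ p = z ^ p + 1 / z ^ p], which
    depends only on [p] modulo 8. *)
Lemma legendre2 : legendre p 2 = if (p %% 8 == 1)%N || (p %% 8 == 7)%N then 1 else -1.
Proof.
have cp : coprime p 8 by rewrite -[8%N]/(2 ^ 3)%N coprimeXr // coprimen2.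
have [L [z [pL z8]]] := finField_unity_root p_pr (isT : (0 < 8)%N) cp.
have L2 := pchar_odd_neq2 pL.
have z0 : z != 0 by exact: prim_root_nonzero z8.
have z4 : z ^+ 4 = -1.
  have : (z ^+ 4) ^+ 2 == 1 by rewrite -exprM (prim_expr_order z8).
  rewrite sqrf_eq1 => /orP[z41|/eqP //].
  by move: z41; rewrite -(prim_order_dvd z8).
have zV : z^-1 = - z ^+ 3.
  by apply: (mulfI z0); rewrite divff // mulrN -exprS z4 opprK.
pose t := z + z^-1.
have t2 : t ^+ 2 = 2%:R.
  by rewrite /t zV; rewrite (_ : _ ^+ 2 = z ^+ 2 + (z ^+ 4) * (z ^+ 2) - 2%:R * z ^+ 4);
    [rewrite z4; ring | ring].
have t0 : t != 0 by rewrite -sqrf_eq0 t2.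
have pp : p = (p.-1./2).*2.+1 by lia.
have tp : t ^+ p = (legendre p 2)%:~R * t.
  by rewrite legendre_euler // {1}pp exprSr -mul2n exprM t2.
have tp' : t ^+ p = z ^+ (p %% 8) + z ^- (p %% 8).
  rewrite -(pFrobenius_autE pL) rmorphD /= !pFrobenius_autE exprVn.
  by rewrite (expr_mod _ (prim_expr_order z8)).
apply: (sign_int_inj L2); rewrite ?legendre_sign //; first by case: ifP.
apply: (mulIf t0); rewrite -tp tp'.
have : (p %% 8 < 8)%N by rewrite ltn_mod.
have : odd (p %% 8)%N by lia.
move: (p %% 8)%N => r; case: r => [|[|[|[|[|[|[|[|]]]]]]]] //= _ _.
- by rewrite mul1r expr1.
- rewrite -exprVn zV /t zV rmorphN mulN1r /=.
  rewrite (_ : (- z ^+ 3) ^+ 3 = - (z ^+ 4) ^+ 2 * z); last by ring.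
  by rewrite z4; ring.
- rewrite -exprVn zV /t zV rmorphN mulN1r /=.
  rewrite (_ : (- z ^+ 3) ^+ 5 = - (z ^+ 4) ^+ 3 * z ^+ 3); last by ring.
  by rewrite (_ : z ^+ 5 = z ^+ 4 * z); [rewrite z4; ring | ring].
- rewrite -exprVn zV /t zV mul1r /=.
  rewrite (_ : (- z ^+ 3) ^+ 7 = - (z ^+ 4) ^+ 5 * z); last by ring.
  by rewrite (_ : z ^+ 7 = z ^+ 4 * z ^+ 3); [rewrite z4; ring | ring].
Qed.
End Legendre.

(* The Gauss sum [g] satisfies [g ^+ 2 = -q] and [g ^+ p = (p / q) g] in
   characteristic [p]. *)
Theorem quadratic_reciprocity3 p q : prime p -> prime q -> odd p -> p != q ->
  q = 3 %[mod 4] -> legendre q p = legendre p (- q%:Z).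
Proof.
move=> p_pr q_pr p_odd pq q3; have q_odd : odd q by lia.
have pp : p = (p.-1./2).*2.+1 by lia.
have q0 := prime_gt0 q_pr.
have cpq : coprime p q by rewrite prime_coprime // dvdn_prime2.
have [L [z [pL zq]]] := finField_unity_root p_pr q0 cpq.
have L2 := pchar_odd_neq2 p_pr p_odd pL.
have z0 : z != 0 by exact: prim_root_nonzero zq.
pose e (t : 'F_q) := z ^+ val t.
pose chi (t : 'F_q) : L := (qchar t)%:~R.
have cF : odd #|'F_q| by rewrite card_Fp.
have chiM s t : chi (s * t) = chi s * chi t by rewrite /chi qcharM // rmorphM.
have eD s t : e (s + t) = e s * e t.
  by rewrite /e -exprD -(expr_mod (_ + _) (prim_expr_order zq)) /= [X in (_ %% X)%N]Fp_cast.
have e0 : e 0 = 1 by [].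
have eM n t : e (n%:R * t) = e t ^+ n.
  by elim: n => [|n IH]; rewrite ?mul0r // -natr1 mulrDl mul1r eD IH exprSr.
have e1 : e 1 != 1.
  rewrite /e /= -[X in _ != X](expr0 z) (eq_prim_root_expr zq) mod0n.
  by rewrite [X in (1 %% X)%N]Fp_cast // modn_small ?prime_gt1 // modn_small ?prime_gt1.
have sum_e : \sum_t e t = 0.
  have : e 1 * \sum_t e t = \sum_t e t.
    rewrite [RHS](reindex (fun t => 1 + t)) /=; last first.
      by exists (fun t => t - 1) => t _; ring.
    by rewrite mulr_sumr; apply: eq_bigr => t _; rewrite eD.
  by move=> /eqP; rewrite -subr_eq0 -{2}[\sum_t e t]mul1r -mulrBl mulf_eq0 subr_eq0
    (negPf e1) => /eqP.
have unitM (b : 'F_q) : b != 0 -> {on [pred _ | true], bijective ( *%R b)}.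
  by move=> b0; exists ( *%R b^-1) => t _; rewrite ?mulKf ?mulVKf.
have sum_eM u : u != 0 -> \sum_t e (t * u) = 0.
  move=> u0; rewrite -[RHS]sum_e [RHS](reindex _ (unitM u u0)).
  by apply: eq_bigr => t _; rewrite mulrC.
have sum_chi : \sum_t chi t = 0.
  have [b bP] := qchar_nonsquare cF.
  have b0 : b != 0 by rewrite -qchar_eq0 bP.
  have : \sum_t chi t = - \sum_t chi t.
    rewrite {1}(reindex _ (unitM b b0)) -mulN1r mulr_sumr; apply: eq_bigr => t _.
    by rewrite chiM /chi bP rmorphN.
  move=> /eqP; rewrite -addr_eq0 -mulr2n -mulr_natl mulf_eq0 (negPf L2) => /eqP.
  exact.
pose g := \sum_t chi t * e t.
have chi0 : chi 0 = 0 by rewrite /chi /qchar eqxx.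
have chi_sq t : t != 0 -> chi t ^+ 2 = 1.
  rewrite -qchar_eq0 /chi; have := qchar_sign t; rewrite !inE.
  by case/or3P=> /eqP -> //; rewrite -rmorphXn.
(* After the second variable is replaced by [t u], the sum over [t] of [e (t (u + 1))] vanishes
   unless [u = -1]; that remaining term is [q] times [(-1/q) = -1]. *)
have g2 : g ^+ 2 = - q%:R.
  have -> : g ^+ 2 = \sum_t \sum_u chi u * e (t * (u + 1)).
    rewrite expr2 {2}/g mulr_sumr; apply: eq_bigr => t _.
    have [->|t0] := eqVneq t 0.
      rewrite chi0 mul0r mulr0; under eq_bigr do rewrite mul0r e0 mulr1.
      by rewrite sum_chi.
    rewrite /g mulr_suml (reindex _ (unitM t t0)); apply: eq_bigr => u _.
    rewrite mulrDr mulr1 eD chiM.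
    rewrite (_ : _ * _ = chi t ^+ 2 * (chi u * (e (t * u) * e t))); last by ring.
    by rewrite chi_sq // mul1r.
  rewrite exchange_big (bigD1 (-1)) //= [X in _ + X]big1 ?addr0.
    rewrite addNr; under eq_bigr do rewrite mulr0 e0 mulr1.
    rewrite sumr_const card_Fp // /chi -[-1]/((-1)%:~R : 'F_q) -/(legendre q (-1)).
    by rewrite legendreN1 // rmorphN mulNrn.
  move=> u u1; rewrite -mulr_sumr sum_eM ?mulr0 //.
  by apply: contra u1; rewrite addr_eq0.
have q0L : q%:R != 0 :> L by rewrite -(dvdn_pcharf pL) dvdn_prime2.
have g0 : g != 0 by rewrite -sqrf_eq0 g2 oppr_eq0.
have gp : g ^+ p = (legendre q p)%:~R * g.
  rewrite -(pFrobenius_autE pL) rmorph_sum mulr_sumr.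
  have pq0 : (p%:R : 'F_q) != 0.
    by rewrite -(dvdn_pcharf (pchar_Fp q_pr)) dvdn_prime2 // eq_sym.
  rewrite [RHS](reindex _ (unitM _ pq0)); apply: eq_bigr => t _.
  rewrite rmorphM /= !pFrobenius_autE eM chiM mulrA; congr (_ * _).
  rewrite mulrA -/(chi p%:R) -expr2 chi_sq // mul1r.
  rewrite /chi; have := qchar_sign t; rewrite !inE.
  case/or3P=> /eqP ->; first by rewrite expr0n gtn_eqF // prime_gt0.
    by rewrite expr1n.
  by rewrite rmorphN /= -signr_odd p_odd expr1.
apply: (sign_int_inj L2); rewrite ?legendre_sign //.
rewrite (legendre_euler p_pr p_odd _ pL) rmorphN /= (_ : q%:~R = q%:R) // -g2 -exprM mul2n.
by apply: (mulIf g0); rewrite -gp -[RHS]exprSr -pp.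
Qed.

(** * Primes in prescribed quadratic residue classes *)

Section Abel.
Variable (R : realFieldType).

Lemma summation_by_parts (u f : nat -> R) a b : (a <= b)%N ->
  \sum_(a <= n < b) u n * f n =
  (\sum_(a <= k < b) u k) * f b
  + \sum_(a <= n < b) (\sum_(a <= k < n.+1) u k) * (f n - f n.+1).
Proof.
elim: b => [|b IH]; first by rewrite leqn0 => /eqP ->; rewrite !big_geq // mul0r addr0.
rewrite leq_eqVlt => /predU1P[<-|]; first by rewrite !big_geq // mul0r addr0.
rewrite ltnS => ab; rewrite big_nat_recr //= IH // [in RHS]big_nat_recr //=.
rewrite [X in _ = _ + X]big_nat_recr //= [\sum_(a <= k < b.+1) u k]big_nat_recr //=.
ring.
Qed.

Lemma abel_bound (u f : nat -> R) a b C : (a <= b)%N ->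
  (forall n, (a <= n)%N -> `|\sum_(a <= k < n) u k| <= C) ->
  (forall n, (a <= n)%N -> f n.+1 <= f n) -> (forall n, (a <= n)%N -> 0 <= f n) ->
  `|\sum_(a <= n < b) u n * f n| <= C * f a.
Proof.
move=> ab uC fd f0; rewrite summation_by_parts //.
apply: le_trans (ler_normD _ _) _.
have -> : C * f a = C * f b + \sum_(a <= n < b) C * (f n - f n.+1).
  rewrite -mulr_sumr -mulrDr; congr (_ * _).
  have -> : \sum_(a <= n < b) (f n - f n.+1) = - (f b - f a).
    by rewrite -(telescope_sumr _ ab) -sumrN; apply: eq_bigr => i _; rewrite opprB.
  ring.
apply: lerD; first by rewrite normrM (ger0_norm (f0 b ab)) ler_wpM2r ?f0 ?uC.
apply: le_trans (ler_norm_sum _ _ _) _.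
rewrite big_nat [in leRHS]big_nat; apply: ler_sum => n /andP[an _].
have fn : 0 <= f n - f n.+1 by rewrite subr_ge0 fd.
by rewrite normrM (ger0_norm fn) ler_wpM2r // uC // ltnW.
Qed.
End Abel.

Section Characters.
Variables (R : realFieldType) (chi : nat -> R) (m : nat).

(* A vanishing sum over a period expresses nontriviality. *)
Definition real_char : Prop :=
  [/\ chi 1%N = 1, forall a b, chi (a * b)%N = chi a * chi b,
      forall n, [\/ chi n = 0, chi n = 1 | chi n = -1],
      forall n, chi (n + m)%N = chi n & (0 < m)%N /\ \sum_(0 <= n < m) chi n = 0].

Hypothesis chiP : real_char.

Let chi1 : chi 1%N = 1. Proof. by case: chiP. Qed.
Let chiM a b : chi (a * b)%N = chi a * chi b. Proof. by case: chiP. Qed.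
Let chiV n : [\/ chi n = 0, chi n = 1 | chi n = -1]. Proof. by case: chiP. Qed.
Let chiD n : chi (n + m)%N = chi n. Proof. by case: chiP. Qed.
Let m_gt0 : (0 < m)%N. Proof. by case: chiP => _ _ _ _ []. Qed.

Lemma char_norm_le1 n : `|chi n| <= 1.
Proof. by case: (chiV n) => ->; rewrite ?normr0 ?normrN1 ?normr1 ?ler01. Qed.

(** Whole periods cancel, so at most [m] terms of absolute value at most 1 remain. *)
Lemma char_sum_bound n : `|\sum_(0 <= k < n) chi k| <= m%:R.
Proof.
elim/ltn_ind: n => n IH; case: (leqP n m) => [nm|mn].
  apply: le_trans (ler_norm_sum _ _ _) _.
  apply: (@le_trans _ _ (\sum_(0 <= k < n) 1)).
    by apply: ler_sum => i _; apply: char_norm_le1.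
  by rewrite big_const_nat subn0 iter_addr_0 ler_nat.
rewrite (@big_cat_nat _ _ _ m) //= ?(ltnW mn) //.
have -> : \sum_(0 <= k < m) chi k = 0 by case: chiP => _ _ _ _ [].
rewrite add0r -{1}[m]add0n big_addn.
under eq_bigr do rewrite chiD.
by apply: IH; rewrite ltn_subrL m_gt0 (leq_trans _ mn).
Qed.

Lemma char_sum_bound2 a n : (a <= n)%N -> `|\sum_(a <= k < n) chi k| <= 2 * m%:R.
Proof.
move=> an; have E : \sum_(0 <= k < n) chi k = _ := big_cat_nat (leq0n a) an.
have -> : \sum_(a <= k < n) chi k
   = \sum_(0 <= k < n) chi k - \sum_(0 <= k < a) chi k.
  by rewrite E addrAC subrr add0r.
apply: le_trans (ler_normB _ _) _.
by have := char_sum_bound a; have := char_sum_bound n; lra.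
Qed.

Lemma char_abel (f : nat -> R) a b : (a <= b)%N ->
  (forall n, (a <= n)%N -> f n.+1 <= f n) -> (forall n, (a <= n)%N -> 0 <= f n) ->
  `|\sum_(a <= n < b) chi n * f n| <= 2 * m%:R * f a.
Proof. by move=> ab fd f0; apply: abel_bound => // n; apply: char_sum_bound2. Qed.

(** The partial sums of [L(1, chi)]. *)
Definition char_psum x : R := \sum_(1 <= n < x.+1) chi n / n%:R.

Lemma char_psum_cauchy x y : (x <= y)%N ->
  `|char_psum y - char_psum x| <= 2 * m%:R / x.+1%:R.
Proof.
move=> xy; have -> : char_psum y - char_psum x = \sum_(x.+1 <= n < y.+1) chi n / n%:R.
  rewrite /char_psum (@big_cat_nat _ _ _ x.+1 1 y.+1) //=; ring.
apply: (@char_abel (fun n => n%:R^-1)) => // n xn.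
  by rewrite lef_pV2 ?posrE ?ltr0n ?ler_nat // (leq_trans _ xn).
by rewrite invr_ge0 ler0n.
Qed.

End Characters.

Lemma divisors_pfactorM p a n : prime p -> (0 < n)%N -> coprime p n ->
  perm_eq (divisors (p ^ a * n)) [seq (p ^ i * d)%N | i <- iota 0 a.+1, d <- divisors n].
Proof.
move=> p_pr n0 pn; have pa0 : (0 < p ^ a * n)%N by rewrite muln_gt0 expn_gt0 prime_gt0.
apply: uniq_perm; first exact: divisors_uniq.
  apply: allpairs_uniq; rewrite ?iota_uniq ?divisors_uniq //.
  move=> [i d] [j e] /allpairsP[[i1 d1] [_ d1n [-> ->]]].
  move=> /allpairsP[[i2 d2] [_ d2n [-> ->]]] E; rewrite /= in d1n d2n E *.
  have cop x : x \in divisors n -> coprime p x /\ (0 < x)%N.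
    rewrite -dvdn_divisors // => xn; split; first exact: coprime_dvdr xn pn.
    exact: dvdn_gt0 n0 xn.
  have [[c1 p1] [c2 p2]] := (cop _ d1n, cop _ d2n).
  have eqi : i1 = i2.
    have := congr1 (logn p) E.
    by rewrite ![(p ^ _ * _)%N]mulnC !logn_Gauss // !pfactorK.
  move: E; rewrite eqi => /eqP; rewrite eqn_pmul2l ?expn_gt0 ?prime_gt0 //.
  by move=> /eqP ->.
move=> d; rewrite -dvdn_divisors //; apply/idP/allpairsP => [dn|[[i e] []]].
  have d0 : (0 < d)%N := dvdn_gt0 pa0 dn.
  have [e pe dE] := pfactor_coprime p_pr d0.
  exists (logn p d, e); split; last by rewrite /= mulnC.
    rewrite mem_iota add0n ltnS /=.
    rewrite -(@pfactorK p a) // -(@logn_Gauss p n (p ^ a)) // mulnC.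
    exact: dvdn_leq_log.
  rewrite -dvdn_divisors // -(@Gauss_dvdr e (p ^ a)) ?coprimeXr 1?coprime_sym //.
  by apply: dvdn_trans dn; rewrite dE dvdn_mulr.
rewrite [_ \in iota _ _]mem_iota add0n ltnS -dvdn_divisors //= => ia en ->.
by rewrite dvdn_mul // dvdn_exp2l.
Qed.

(** * Non-vanishing of L(1, chi) by Lambert series *)

Section Nonvanishing.
Variables (R : realType) (chi : nat -> R) (m : nat).
Hypothesis chiP : real_char chi m.

Let chi1 : chi 1%N = 1. Proof. by case: chiP. Qed.
Let chiM a b : chi (a * b)%N = chi a * chi b. Proof. by case: chiP. Qed.
Let chiV n : [\/ chi n = 0, chi n = 1 | chi n = -1]. Proof. by case: chiP. Qed.

Lemma char_exp a i : chi (a ^ i)%N = chi a ^+ i.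
Proof. by elim: i => [|i IH]; rewrite ?expn0 // expnS chiM IH exprS. Qed.

(** The coefficients of the Dirichlet series [zeta(s) L(s, chi)]. *)
Definition divsum n : R := \sum_(d <- divisors n) chi d.

Lemma divsum_pfactorM p a n : prime p -> (0 < n)%N -> coprime p n ->
  divsum (p ^ a * n) = (\sum_(0 <= i < a.+1) chi p ^+ i) * divsum n.
Proof.
move=> p_pr n0 pn; rewrite /divsum (perm_big _ (divisors_pfactorM a p_pr n0 pn)).
rewrite big_allpairs_dep mulr_suml /index_iota subn0; apply: eq_bigr => i _.
by rewrite mulr_sumr; apply: eq_bigr => d _; rewrite chiM char_exp.
Qed.

Lemma geom_signE a : \sum_(0 <= i < a.+1) (-1 : R) ^+ i = (~~ odd a)%:R.
Proof.
elim: a => [|a IH]; first by rewrite big_nat1 expr0.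
rewrite big_nat_recr //= IH; rewrite -signr_odd /=.
by case: (odd a); rewrite /= ?expr0 ?expr1 ?add0r ?subrr.
Qed.

(** By multiplicativity it is enough to look at the factor [1 + chi p + ... + chi p ^ a] of a prime
    power. For [chi p = 0] it is 1, for [chi p = 1] it is [a + 1], and for [chi p = -1] it is 1 or 0
    as [a] is even or odd. A square has only even exponents. *)
Lemma divsum_bounds n : (0 < n)%N ->
  0 <= divsum n /\ ((exists k, n = (k ^ 2)%N) -> 1 <= divsum n).
Proof.
elim/ltn_ind: n => n IH n0.
have [n1|n_gt1] := leqP n 1.
  have -> : n = 1%N by apply/eqP; rewrite eqn_leq n1.
  by rewrite /divsum (_ : divisors 1 = [:: 1%N]) // big_seq1 chi1 ler01.
set p := pdiv n; have p_pr : prime p := pdiv_prime n_gt1.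
have [k pk nE] := pfactor_coprime p_pr n0; set a := logn p n in nE *.
have k0 : (0 < k)%N by case: k nE {pk} n0 => // ->.
have a0 : (0 < a)%N by rewrite logn_gt0 mem_primes p_pr n0 pdiv_dvd.
have kn : (k < n)%N.
  rewrite nE -{1}[k]muln1 ltn_pmul2l //; apply: leq_trans (ltn_expl _ (prime_gt1 p_pr)).
  by rewrite ltnS.
have [IH0 IH1] := IH k kn k0.
rewrite nE mulnC divsum_pfactorM // big_nat_recl // expr0.
have G : 0 <= 1 + \sum_(0 <= i < a) chi p ^+ i.+1 /\
   (~~ odd a -> 1 <= 1 + \sum_(0 <= i < a) chi p ^+ i.+1).
  case: (chiV p) => ->.
  - rewrite big1 ?addr0 ?lexx ?ler01 // => i _; exact: expr0n.
  - have : 0 <= \sum_(0 <= i < a) (1 : R) ^+ i.+1.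
      by apply: sumr_ge0 => i _; rewrite expr1n ler01.
    by split => // [|_]; lra.
  - have E : 1 + \sum_(0 <= i < a) (-1 : R) ^+ i.+1 = (~~ odd a)%:R.
      by rewrite -geom_signE big_nat_recl.
    by rewrite E; case: (odd a); rewrite /= ?lexx ?ler01.
move: G => [G0 G1]; split; first exact: mulr_ge0.
case=> l lE; rewrite -[leLHS]mul1r; apply: ler_pM; rewrite ?ler01 //.
  by apply: G1; rewrite /a nE mulnC lE lognX mul2n odd_double.
apply: IH1.
have l0 : (0 < l)%N.
  have : (0 < l ^ 2)%N by rewrite -lE muln_gt0 expn_gt0 prime_gt0.
  by rewrite expn_gt0 orbF.
have [l' pl' l'E] := pfactor_coprime p_pr l0; exists l'.
have lE' : (logn p l * 2)%N = a by rewrite /a nE [(k * _)%N]mulnC lE lognX mulnC.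
apply/eqP; rewrite -(eqn_pmul2l (m := p ^ a)) ?expn_gt0 ?prime_gt0 // lE.
by rewrite {1}l'E expnMn -expnM lE' mulnC.
Qed.

Lemma divsum_dvd k M : (0 < k <= M)%N ->
  divsum k = \sum_(1 <= n < M.+1 | (n %| k)%N) chi n.
Proof.
case/andP=> k0 kM; rewrite /divsum -[RHS]big_filter; apply: perm_big.
apply: uniq_perm; rewrite ?divisors_uniq ?filter_uniq ?iota_uniq //.
move=> d; rewrite -dvdn_divisors // mem_filter mem_index_iota.
apply/idP/andP => [dk|[]//]; split=> //.
by rewrite ltnS (dvdn_gt0 k0 dk) (leq_trans (dvdn_leq k0 dk) kM).
Qed.

Section Lambert.
Variable t : R.
Hypotheses (t_gt0 : 0 < t) (t_lt1 : t < 1).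
Let subt_gt0 : 0 < 1 - t. Proof. by rewrite subr_gt0. Qed.

Let tX_le a b : (a <= b)%N -> t ^+ b <= t ^+ a.
Proof. by move=> ab; apply: ler_wiXn2l => //; apply: ltW. Qed.

Let qn n := \sum_(0 <= i < n) t ^+ i.

Let qnE n : (1 - t) * qn n = 1 - t ^+ n.
Proof.
elim: n => [|n IH]; first by rewrite /qn big_geq // expr0 mulr0 subrr.
rewrite /qn big_nat_recr //= mulrDr IH exprS; ring.
Qed.

Let qn_ge n : n%:R * t ^+ n <= qn n.
Proof.
rewrite mulr_natl -[n in _ *+ n]subn0 -sumr_const_nat.
by rewrite /qn !big_nat; apply: ler_sum => i /andP[_ /ltnW]; apply: tX_le.
Qed.

Let qn_gt0 n : (0 < n)%N -> 0 < qn n.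
Proof. by move=> n0; apply: lt_le_trans (qn_ge n); rewrite mulr_gt0 ?ltr0n ?exprn_gt0. Qed.

(* AM-GM: [t ^ i + t ^ (2 n - i) >= 2 t ^ n] *)
Let qn_pair n : 2 * n%:R * t ^+ n <= qn n * (1 + t ^+ n).
Proof.
have -> : qn n * (1 + t ^+ n) = \sum_(0 <= i < n) (t ^+ i + t ^+ (n + (n - i.+1))).
  rewrite big_split /= mulrDr mulr1; congr (_ + _).
  rewrite /qn big_nat_rev /= mulr_suml; apply: eq_bigr => i _.
  by rewrite add0n -exprD addnC.
have -> : 2 * n%:R * t ^+ n = \sum_(0 <= i < n) (2 * t ^+ n).
  by rewrite sumr_const_nat subn0 -mulr_natl; ring.
rewrite !big_nat; apply: ler_sum => i /andP[_ ni].
have H : t ^+ (n + (n - i)) <= t ^+ (n + (n - i.+1)) by apply: tX_le; lia.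
have E : t ^+ n = t ^+ i * t ^+ (n - i) by rewrite -exprD subnKC // ltnW.
rewrite exprD {1}E -mulrA in H.
have := mulr_ge0 (exprn_ge0 i (ltW t_gt0)) (sqr_ge0 (1 - t ^+ (n - i))).
rewrite E => H'; apply: le_trans (lerD (lexx _) H); move: H'; nra.
Qed.

(** The cross-multiplied form of [b n.+1 <= b n] for the sequence [b] below; the induction step
    comes from [qn_pair]. *)
Let qn_mul n : n%:R * n.+1%:R * t ^+ n <= qn n * qn n.+1.
Proof.
elim: n => [|n IH]; first by rewrite mul0r mul0r /qn big_geq // mul0r.
have E : qn n.+2 = 1 + t * qn n + t ^+ n.+1.
  rewrite /qn big_nat_recr //= big_nat_recl // expr0 mulr_sumr.
  by congr (_ + _ + _); apply: eq_bigr => i _; rewrite exprS.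
have := qn_pair n.+1; have := ler_wpM2l (ltW t_gt0) IH; rewrite E exprS.
rewrite -![n.+2%:R]natr1 -![n.+1%:R]natr1; nra.
Qed.

(** The error made when the Lambert term [t ^ n / (1 - t ^ n)] is replaced by [1 / (n (1 - t))]. It
    is nonnegative, decreasing and equal to 1 at [n = 1], so its sums against [chi] are at most
    [2 m], uniformly in [t]. *)
Let b n : R := (n%:R * (1 - t))^-1 - t ^+ n / (1 - t ^+ n).

Let bE n : (0 < n)%N -> b n = (1 - t)^-1 * (n%:R^-1 - t ^+ n / qn n).
Proof.
move=> n0; have := qn_gt0 n0; rewrite /b -qnE => q0.
have n0R : n%:R != 0 :> R by rewrite pnatr_eq0 -lt0n.
by field; rewrite n0R (gt_eqF q0) subr_eq0 eq_sym (lt_eqF t_lt1).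
Qed.

Let b_ge0 n : (0 < n)%N -> 0 <= b n.
Proof.
move=> n0; rewrite bE // mulr_ge0 ?invr_ge0 ?(ltW subt_gt0) // subr_ge0.
rewrite ler_pdivrMr ?qn_gt0 // mulrC ler_pdivlMr ?ltr0n // mulrC.
exact: qn_ge.
Qed.

Let b_dec n : (0 < n)%N -> b n.+1 <= b n.
Proof.
move=> n0; rewrite !bE // ler_wpM2l ?invr_ge0 ?(ltW subt_gt0) // -subr_ge0.
have q0 := qn_gt0 n0; have q1 := qn_gt0 (ltn0Sn n).
have n0R : 0 < n%:R :> R by rewrite ltr0n.
have n1R : 0 < n.+1%:R :> R by rewrite ltr0n.
have Eq : qn n.+1 = qn n + t ^+ n by rewrite /qn big_nat_recr.
have Eq' : t * qn n = qn n + t ^+ n - 1 by have := qnE n; lra.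
have -> : n%:R^-1 - t ^+ n / qn n - (n.+1%:R^-1 - t ^+ n.+1 / qn n.+1)
   = (qn n * qn n.+1 - n%:R * n.+1%:R * t ^+ n) / (n%:R * n.+1%:R * (qn n * qn n.+1)).
  have -> : t ^+ n.+1 / qn n.+1 = t ^+ n * (t * qn n) / (qn n * qn n.+1).
    by rewrite exprS; field; rewrite !gt_eqF.
  rewrite Eq' Eq -natr1; field; rewrite natr1 -Eq !gt_eqF //.
by rewrite divr_ge0 ?subr_ge0 ?qn_mul // ltW // !mulr_gt0.
Qed.

Let b1 : b 1 = 1.
Proof. by rewrite /b mul1r expr1; field; rewrite subr_eq0 eq_sym (lt_eqF t_lt1). Qed.

Let lambert_tail n M : (0 < n)%N ->
  t ^+ n / (1 - t ^+ n) - \sum_(1 <= k < M.+1 | (n %| k)%N) t ^+ k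
  = t ^+ (n * (M %/ n).+1) / (1 - t ^+ n).
Proof.
move=> n0; have tn : 1 - t ^+ n != 0.
  by rewrite -qnE mulf_neq0 ?gt_eqF ?qn_gt0.
elim: M => [|M IH]; first by rewrite big_geq // div0n muln1 subr0.
rewrite big_mkcond big_nat_recr //= -big_mkcond /= opprD addrA IH divnS //.
case: (boolP (n %| M.+1)%N) => [nM|_]; last by rewrite subr0 add0n.
have -> : M.+1 = (n * (M %/ n).+1)%N.
  by rewrite -[in LHS](divnK nM) divnS // nM add1n mulnC.
by rewrite add1n [in RHS]mulnS exprD; field.
Qed.

(** The Lambert sum [T] is estimated twice. Expanded in powers of [t] it is the sum of
    [divsum k * t ^ k], up to a truncation error of at most [M t ^ M / (1 - t)], and the squares up
    to [s ^ 2] alone contribute [s t ^ (s ^ 2)]. With its terms replaced by [chi n / (n (1 - t))] it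
    is [char_psum chi M / (1 - t)], up to [2 m]. *)
Lemma char_lambert_bound (s M : nat) (C : R) : (s ^ 2 <= M)%N ->
  `|char_psum chi M| <= C ->
  s%:R * t ^+ (s ^ 2) - M%:R * (t ^+ M / (1 - t)) <= C / (1 - t) + 2 * m%:R.
Proof.
move=> sM psC.
set T := \sum_(1 <= n < M.+1) chi n * (t ^+ n / (1 - t ^+ n)).
have TE : T = char_psum chi M / (1 - t) - \sum_(1 <= n < M.+1) chi n * b n.
  rewrite /T /char_psum mulr_suml -sumrB; apply: eq_big_nat => n /andP[n0 _].
  by rewrite /b invfM; ring.
have TU : T <= C / (1 - t) + 2 * m%:R.
  have /ler_normlP[+ _] : `|\sum_(1 <= n < M.+1) chi n * b n| <= 2 * m%:R.
    by have := char_abel chiP (isT : (1 <= M.+1)%N) b_dec b_ge0; rewrite b1 mulr1.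
  have : char_psum chi M / (1 - t) <= C / (1 - t).
    by rewrite ler_pM2r ?invr_gt0 // (le_trans (ler_norm _)).
  rewrite TE; lra.
have TL : \sum_(1 <= k < M.+1) divsum k * t ^+ k - M%:R * (t ^+ M / (1 - t)) <= T.
  have -> : \sum_(1 <= k < M.+1) divsum k * t ^+ k
     = \sum_(1 <= n < M.+1) chi n * \sum_(1 <= k < M.+1 | (n %| k)%N) t ^+ k.
    under eq_big_nat => k kM do rewrite (divsum_dvd (M := M)) // mulr_suml big_mkcond.
    rewrite exchange_big_nat; apply: eq_bigr => n _.
    rewrite [in RHS]big_mkcond mulr_sumr; apply: eq_bigr => k _.
    by case: ifP; rewrite ?mulr0.
  have -> : M%:R * (t ^+ M / (1 - t)) = \sum_(1 <= n < M.+1) (t ^+ M / (1 - t)).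
    by rewrite sumr_const_nat subSS subn0 mulr_natl.
  rewrite -sumrB /T; rewrite !big_nat; apply: ler_sum => n /andP[n0 nM].
  rewrite -[X in _ <= _ * X](subrK (\sum_(1 <= k < M.+1 | (n %| k)%N) t ^+ k)).
  rewrite (lambert_tail M n0) mulrDr addrC lerD2r lerNl.
  have tn : 0 < 1 - t ^+ n by rewrite -qnE mulr_gt0 ?qn_gt0.
  apply: le_trans (ler_norm _) _; rewrite normrN normrM.
  apply: le_trans (ler_pM (normr_ge0 _) (normr_ge0 _) (char_norm_le1 chiP n) (lexx _)) _.
  rewrite mul1r ger0_norm ?divr_ge0 ?exprn_ge0 ?(ltW t_gt0) ?(ltW tn) //.
  apply: ler_pM; rewrite ?exprn_ge0 ?invr_ge0 ?(ltW t_gt0) ?(ltW tn) //.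
    by apply: tX_le; rewrite mulnC; apply: ltnW; apply: ltn_ceil.
  rewrite lef_pV2 ?posrE // lerD2l lerN2 -[leRHS]expr1; exact: tX_le.
apply: le_trans TU; apply: le_trans TL; rewrite lerD2r.
have dt k : (0 < k)%N -> 0 <= divsum k * t ^+ k.
  by move=> k0; rewrite mulr_ge0 ?exprn_ge0 ?(ltW t_gt0) //; case: (divsum_bounds k0).
have mono a c : (0 < a <= c)%N ->
   \sum_(1 <= k < a) divsum k * t ^+ k <= \sum_(1 <= k < c) divsum k * t ^+ k.
  case/andP=> a0 ac; rewrite [leRHS](big_cat_nat a0 ac) /= lerDl.
  by rewrite big_nat; apply: sumr_ge0 => k /andP[ak _]; rewrite dt // (leq_trans a0).
apply: le_trans (mono (s ^ 2).+1 M.+1 _); last by rewrite ltnS.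
elim: s {sM} => [|s IH]; first by rewrite mul0r big_geq.
have s2 : (s ^ 2 < s.+1 ^ 2)%N by rewrite ltn_sqr.
rewrite big_nat_recr ?expn_gt0 //=.
have := mono (s ^ 2).+1 (s.+1 ^ 2)%N; rewrite s2 => /(_ isT).
have [_ /(_ (ex_intro _ s.+1 erefl)) d1] : 0 <= divsum (s.+1 ^ 2) /\ _ :=
  divsum_bounds (n := (s.+1 ^ 2)%N) isT.
have := ler_wpM2r (exprn_ge0 (s.+1 ^ 2) (ltW t_gt0)) d1.
have := ler_wpM2l (ler0n R s) (tX_le (ltnW s2)).
rewrite -natr1; lra.
Qed.

End Lambert.

End Nonvanishing.

Section Nonvanishing.
Variables (R : realType) (chi : nat -> R) (m : nat).
Hypothesis chiP : real_char chi m.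

Lemma leq_sqr_pow2 k : (4 <= k)%N -> (k ^ 2 <= 2 ^ k)%N.
Proof.
elim: k => // k IH; rewrite leq_eqVlt => /predU1P[<- //|]; rewrite ltnS => k4.
rewrite [(2 ^ k.+1)%N]expnS -mulnn; move: (IH k4); rewrite -mulnn; move: (2 ^ k)%N => u; nia.
Qed.

(** The excluded bound is the rate at which the partial sums would tend to 0 if [L(1, chi)] were 0.
    The Lambert sum would then stay bounded as [t] tends to 1, whereas the squares make it grow like
    [s / 2]. *)
Lemma char_psum_nonvanishing C :
  ~ (forall x, `|char_psum chi x| <= C / x.+1%:R).
Proof.
move=> CP; have C0 : 0 <= C by have := CP 0%N; rewrite divr1; apply: le_trans.
have [s sP] : exists s : nat, 2 * (C + 2 * m%:R + 1) < s%:R.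
  exists (Num.truncn (2 * (C + 2 * m%:R + 1))).+1; exact: truncnS_gt.
have s0 : (0 < s)%N.
  by rewrite -(ltr0n R); apply: le_lt_trans sP; rewrite mulr_ge0 // !addr_ge0 // mulr_ge0.
(* By Bernoulli's inequality this [y] gives [t ^ (s ^ 2) >= 1 / 2]. With [M = y ^ 3] below,
   [t ^ M <= 1 / 2 ^ (y ^ 2)], which makes the truncation error at most 1. *)
pose y := (2 * s ^ 2)%N; pose t : R := 1 - y%:R^-1.
have y2 : (2 <= y)%N by rewrite /y -{1}[2%N]muln1 leq_pmul2l // expn_gt0 s0.
have y0 : 0 < y%:R :> R by rewrite ltr0n; apply: leq_trans y2.
have yV : y%:R^-1 < 1 :> R by rewrite invf_lt1 // ltr1n.
have yV0 : 0 < y%:R^-1 :> R by rewrite invr_gt0.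
have t0 : 0 < t by rewrite /t subr_gt0.
have t1 : t < 1 by rewrite /t; lra.
pose M := (y * y ^ 2)%N.
have bern (x : R) n : -1 <= x -> 1 + n%:R * x <= (1 + x) ^+ n.
  move=> x1; elim: n => [|n IH]; first by rewrite mul0r addr0 expr0.
  have x1' : 0 <= 1 + x by lra.
  have := ler_wpM2l x1' IH; rewrite exprS; apply: le_trans.
  have := sqr_ge0 x; have := ler0n R n; rewrite -natr1; nra.
have ts : 1 / 2 <= t ^+ (s ^ 2).
  apply: le_trans (bern (- y%:R^-1) _ _); last by lra.
  rewrite /y natrM mulrN invfM mulrCA mulfV ?mulr1; first by lra.
  by rewrite pnatr_eq0 -lt0n expn_gt0 s0.
have tM : M%:R * (t ^+ M / (1 - t)) <= 1.
  have -> : 1 - t = y%:R^-1 by rewrite /t; ring.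
  rewrite invrK mulrCA -natrM.
  have tu : t <= (1 + y%:R^-1)^-1.
    by rewrite -[leRHS]mul1r ler_pdivlMr /t; nra.
  have : t ^+ M <= ((1 + y%:R^-1)^-1) ^+ M.
    by apply: lerXn2r; rewrite ?nnegrE ?invr_ge0; lra.
  have : 2 ^+ (y ^ 2) <= (1 + y%:R^-1 : R) ^+ M.
    rewrite /M exprM; apply: lerXn2r; rewrite ?nnegrE ?exprn_ge0; try lra.
    by apply: le_trans (bern _ _ _); rewrite ?mulfV ?gt_eqF //; lra.
  have : (M * y)%:R <= 2 ^+ (y ^ 2) :> R.
    rewrite -natrX ler_nat; have := leq_sqr_pow2 (k := (y ^ 2)%N).
    rewrite /M; have : (2 ^ 2 <= y ^ 2)%N by rewrite leq_sqr.
    by move=> /[swap] /[apply]; apply: leq_trans; rewrite -expnM; lia.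
  rewrite exprVn => h1 h2 h3.
  have u0 : 0 < (1 + y%:R^-1 : R) ^+ M by rewrite exprn_gt0; lra.
  apply: (le_trans (ler_wpM2r _ h3)); first by rewrite ler0n.
  by rewrite mulrC ler_pdivrMr // mul1r (le_trans h1).
have sM : (s ^ 2 <= M)%N by rewrite /M /y; nia.
have := char_lambert_bound chiP t0 t1 sM (CP M).
have -> : 1 - t = y%:R^-1 by rewrite /t; ring.
rewrite invrK => H.
have CM : C / M.+1%:R * y%:R <= C.
  rewrite mulrAC ler_pdivrMr ?ltr0n // ler_wpM2l // ler_nat.
  by rewrite leqW // leq_pmulr // expn_gt0 (leq_trans _ y2).
have tM' : M%:R * (t ^+ M * y%:R) <= 1.
  by move: tM; rewrite (_ : 1 - t = y%:R^-1) ?invrK // /t; ring.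
have := ler_wpM2l (ler0n R s) ts.
move: H CM tM' sP.
move: (s%:R * t ^+ (s ^ 2)) (M%:R * (t ^+ M * y%:R)) (C / M.+1%:R * y%:R) => a1 a2 a3.
lra.
Qed.

End Nonvanishing.

(** * Estimates of Chebyshev and Mertens *)

Lemma dvdn_prod_primes (s : seq nat) N : uniq s -> all prime s ->
  (forall p, p \in s -> (p %| N)%N) -> (\prod_(p <- s) p %| N)%N.
Proof.
elim: s => [|p s IH] /=; first by rewrite big_nil dvd1n.
move=> /andP[ps us] /andP[p_pr s_pr] sN; rewrite big_cons Gauss_dvd.
  by rewrite sN ?mem_head //= IH // => q qs; rewrite sN // inE qs orbT.
rewrite prime_coprime //; apply: contra ps; rewrite Euclid_dvd_prod //.
rewrite big_has => /hasP[q qs]; rewrite dvdn_prime2 //; last exact: (allP s_pr).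
by move=> /eqP ->.
Qed.

(** For odd [n = 2 k + 1] the primes from [k + 2] to [n] all divide the binomial coefficient of [n]
    and [k], which is at most [4 ^ k] because it occurs twice in the expansion of [(1 + 1) ^ n]. An
    even [n > 2] adds no prime. *)
Lemma primorial_le n : (\prod_(0 <= p < n.+1 | prime p) p <= 4 ^ n)%N.
Proof.
elim/ltn_ind: n => n IH; case: (leqP n 2) => [n2|n3].
  by case: n n2 {IH} => [|[|[|//]]] _; rewrite unlock.
case: (boolP (odd n)) => on; last first.
  have nprime : ~~ prime n.
    by apply: contra on => np; case: (even_prime np) => // n2; rewrite n2 in n3.
  case: n IH n3 on nprime => // n IH n3 on /negPf np.
  rewrite big_mkcond big_nat_recr //= np muln1 -big_mkcond.
  by apply: leq_trans (IH n _) _; rewrite // leq_pexp2l.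
pose k := n./2; have nE : n = k.*2.+1 by rewrite -(odd_double_half n) on.
have k0 : (0 < k)%N by lia.
rewrite (@big_cat_nat _ _ _ k.+2) /= ?nE //; try lia.
have -> : (4 ^ (k.*2.+1) = 4 ^ k.+1 * 4 ^ k)%N by rewrite -expnD; congr (4 ^ _)%N; lia.
apply: leq_mul; first by apply: IH; lia.
have C0 : (0 < 'C(k.*2.+1, k))%N by rewrite bin_gt0; lia.
apply: (@leq_trans 'C(k.*2.+1, k)).
  apply: dvdn_leq => //; rewrite -big_filter; apply: dvdn_prod_primes.
  - by rewrite filter_uniq ?iota_uniq.
  - exact: filter_all.
  move=> p; rewrite mem_filter mem_index_iota => /and3P[p_pr kp pk].
  have := bin_fact (n := k.*2.+1) (m := k) ltac:(lia).
  have : (p %| (k.*2.+1)`!)%N by rewrite dvdn_fact // prime_gt0 //; lia.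
  move=> /[swap] <-; rewrite !Euclid_dvdM //.
  have pf j : (j < p)%N -> (p %| j`!)%N = false.
    move=> jp; rewrite fact_prod Euclid_dvd_prod // big_has.
    apply/negP => /hasP[i]; rewrite mem_index_iota => /andP[i0 ij] /(dvdn_leq i0).
    by lia.
  by rewrite !pf ?orbF //; lia.
have : ('C(k.*2.+1, k) + 'C(k.*2.+1, k.+1) <= 2 ^ (k.*2.+1))%N.
  rewrite -[2%N]/(1 + 1)%N expnDn.
  under eq_bigr do rewrite !exp1n !muln1.
  have i1 : (k < k.*2.+2)%N by lia.
  have i2 : (k.+1 < k.*2.+2)%N by lia.
  rewrite (bigD1 (Ordinal i1)) //= (bigD1 (Ordinal i2)) /=; first by lia.
  by rewrite -val_eqE /=; lia.
rewrite -[in X in (_ + X <= _)%N](@bin_sub k.*2.+1 k.+1); last by lia.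
have -> : (k.*2.+1 - k.+1 = k)%N by lia.
rewrite addnn -mul2n expnS leq_pmul2l // => /leq_trans; apply.
by rewrite -(expnM 2 2) mul2n.
Qed.

Section Logarithms.
Variable R : realType.
Implicit Types (f : nat -> R).

Lemma ln_prod_nat (s : seq nat) (P : pred nat) (F : nat -> nat) :
  (forall p, P p -> (0 < F p)%N) ->
  ln (\prod_(p <- s | P p) F p)%:R = \sum_(p <- s | P p) ln (F p)%:R :> R.
Proof.
move=> F0; suff [] : (0 < \prod_(p <- s | P p) F p)%N /\
  ln (\prod_(p <- s | P p) F p)%:R = \sum_(p <- s | P p) ln (F p)%:R :> R by [].
apply: (big_ind2 (fun a b => (0 < a)%N /\ ln a%:R = b)).
- by rewrite ln1.
- move=> a b a' b' [a0 <-] [a0' <-]; split; first by rewrite muln_gt0 a0.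
  by rewrite natrM lnM ?posrE ?ltr0n.
- by move=> p Pp; split; first exact: F0.
Qed.

Lemma ln_prime_sum n x : (0 < n <= x)%N ->
  ln n%:R = \sum_(0 <= p < x.+1 | prime p)
     ln p%:R * \sum_(1 <= k < x.+1) ((p ^ k %| n)%N)%:R :> R.
Proof.
case/andP=> n0 nx; rewrite -{1}[n]partnT // (widen_partn _ nx).
rewrite ln_prod_nat; last first.
  by move=> p _; case: p => [|p]; rewrite ?expn_gt0.
rewrite [RHS]big_mkcond /=; apply: eq_bigr => p _.
case: ifPn => [p_pr|np]; last first.
  by rewrite lognE (negPf np) /= expn0 ln1.
rewrite natrX lnXn ?ltr0n ?prime_gt0 // -[LHS]mulr_natr; congr (_ * _).
have ax : (logn p n < x.+1)%N.
  by rewrite ltnS; apply: leq_trans nx; apply: ltnW; apply: ltn_logl.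
rewrite (@big_cat_nat _ _ _ (logn p n).+1) //=.
rewrite [X in _ = _ + X]big_nat [X in _ = _ + X]big1 ?addr0; last first.
  by move=> k /andP[k1 _]; rewrite pfactor_dvdn // leqNgt k1.
rewrite big_nat (eq_bigr (fun=> 1)); last first.
  by move=> k /andP[_ k1]; rewrite pfactor_dvdn // -ltnS k1.
by rewrite -big_nat sumr_const_nat subSS subn0.
Qed.

Lemma sum_dvdn f d x : (0 < d)%N ->
  \sum_(1 <= n < x.+1) f n * ((d %| n)%N)%:R = \sum_(1 <= k < (x %/ d).+1) f (d * k)%N.
Proof.
move=> d0; elim: x => [|x IH]; first by rewrite div0n !big_geq.
rewrite big_nat_recr //= IH divnS //; case: (boolP (d %| x.+1)%N) => [dx|_].
  rewrite add1n [in RHS]big_nat_recr //= mulr1; congr (_ + f _).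
  by rewrite -[LHS](divnK dx) divnS // dx add1n mulnC.
by rewrite mulr0 addr0 add0n.
Qed.

(** The logarithm is the convolution of the von Mangoldt function with 1; here the identity is
    summed against a weight [f], with the prime powers written out. *)
Lemma sum_ln f x : \sum_(1 <= n < x.+1) f n * ln n%:R =
  \sum_(0 <= p < x.+1 | prime p) ln p%:R *
     \sum_(1 <= k < x.+1) \sum_(1 <= n < (x %/ p ^ k).+1) f (p ^ k * n)%N.
Proof.
under eq_big_nat => n nx do rewrite (@ln_prime_sum n x) // mulr_sumr big_mkcond.
rewrite exchange_big_nat [RHS]big_mkcond; apply: eq_bigr => p _.
case: ifP => p_pr; last by rewrite big1.
under [in RHS]eq_bigr do rewrite -sum_dvdn ?expn_gt0 ?prime_gt0 //.
rewrite exchange_big_nat mulr_sumr; apply: eq_bigr => n _.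
by rewrite -mulr_sumr; ring.
Qed.

Lemma ln_step k : (0 < k)%N -> k%:R * (ln k.+1%:R - ln k%:R) <= 1 :> R.
Proof.
move=> k0; have kR : 0 < k%:R :> R by rewrite ltr0n.
rewrite -ln_div ?posrE ?ltr0n // -natr1 mulrDl divff ?gt_eqF // mul1r.
have : ln (1 + k%:R^-1) <= k%:R^-1 :> R.
  by apply: le_ln1Dx; apply: lt_trans (_ : 0 < _); rewrite ?invr_gt0 // ltrN10.
by move=> /(ler_wpM2l (ltW kR)); rewrite divff ?gt_eqF.
Qed.

Lemma ln_nat_ge0 n : 0 <= ln n%:R :> R.
Proof. by case: n => [|n]; [rewrite ln0 | rewrite ln_ge0 // ler1n]. Qed.

Lemma sum_ln_div_le x :
  \sum_(2 <= n < x.+1) ln n%:R / (n%:R * (n%:R - 1)) <= 2 :> R.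
Proof.
case: x => [|x]; first by rewrite big_geq.
(* A telescoping majorant: [g n - g n.+1] dominates the summand at [n.+1], and [g 1 = 2] is the
   bound. *)
pose g n : R := (ln n%:R + 2) / n%:R.
have g0 n : 0 <= g n by rewrite divr_ge0 ?addr_ge0 ?ln_nat_ge0.
apply: (@le_trans _ _ (g 1%N - g x.+1)); last first.
  by have := g0 x.+1; rewrite {2}/g ln1 divr1; lra.
elim: x => [|x IH]; first by rewrite big_geq // subrr.
rewrite big_nat_recr //=; apply: le_trans (lerD IH (_ : _ <= g x.+1 - g x.+2)) _; last lra.
have a0 : 0 < x.+1%:R :> R by rewrite ltr0n.
have b0 : 0 < x.+2%:R :> R by rewrite ltr0n.
have E : x.+2%:R = x.+1%:R + 1 :> R by rewrite natr1.
have -> : g x.+1 - g x.+2 = ((x.+1%:R + 1) * ln x.+1%:R - x.+1%:R * ln x.+2%:R + 2)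
   / (x.+2%:R * (x.+2%:R - 1)).
  rewrite /g E; move: (x.+1%:R) a0 => u u0; field.
  by apply/andP; split; rewrite gt_eqF //; lra.
have d0 : 0 < x.+2%:R * (x.+2%:R - 1) :> R by rewrite E; apply: mulr_gt0; lra.
rewrite ler_pM2r ?invr_gt0 //.
have := ln_step (ltn0Sn x); have : ln x.+2%:R - ln x.+1%:R <= 1 :> R; last by lra.
have := ln_step (ltn0Sn x); apply: le_trans.
rewrite ler_peMl ?ler1n // subr_ge0 ler_ln ?posrE ?ler_nat //.
Qed.

Lemma sum_ln_ge x : (0 < x)%N ->
  x%:R * ln x%:R - x%:R <= \sum_(1 <= n < x.+1) ln n%:R :> R.
Proof.
elim: x => // -[|x] IH _; first by rewrite big_nat1 ln1 mulr0 sub0r lerNl oppr0.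
rewrite big_nat_recr //=; apply: le_trans (lerD (IH isT) (lexx _)).
by have := ln_step (ltn0Sn x); rewrite -[x.+2%:R]natr1 ?natr1; lra.
Qed.

Lemma theta_le x : \sum_(0 <= p < x.+1 | prime p) ln p%:R <= x%:R * ln 4 :> R.
Proof.
rewrite -ln_prod_nat; last by move=> p; apply: prime_gt0.
rewrite mulr_natl -lnXn // -natrX ler_ln ?posrE ?ltr0n ?expn_gt0 //.
  by rewrite ler_nat primorial_le.
by apply: prodn_cond_gt0 => p; apply: prime_gt0.
Qed.

Lemma geom_tail_le p x : (1 < p)%N ->
  \sum_(2 <= k < x.+1) p%:R ^- k <= (p%:R * (p%:R - 1))^-1 :> R.
Proof.
move=> p1; have pR : 1 < p%:R :> R by rewrite ltr1n.
have p0 : 0 < p%:R :> R by lra.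
have d0 : 0 < p%:R * (p%:R - 1) :> R by apply: mulr_gt0; lra.
case: x => [|x]; first by rewrite big_geq ?invr_ge0 ?ltW.
suff -> : \sum_(2 <= k < x.+2) p%:R ^- k =
    (p%:R * (p%:R - 1))^-1 - (p%:R - 1)^-1 * p%:R ^- x.+1 :> R.
  by rewrite gerBl mulr_ge0 ?invr_ge0 ?exprn_ge0 ?ltW //; lra.
elim: x => [|x IH].
  by rewrite big_geq // expr1 invfM mulrC subrr.
rewrite big_nat_recr //= IH [p%:R ^+ x.+2]exprS; field.
by rewrite expf_neq0 ?gt_eqF //; lra.
Qed.

(** The proper prime powers contribute a bounded amount: summing over [k >= 2] leaves
    [ln p / (p (p - 1))], whose sum is at most 2. *)
Lemma sum_ln_primepow_le x (g : nat -> nat -> R) C : 0 <= C ->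
  (forall p k, `|g p k| <= C * p%:R ^- k) ->
  `|\sum_(0 <= p < x.+1 | prime p) ln p%:R * \sum_(2 <= k < x.+1) g p k| <= 2 * C.
Proof.
move=> C0 gC; apply: le_trans (ler_norm_sum _ _ _) _.
apply: (@le_trans _ _ (\sum_(0 <= p < x.+1 | prime p) C * (ln p%:R / (p%:R * (p%:R - 1))))).
  apply: ler_sum => p p_pr; rewrite normrM (ger0_norm (ln_nat_ge0 _)) mulrCA.
  rewrite ler_wpM2l ?ln_nat_ge0 //; apply: le_trans (ler_norm_sum _ _ _) _.
  apply: le_trans (ler_wpM2l C0 (geom_tail_le x (prime_gt1 p_pr))).
  by rewrite mulr_sumr; apply: ler_sum.
rewrite -mulr_sumr mulrC ler_wpM2r //; apply: le_trans (sum_ln_div_le x).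
have T n : (1 < n)%N -> 0 <= ln n%:R / (n%:R * (n%:R - 1)) :> R.
  move=> n1; rewrite divr_ge0 ?ln_nat_ge0 // mulr_ge0 // subr_ge0 ler1n.
  exact: ltnW.
case: x => [|[|x]].
- by rewrite big_mkcond big_nat1 big_geq.
- by rewrite big_mkcond /= big_ltn // big_nat1 addr0 big_geq.
rewrite big_mkcond /= big_ltn // big_ltn // !add0r !big_nat; apply: ler_sum => n /andP[n2 _].
by case: ifP => // _; rewrite T.
Qed.

(** The lower half of Mertens' first theorem. The logarithm of [x!] is at least [x ln x - x], and at
    most [x] times the sum on the right plus 2, the 2 accounting for proper prime powers. *)
Lemma sum_ln_prime_ge x : (0 < x)%N ->
  ln x%:R - 3 <= \sum_(0 <= p < x.+1 | prime p) ln p%:R / p%:R :> R.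
Proof.
move=> x0; have xR : 0 < x%:R :> R by rewrite ltr0n.
have := sum_ln_ge x0.
have -> : \sum_(1 <= n < x.+1) ln n%:R = \sum_(1 <= n < x.+1) 1 * ln n%:R :> R.
  by apply: eq_bigr => n _; rewrite mul1r.
rewrite (sum_ln (fun=> 1)) => H.
have : \sum_(0 <= p < x.+1 | prime p) ln p%:R *
     \sum_(1 <= k < x.+1) \sum_(1 <= n < (x %/ p ^ k).+1) 1
   <= x%:R * (\sum_(0 <= p < x.+1 | prime p) ln p%:R / p%:R + 2) :> R.
  apply: (@le_trans _ _ (x%:R * (\sum_(0 <= p < x.+1 | prime p) ln p%:R *
      \sum_(1 <= k < x.+1) p%:R ^- k))).
    rewrite mulr_sumr; apply: ler_sum => p p_pr.
    rewrite mulrCA ler_wpM2l ?ln_nat_ge0 // mulr_sumr; apply: ler_sum => k _.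
    rewrite sumr_const_nat subSS subn0 ler_pdivlMr ?exprn_gt0 ?ltr0n ?prime_gt0 //.
    by rewrite -natrX -natrM ler_nat leq_divM.
  rewrite ler_pM2l //.
  have : `|\sum_(0 <= p < x.+1 | prime p) ln p%:R * \sum_(2 <= k < x.+1) p%:R ^- k|
      <= 2 * 1 :> R.
    apply: (@sum_ln_primepow_le x (fun p k => p%:R ^- k)) => // p k.
    by rewrite mul1r ger0_norm // invr_ge0 exprn_ge0.
  move=> /(le_trans (ler_norm _)) H2.
  under eq_bigr do rewrite big_ltn // expr1 mulrDr.
  rewrite big_split /=; lra.
move=> /(le_trans H); rewrite -[X in _ - X]mulr1 -mulrBr ler_pM2l //; lra.
Qed.

End Logarithms.

(** * Sums over primes twisted by a nontrivial real character *)

Section PrimeSums.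
Variables (R : realType) (chi : nat -> R) (m : nat).
Hypothesis chiP : real_char chi m.

Let chiM a b : chi (a * b)%N = chi a * chi b. Proof. by case: chiP. Qed.

Lemma char_L_value : exists2 L : R, L != 0 &
  forall x, `|char_psum chi x - L| <= 2 * m%:R / x.+1%:R.
Proof.
pose C : R := 2 * m%:R; pose A := char_psum chi.
have C0 : 0 <= C by rewrite mulr_ge0.
(* The intervals of radius [C / x.+1] about [A x] meet pairwise, so the supremum of their left
   endpoints lies in all of them. *)
pose E : set R := [set r | exists x, r = A x - C / x.+1%:R]%classic.
have AE x y : A x - C / x.+1%:R <= A y + C / y.+1%:R.
  have Cd z : 0 <= C / z.+1%:R by rewrite divr_ge0.
  case: (leqP x y) => [xy|/ltnW yx].
    have := char_psum_cauchy chiP xy; rewrite -/A -/C => /ler_normlP[].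
    move: (Cd y) (A x) (A y); move: (C / x.+1%:R) (C / y.+1%:R) => u v v0 a b; lra.
  have := char_psum_cauchy chiP yx; rewrite -/A -/C => /ler_normlP[].
    move: (Cd x) (A x) (A y); move: (C / x.+1%:R) (C / y.+1%:R) => u v v0 a b; lra.
have E0 : (E !=set0)%classic by exists (A 0%N - C / 1%:R), 0%N.
have ubE : has_ubound E by exists (A 0%N + C / 1%:R) => _ [x ->]; apply: AE.
have LP x : `|A x - sup E| <= C / x.+1%:R.
  have h1 : A x - C / x.+1%:R <= sup E by apply: ub_le_sup => //; exists x.
  have h2 : sup E <= A x + C / x.+1%:R by apply: ge_sup => // _ [y ->]; apply: AE.
  move: h1 h2; move: (A x) (sup E) (C / _) => a b c h1 h2.
  by apply/ler_normlP; split; lra.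
exists (sup E) => //; apply/eqP => L0.
apply: (@char_psum_nonvanishing R chi m chiP C) => x.
by have := LP x; rewrite L0 subr0.
Qed.

Lemma char_sum_ln_bounded : exists B : R, forall x,
  `|\sum_(1 <= n < x.+1) chi n / n%:R * ln n%:R| <= B.
Proof.
have [L _ LP] := char_L_value.
(* [ln n / n] still increases from 1 to 2, whereas [(1 + ln n) / n] decreases from [n = 1] on; the
   difference is a partial sum of [L(1, chi)]. *)
pose f n : R := (1 + ln n%:R) / n%:R.
exists (2 * m%:R + (2 * m%:R + `|L|)) => x.
have -> : \sum_(1 <= n < x.+1) chi n / n%:R * ln n%:R =
    \sum_(1 <= n < x.+1) chi n * f n - char_psum chi x.
  by rewrite /char_psum -sumrB; apply: eq_bigr => n _; rewrite /f; ring.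
apply: le_trans (ler_normB _ _) _; apply: lerD.
  have -> : 2 * m%:R = 2 * m%:R * f 1%N by rewrite /f ln1 addr0 divr1 mulr1.
  apply: (char_abel chiP) => // n n0; rewrite /f; last first.
    by rewrite divr_ge0 // addr_ge0 // ln_nat_ge0.
  have nR : 0 < n%:R :> R by rewrite ltr0n.
  have := ln_step R n0; have := ln_nat_ge0 R n; rewrite -natr1.
  set a := ln n%:R; set b := ln _ => a0 st.
  rewrite ler_pdivrMr; last by lra.
  by rewrite mulrAC ler_pdivlMr //; lra.
rewrite -[char_psum chi x](subrK L); apply: le_trans (ler_normD _ _) _.
rewrite lerD2r; apply: le_trans (LP x) _.
by rewrite ler_pdivrMr ?ltr0n // ler_peMr ?mulr_ge0 // ler1n.
Qed.

(** Splitting [ln n] into prime powers turns the bounded sum of [chi n ln n / n] into a sum of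
    [chi p ln p / p] times [A (x %/ p)], plus proper prime powers. Replacing [A (x %/ p)] by [L]
    costs at most [C p / x] per prime, hence [C ln 4] in all by Chebyshev's bound. So [L] times the
    sum is bounded, and [L] is not 0. *)
Lemma char_prime_sum_bounded : exists B : R, forall x,
  `|\sum_(0 <= p < x.+1 | prime p) chi p * (ln p%:R / p%:R)| <= B.
Proof.
have [L L0 LP] := char_L_value; have [B BP] := char_sum_ln_bounded.
pose C : R := 2 * m%:R; have C0 : 0 <= C by rewrite mulr_ge0.
pose A := char_psum chi; pose Amax := C + `|L|.
have AP x : `|A x| <= Amax.
  rewrite -[A x](subrK L); apply: le_trans (ler_normD _ _) _; rewrite lerD2r.
  apply: le_trans (LP x) _.
  by rewrite ler_pdivrMr ?ltr0n // ler_peMr // ler1n.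
exists ((B + 2 * Amax + C * ln 4) / `|L|) => x.
rewrite ler_pdivlMr ?normr_gt0 // -normrM mulr_suml.
case: x => [|x]; first rewrite big_mkcond big_nat1 normr0.
  have := BP 0%N; rewrite big_geq // normr0 => B0.
  rewrite !addr_ge0 // mulr_ge0 ?addr_ge0 // -?[4]/(4%:R) ?ln_nat_ge0 //.
set y := x.+1; have yR : 0 < y%:R :> R by rewrite ltr0n.
have Ad d : (0 < d)%N -> \sum_(1 <= n < (y %/ d).+1) chi (d * n)%N / (d * n)%:R
     = chi d / d%:R * A (y %/ d)%N.
  move=> d0; rewrite /A /char_psum mulr_sumr; apply: eq_big_nat => n /andP[n0 _].
  by rewrite chiM natrM invfM; ring.
have := BP y; rewrite (sum_ln (fun n => chi n / n%:R)).
have -> : \sum_(0 <= p < y.+1 | prime p) ln p%:R * \sum_(1 <= k < y.+1)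
     \sum_(1 <= n < (y %/ p ^ k).+1) chi (p ^ k * n)%N / (p ^ k * n)%:R
   = \sum_(0 <= p < y.+1 | prime p) chi p * (ln p%:R / p%:R) * L
   + \sum_(0 <= p < y.+1 | prime p) chi p * (ln p%:R / p%:R) * (A (y %/ p)%N - L)
   + \sum_(0 <= p < y.+1 | prime p) ln p%:R *
       \sum_(2 <= k < y.+1) chi (p ^ k)%N / (p ^ k)%:R * A (y %/ p ^ k)%N.
  rewrite -!big_split; apply: eq_bigr => p p_pr; have p0 := prime_gt0 p_pr.
  rewrite big_ltn // expn1 Ad // -[RHS]addrA.
  under eq_bigr do rewrite Ad ?expn_gt0 ?p0 //.
  by ring.
have H2 : `|\sum_(0 <= p < y.+1 | prime p) chi p * (ln p%:R / p%:R) * (A (y %/ p)%N - L)|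
    <= C * ln 4.
  apply: le_trans (ler_norm_sum _ _ _) _.
  apply: (@le_trans _ _ (\sum_(0 <= p < y.+1 | prime p) C / y%:R * ln p%:R)).
    apply: ler_sum => p p_pr; have p0 : 0 < p%:R :> R by rewrite ltr0n prime_gt0.
    have l0 : 0 <= ln p%:R / p%:R :> R by rewrite divr_ge0 ?ln_nat_ge0.
    rewrite normrM normrM (ger0_norm l0).
    have -> : C / y%:R * ln p%:R = 1 * (ln p%:R / p%:R) * (C * p%:R / y%:R) :> R.
      by field; rewrite !gt_eqF.
    apply: ler_pM => //; first by rewrite mulr_ge0.
      by rewrite ler_wpM2r // (char_norm_le1 chiP).
    apply: le_trans (LP _) _; rewrite ler_pdivrMr ?ltr0n // mulrAC ler_pdivlMr //.
    rewrite -/C -[leRHS]mulrA ler_wpM2l // -natrM ler_nat ltnW // mulnC.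
    by rewrite ltn_ceil // prime_gt0.
  rewrite -mulr_sumr mulrAC ler_pdivrMr // -[leRHS]mulrA ler_wpM2l // [leRHS]mulrC.
  exact: theta_le.
have H3 : `|\sum_(0 <= p < y.+1 | prime p) ln p%:R *
       \sum_(2 <= k < y.+1) chi (p ^ k)%N / (p ^ k)%:R * A (y %/ p ^ k)%N| <= 2 * Amax.
  apply: sum_ln_primepow_le => [|p k]; first by rewrite addr_ge0.
  rewrite !normrM normfV natrX (ger0_norm (exprn_ge0 _ (ler0n _ _))) mulrC.
  apply: ler_pM => //; first by rewrite mulr_ge0 ?invr_ge0 ?exprn_ge0.
  by rewrite ler_piMl ?invr_ge0 ?exprn_ge0 // (char_norm_le1 chiP).
move: H2 H3; set s1 := \sum_(_ <= p < _ | _) _ * L; set s2 := \sum_(_ <= p < _ | _) _.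
set s3 := \sum_(_ <= p < _ | _) _ => /ler_normlP[] h1 h2 /ler_normlP[] h3 h4.
by move=> /ler_normlP[] h5 h6; apply/ler_normlP; split; lra.
Qed.

End PrimeSums.

(** * Dirichlet's theorem for real characters *)

Section PrimesWithPrescribedSigns.
Variables (R : realType) (m n0 : nat).
Hypotheses (m_gt0 : (0 < m)%N) (n0m : coprime n0 m).

(** Real characters to the exact modulus [m], the principal one included; the set of them is closed
    under products, unlike the nontrivial ones. *)
Definition sign_char (chi : nat -> R) : Prop :=
  [/\ chi 1%N = 1, forall a b, chi (a * b)%N = chi a * chi b,
      forall n, [\/ chi n = 0, chi n = 1 | chi n = -1],
      forall n, chi (n + m)%N = chi n & forall n, (chi n == 0) = ~~ coprime n m].

Lemma sign_charM chi psi : sign_char chi -> sign_char psi ->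
  sign_char (fun n => chi n * psi n).
Proof.
move=> [c1 cM cV cD cZ] [p1 pM pV pD pZ]; split.
- by rewrite c1 p1 mulr1.
- by move=> a b; rewrite cM pM mulrACA.
- move=> n; case: (cV n) => ->; rewrite ?mul0r ?mul1r ?mulN1r; first by constructor.
    exact: pV.
  by case: (pV n) => ->; rewrite ?oppr0 ?opprK; constructor.
- by move=> n; rewrite cD pD.
- by move=> n; rewrite mulf_eq0 cZ pZ orbb.
Qed.

(** Multiplication by [n1] permutes the residues modulo [m] and changes the sign of the sum over a
    period. *)
Lemma sign_char_nontrivial chi n1 : sign_char chi -> chi n1 = -1 -> real_char chi m.
Proof.
move=> [c1 cM cV cD cZ] cn1; split=> //; split=> //.
have n1m : coprime n1 m.
  by rewrite -[coprime _ _]negbK -cZ cn1 oppr_eq0 oner_eq0.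
have cmod n : chi (n %% m)%N = chi n.
  rewrite [in RHS](divn_eq n m); elim: (n %/ m)%N => [|k IH]; first by rewrite mul0n.
  by rewrite mulSn -addnA addnC cD.
rewrite big_mkord; set S := \sum_(_ < _) _.
have : - S = S.
  pose f (i : 'I_m) := Ordinal (ltn_pmod (n1 * i) m_gt0).
  have f_inj : injective f.
    move=> i j /(congr1 val) /= /eqP; rewrite -/(_ == _ %[mod m])%N => H.
    apply: val_inj; rewrite /= -(modn_small (ltn_ord i)) -(modn_small (ltn_ord j)).
    wlog ij : i j H / (i <= j)%N.
      by move=> W; case: (leqP i j) => [/W|/ltnW /W]; [exact|rewrite eq_sym => /(_ H)].
    apply/eqP; rewrite eq_sym eqn_mod_dvd //.
    move: H; rewrite eq_sym eqn_mod_dvd ?leq_mul2l ?ij ?orbT // -mulnBr.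
    by rewrite Gauss_dvdr // coprime_sym.
  rewrite [in RHS]/S (reindex_inj f_inj) /= -mulN1r mulr_sumr.
  by apply: eq_bigr => i _; rewrite cmod cM cn1.
by move=> /eqP; rewrite eq_sym -addr_eq0 -mulr2n mulrn_eq0 /= => /eqP.
Qed.

(** At a prime [p] not dividing [m] the product is nonzero precisely when every [c] in [s] takes the
    same value at [p] as at [n0]. The extra factor [chi] lets the product be expanded one character
    at a time. *)
Definition weighted_prime_sum (s : seq (nat -> R)) (chi : nat -> R) (x : nat) : R :=
  \sum_(0 <= p < x.+1 | prime p)
    chi p * (\prod_(c <- s) (1 + c n0 * c p)) * (ln p%:R / p%:R).

Lemma weighted_prime_sum_cons c s chi x : weighted_prime_sum (c :: s) chi x =
  weighted_prime_sum s chi x + c n0 * weighted_prime_sum s (fun n => c n * chi n) x.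
Proof.
rewrite /weighted_prime_sum mulr_sumr -big_split; apply: eq_bigr => p _.
by rewrite big_cons /=; ring.
Qed.

(** Expanding the product gives products of characters, each multiplied by its value at [n0]. A
    product that takes the value -1 has a bounded prime sum; one that does not is nonnegative
    everywhere. Since principal products may occur, only a lower bound can hold. *)
Lemma weighted_prime_sum_bounded s chi : (forall c, List.In c s -> sign_char c) ->
  sign_char chi -> exists B, forall x, - B <= chi n0 * weighted_prime_sum s chi x.
Proof.
elim: s chi => [|c s IH] chi sP chiP.
  case: (pselect (exists n1, chi n1 = -1)) => [[n1 cn1]|triv].
    have [B BP] := char_prime_sum_bounded (sign_char_nontrivial chiP cn1).
    exists B => x; have -> : weighted_prime_sum [::] chi x =
      \sum_(0 <= p < x.+1 | prime p) chi p * (ln p%:R / p%:R).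
      by apply: eq_bigr => p _; rewrite big_nil mulr1.
    have := BP x; set S := \sum_(_ <= _ < _ | _) _ => /ler_normlP[h1 h2].
    have h3 := le_trans (normr_ge0 _) (BP x).
    case: chiP => _ _ cV _ _.
    by case: (cV n0) => ->; rewrite ?mul0r ?mul1r ?mulN1r; lra.
  exists 0 => x; rewrite oppr0; case: chiP => _ _ cV _ _.
  have c0 n : 0 <= chi n.
    by case: (cV n) => [->|->|E] //; case: triv; exists n.
  rewrite mulr_ge0 ?c0 //; apply: sumr_ge0 => p _.
  by rewrite big_nil mulr1 mulr_ge0 ?c0 // divr_ge0 ?ln_nat_ge0.
have cP : sign_char c by apply: sP; left.
have sP' d : List.In d s -> sign_char d by move=> ds; apply: sP; right.
have [B BP] := IH chi sP' chiP.
have [B' BP'] := IH _ sP' (sign_charM cP chiP).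
exists (B + B') => x; rewrite weighted_prime_sum_cons.
by have := BP x; have := BP' x; lra.
Qed.

Definition principal_char (n : nat) : R := (coprime n m)%:R.

Lemma sign_char_principal : sign_char principal_char.
Proof.
split; rewrite /principal_char.
- by rewrite coprime1n.
- by move=> a b; rewrite coprimeMl -natrM mulnb.
- by move=> n; case: coprime; constructor.
- by move=> n; rewrite -(coprime_modl (n + m)) modnDr coprime_modl.
- by move=> n; case: coprime; rewrite ?oner_eq0 ?eqxx.
Qed.

(** Each character added to [s] changes the sum by an amount bounded below. For empty [s] the sum
    diverges by Mertens' bound, [K] dominating the primes that divide [m]. *)
Lemma weighted_prime_sum_unbounded s : (forall c, List.In c s -> sign_char c) ->
  forall B, exists x, B < weighted_prime_sum s principal_char x.
Proof.
have pr0 := sign_char_principal.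
elim: s => [|c s IH] sP B.
  pose K : R := \sum_(0 <= p < m.+1) ln p%:R / p%:R.
  have T p : 0 <= ln p%:R / p%:R :> R by rewrite divr_ge0 ?ln_nat_ge0.
  have [x x0 xP] : exists2 x, (m < x)%N & B + K + 3 < ln x%:R.
    pose y := expR (`|B + K + 3| + 1); exists (maxn m.+1 (Num.truncn y).+1).
      by rewrite leq_max leqnn.
    have h : `|B + K + 3| + 1 < ln (maxn m.+1 (Num.truncn y).+1)%:R.
      rewrite -[X in X < _]expRK ltr_ln ?posrE ?expR_gt0 ?ltr0n ?leq_max //.
      apply: lt_le_trans (_ : (Num.truncn y).+1%:R <= _); first exact: truncnS_gt.
      by rewrite ler_nat leq_max leqnn orbT.
    by apply: le_lt_trans h; have := ler_norm (B + K + 3); lra.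
  exists x; have := sum_ln_prime_ge R (leq_ltn_trans (leq0n m) x0).
  suff : \sum_(0 <= p < x.+1 | prime p) ln p%:R / p%:R <=
     weighted_prime_sum [::] principal_char x + K by lra.
  have KE : K = \sum_(0 <= p < x.+1) (p <= m)%:R * (ln p%:R / p%:R).
    rewrite (@big_cat_nat _ _ _ m.+1) //=; last by rewrite ltnS ltnW.
    rewrite [X in _ = _ + X]big_nat [X in _ = _ + X]big1 ?addr0; last first.
      by move=> p /andP[mp _]; rewrite leqNgt mp mul0r.
    rewrite /K !big_nat; apply: eq_bigr => p /andP[_ pm].
    by rewrite -ltnS pm mul1r.
  rewrite KE /weighted_prime_sum big_mkcond [X in _ <= X + _]big_mkcond -big_split /=.
  apply: ler_sum => p _; case: ifP => p_pr; last by rewrite add0r mulr_ge0.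
  rewrite big_nil mulr1 -mulrDl ler_peMl // /principal_char.
  rewrite prime_coprime //; case: (boolP (p %| m)%N) => [pm|_].
    by rewrite add0r (dvdn_leq m_gt0 pm).
  by rewrite lerDl ler0n.
have cP : sign_char c by apply: sP; left.
have sP' d : List.In d s -> sign_char d by move=> ds; apply: sP; right.
have [B' BP'] := weighted_prime_sum_bounded sP' (sign_charM cP pr0).
have [x xP] := IH sP' (B + B').
exists x; rewrite weighted_prime_sum_cons; have := BP' x.
rewrite [principal_char n0]/principal_char n0m mulr1; lra.
Qed.

(** Were there no such prime, at each prime coprime to [m] some factor [1 + c n0 * c p] would be 0,
    and the weighted sum would vanish for all [x]. *)
Theorem exists_prime_sign_chars s : (forall c, List.In c s -> sign_char c) ->
  exists q, [/\ prime q, coprime q m & forall c, List.In c s -> c q = c n0].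
Proof.
move=> sP; apply: contrapT => noq.
have [x] := weighted_prime_sum_unbounded sP 0; rewrite /weighted_prime_sum.
rewrite big1 ?ltxx // => p p_pr; rewrite /principal_char.
case: (boolP (coprime p m)) => [pm|_]; last by rewrite !mul0r.
have [c cs /eqP cp] : exists2 c, List.In c s & c p <> c n0.
  apply: contrapT => noc; apply: noq; exists p; split => // c cs.
  by apply: contrapT => cp; apply: noc; exists c.
have [_ _ cV _ cZ] := sP c cs.
suff -> : \prod_(c <- s) (1 + c n0 * c p) = 0 by rewrite mulr0 mul0r.
elim: s cs {sP noq} => //= d s IH [dc|cs]; rewrite big_cons; last by rewrite IH ?mulr0.
rewrite dc.
move: cp (cZ p) (cZ n0); rewrite pm n0m /=.
by case: (cV p) => ->; case: (cV n0) => ->; rewrite ?eqxx // => *;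
  rewrite ?mulrN1 ?mulr1 ?subrr ?mul0r.
Qed.

End PrimesWithPrescribedSigns.

Lemma In_mapP (T U : Type) (g : T -> U) (s : seq T) y :
  List.In y (map g s) <-> exists2 x, List.In x s & g x = y.
Proof.
elim: s => [|a s IH] /=; first by split=> // -[].
split=> [[<-|/IH[x xs <-]]|[x [->|xs] gx]]; [by exists a => //; left|by exists x => //; right|by left|].
by right; apply/IH; exists x.
Qed.

Lemma In_memP (T : eqType) (s : seq T) x : List.In x s <-> x \in s.
Proof.
elim: s => [|a s IH] //=; rewrite inE; split=> [[->|/IH ->]|/predU1P[->|/IH]].
- by rewrite eqxx.
- by rewrite orbT.
- by left.
- by right.
Qed.

Definition chi4 (n : nat) : int :=
  if (n %% 4 == 1)%N then 1 else if (n %% 4 == 3)%N then -1 else 0.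

Definition chi8 (n : nat) : int :=
  if (n %% 8 == 1)%N || (n %% 8 == 7)%N then 1
  else if (n %% 8 == 3)%N || (n %% 8 == 5)%N then -1 else 0.

Lemma chi4M a b : chi4 (a * b) = chi4 a * chi4 b.
Proof.
rewrite /chi4 -modnMm; have := ltn_pmod a (isT : (0 < 4)%N).
have := ltn_pmod b (isT : (0 < 4)%N); move: (a %% 4)%N (b %% 4)%N => u v.
by case: v => [|[|[|[|//]]]] _; case: u => [|[|[|[|//]]]] _.
Qed.

Lemma chi8M a b : chi8 (a * b) = chi8 a * chi8 b.
Proof.
rewrite /chi8 -modnMm; have := ltn_pmod a (isT : (0 < 8)%N).
have := ltn_pmod b (isT : (0 < 8)%N); move: (a %% 8)%N (b %% 8)%N => u v.
by case: v => [|[|[|[|[|[|[|[|//]]]]]]]] _; case: u => [|[|[|[|[|[|[|[|//]]]]]]]] _.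
Qed.

Lemma chi48_inj a b : odd a -> chi4 a = chi4 b -> chi8 a = chi8 b -> a = b %[mod 8].
Proof.
rewrite /chi4 /chi8 => oa.
have {oa} : odd (a %% 8) by lia.
rewrite -(modn_dvdm a (isT : (4 %| 8)%N)) -(modn_dvdm b (isT : (4 %| 8)%N)).
have := ltn_pmod a (isT : (0 < 8)%N).
have := ltn_pmod b (isT : (0 < 8)%N); move: (a %% 8)%N (b %% 8)%N => u v.
by case: v => [|[|[|[|[|[|[|[|//]]]]]]]] _; case: u => [|[|[|[|[|[|[|[|//]]]]]]]] _.
Qed.

(** Multiplication by the principal character brings characters of different conductors to the
    common modulus [m]. *)
Lemma sign_char_of_int (R : realType) m (f : nat -> int) :
  f 1%N = 1 -> (forall a b, f (a * b)%N = f a * f b) ->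
  (forall n, f n \in [:: 0; 1; -1]) -> (forall n, f (n + m)%N = f n) ->
  (forall n, coprime n m -> f n != 0) ->
  sign_char m (fun n => (f n)%:~R * principal_char R m n).
Proof.
move=> f1 fM fV fD fZ; have [p1 pM pV pD pZ] := sign_char_principal R m; split.
- by rewrite f1 p1 mulr1.
- by move=> a b; rewrite fM pM rmorphM mulrACA.
- move=> n; rewrite /principal_char; case: coprime; rewrite ?mulr0 ?mulr1; last by constructor.
  by have := fV n; rewrite !inE => /or3P[] /eqP ->; [constructor 1|constructor 2|constructor 3].
- by move=> n; rewrite fD pD.
- move=> n; rewrite mulf_eq0 pZ intr_eq0; case: (boolP (coprime n m)) => [/fZ|]; last by rewrite orbT.
  by move=> /negPf ->.
Qed.

Lemma exists_residue_class (ps : seq nat) (delta : nat -> int) c :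
  uniq ps -> all prime ps -> all odd ps ->
  (forall p, p \in ps -> delta p \in [:: 1; -1]) ->
  exists n, n = c %[mod 8] /\ forall p, p \in ps -> legendre p n = delta p.
Proof.
elim: ps => [|p ps IH] /=; first by exists c.
move=> /andP[pps ups] /andP[p_pr ps_pr] /andP[po pso] dP.
have [|n [nc nP]] := IH ups ps_pr pso; first by move=> q qs; rewrite dP // inE qs orbT.
have [b bP] : exists b : nat, legendre p b = delta p.
  have := dP p (mem_head _ _); rewrite !inE => /orP[] /eqP ->.
    by exists 1%N; apply: legendre1.
  exact: legendre_nonresidue.
pose M := (8 * \prod_(q <- ps) q)%N.
have cM : coprime M p.
  rewrite coprimeMl; apply/andP; split.
    by rewrite -[8%N]/(2 ^ 3)%N coprimeXl // coprime2n.
  rewrite big_seq; apply: (big_ind (fun x => coprime x p)) => [|x y|q qs]; first exact: coprime1n.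
    by rewrite coprimeMl => -> ->.
  rewrite coprime_sym prime_coprime // dvdn_prime2 //; last exact: (allP ps_pr).
  by apply: contra pps => /eqP ->.
exists (chinese M p n b); split.
  have := chinese_modl cM n b => H.
  rewrite -(modn_dvdm (chinese _ _ _ _) (dvdn_mulr _ (dvdnn 8) : (8 %| M)%N)) H.
  by rewrite modn_dvdm ?dvdn_mulr.
move=> q; rewrite inE => /predU1P[->|qs].
  rewrite -bP; apply: legendre_mod => //.
  by apply/eqP; rewrite !modz_nat; apply/eqP; congr Posz; exact: chinese_modr.
rewrite -(nP q qs); have q_pr := allP ps_pr q qs; apply: legendre_mod => //.
rewrite !modz_nat; congr Posz.
have qM : (q %| M)%N by rewrite dvdn_mull // (big_rem q) //= dvdn_mulr.
by rewrite -(modn_dvdm (chinese _ _ _ _) qM) chinese_modl // modn_dvdm.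
Qed.

(** An odd class modulo 8 is determined by the two characters [chi4] and [chi8], so real characters
    suffice; the class [n] to be hit comes from the Chinese remainder theorem. *)
Theorem exists_prime_residues (R : realType) (ps : seq nat) (delta : nat -> int) c :
  uniq ps -> all prime ps -> all odd ps -> odd c ->
  (forall p, p \in ps -> delta p \in [:: 1; -1]) ->
  exists q, [/\ prime q, q = c %[mod 8] & forall p, p \in ps -> legendre p q = delta p].
Proof.
move=> ups ps_pr pso oc dP; have [n [nc nP]] := exists_residue_class c ups ps_pr pso dP.
pose m := (8 * \prod_(p <- ps) p)%N.
have m0 : (0 < m)%N.
  rewrite muln_gt0 /= big_seq; apply: prodn_cond_gt0 => p /(allP ps_pr); exact: prime_gt0.
have on : odd n by lia.
have m8 : (8 %| m)%N by rewrite dvdn_mulr.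
have psm p : p \in ps -> (p %| m)%N.
  by move=> pp; rewrite dvdn_mull // (big_rem p) //= dvdn_mulr.
have odd_m k : coprime k m -> odd k.
  by move=> /(coprime_dvdr (dvdn_trans (isT : 2 %| 8) m8)%N); rewrite coprimen2.
have nm : coprime n m.
  rewrite coprimeMr; apply/andP; split; first by rewrite -[8%N]/(2 ^ 3)%N coprimeXr // coprimen2.
  rewrite big_seq; apply: (big_ind (fun x => coprime n x)) => [|x y|p pp]; first exact: coprimen1.
    by rewrite coprimeMr => -> ->.
  have p_pr := allP ps_pr p pp.
  rewrite coprime_sym prime_coprime // -legendre_nat_eq0 //.
  by rewrite nP //; have := dP p pp; rewrite !inE => /orP[] /eqP ->.
pose S : seq (nat -> int) := [:: chi4, chi8 & [seq (fun k : nat => legendre p k) | p <- ps]].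
pose ext (f : nat -> int) (k : nat) : R := (f k)%:~R * principal_char R m k.
have SP f : List.In f S -> sign_char m (ext f).
  have modm (d k : nat) : (d %| m)%N -> ((k + m) %% d = k %% d)%N.
    by move=> /dvdnP[t ->]; rewrite addnC modnMDl.
  move=> /= [<-|[<-|]].
  - apply: sign_char_of_int => //; first exact: chi4M.
    + by move=> k; rewrite /chi4; case: ifP => // _; case: ifP.
    + by move=> k; rewrite /chi4 modm // (dvdn_trans _ m8).
    + move=> k /odd_m ok; rewrite /chi4.
      have : odd (k %% 4) by lia.
      by have := ltn_pmod k (isT : (0 < 4)%N); case: (k %% 4)%N => [|[|[|[|]]]].
  - apply: sign_char_of_int => //; first exact: chi8M.
    + by move=> k; rewrite /chi8; case: ifP => // _; case: ifP.
    + by move=> k; rewrite /chi8 modm.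
    + move=> k /odd_m ok; rewrite /chi8.
      have : odd (k %% 8) by lia.
      by have := ltn_pmod k (isT : (0 < 8)%N); case: (k %% 8)%N => [|[|[|[|[|[|[|[|]]]]]]]].
  move=> /In_mapP[p /In_memP pp <-]; have p_pr := allP ps_pr p pp.
  have po := allP pso p pp; apply: sign_char_of_int => //.
  + exact: legendre1.
  + by move=> a b; rewrite -legendreM.
  + by move=> k; apply: legendre_sign.
  + by move=> k; apply: legendre_mod => //; rewrite !modz_nat modm // psm.
  + move=> k km; rewrite legendre_nat_eq0 // -prime_coprime //.
    by rewrite coprime_sym; apply: coprime_dvdr km; apply: psm.
have SP' f : List.In f (map ext S) -> sign_char m f by move=> /In_mapP[g gS <-]; apply: SP.
have [q [q_pr qm qP]] := exists_prime_sign_chars m0 nm SP'.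
have qS f : List.In f S -> f q = f n.
  move=> fS; have := qP (ext f); rewrite /ext /principal_char qm nm !mulr1 => H.
  by apply/eqP; rewrite -(eqr_int R); apply/eqP/H/In_mapP; exists f.
exists q; split => // [|p pp].
  by rewrite -nc; apply: chi48_inj; [exact: odd_m|apply: qS; left|apply: qS; right; left].
rewrite -nP //; apply: (qS (fun k : nat => legendre p k)); right; right.
by apply/In_mapP; exists p => //; apply/In_memP.
Qed.

(** * Legendre's theorem on ternary quadratic forms *)

Definition squarefree (n : nat) : Prop := forall p, prime p -> ~~ (p ^ 2 %| n)%N.

Lemma squarefree_gt0 n : squarefree n -> (0 < n)%N.
Proof. by case: n => // /(_ 2%N isT). Qed.

Lemma squarefree_dvdn m n : (m %| n)%N -> squarefree n -> squarefree m.
Proof. by move=> mn sn p p_pr; apply: contra (sn p p_pr) => /dvdn_trans; apply. Qed.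

Lemma squarefreeM m n : coprime m n -> squarefree m -> squarefree n -> squarefree (m * n).
Proof.
move=> mn sm sn p p_pr; apply/negP => pmn.
have [pm|pm] := boolP (p %| m)%N.
  have pn : coprime p n by apply: coprime_dvdl mn.
  by move: pmn; rewrite Gauss_dvdl ?coprimeXl // (negPf (sm p p_pr)).
by move: pmn; rewrite Gauss_dvdr ?coprimeXl ?prime_coprime // (negPf (sn p p_pr)).
Qed.

Lemma dvdz_square_cong (k x y m : int) :
  (k %| x - y)%Z -> (k %| y ^+ 2 - m)%Z -> (k %| x ^+ 2 - m)%Z.
Proof.
move=> kxy kym; have -> : x ^+ 2 - m = (x - y) * (x + y) + (y ^+ 2 - m) by ring.
by rewrite rpredD // dvdz_mulr.
Qed.

Lemma square_mod_squarefree (n : nat) (m : int) : squarefree n ->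
  (forall p, prime p -> odd p -> (p %| n)%N -> exists x : int, (p %| x ^+ 2 - m)%Z) ->
  exists u : int, (n %| u ^+ 2 - m)%Z.
Proof.
elim/ltn_ind: n => n IH sn nP; have n0 := squarefree_gt0 sn.
have [n1|n_gt1] := leqP n 1.
  by exists 0; have -> : n = 1%N by [lia|]; rewrite dvd1z.
set p := pdiv n; have p_pr : prime p := pdiv_prime n_gt1.
have [k nE] := dvdnP (pdiv_dvd n).
have kn : (k %| n)%N by rewrite nE dvdn_mulr.
have cpk : coprime p k.
  rewrite prime_coprime //; apply: contra (sn p p_pr) => pk.
  by rewrite nE mulnC -mulnn dvdn_mul.
have [u1 u1P] : exists u1 : int, (k %| u1 ^+ 2 - m)%Z.
  apply: IH.
  - have k0 : (0 < k)%N by rewrite (dvdn_gt0 n0).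
    by rewrite nE -{1}[k]muln1 ltn_pmul2l // prime_gt1.
  - exact: squarefree_dvdn sn.
  - by move=> r r_pr ro rk; apply: nP => //; apply: dvdn_trans kn.
have [u2 u2P] : exists u2 : int, (p %| u2 ^+ 2 - m)%Z.
  have [po|pe] := boolP (odd p); first by apply: nP => //; apply: pdiv_dvd.
  (* Modulo 2 every integer is its own square, so the prime 2 imposes no condition. *)
  exists m; have -> : p = 2%N by case: (even_prime p_pr) => // po; rewrite po in pe.
  have [h [mE|mE]] : exists h : int, m = h * 2 \/ m = h * 2 + 1 by exists (m %/ 2)%Z; lia.
    by rewrite mE (_ : _ - _ = 2 * (h ^+ 2 * 2 - h)); [rewrite dvdz_mulr | ring].
  by rewrite mE (_ : _ - _ = 2 * (h ^+ 2 * 2 + h)); [rewrite dvdz_mulr | ring].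
have cpkz : coprimez p k by [].
exists (zchinese p k u2 u1).
rewrite nE mulnC PoszM Gauss_dvdz //; apply/andP; split.
  by apply: dvdz_square_cong u2P; rewrite -eqz_mod_dvd zchinese_modl.
by apply: dvdz_square_cong u1P; rewrite -eqz_mod_dvd zchinese_modr.
Qed.

Lemma exists_sqrt_floor n : exists2 X : nat, (0 < X)%N & ((X.-1) ^ 2 <= n < X ^ 2)%N.
Proof.
elim: n => [|n [X X0 /andP[lo hi]]]; first by exists 1%N.
have [lt|ge] := ltnP n.+1 (X ^ 2); first by exists X => //; rewrite lt andbT ltnW // ltnS.
exists X.+1 => //; rewrite /= ge /=; apply: leq_ltn_trans (_ : X ^ 2 < _)%N => //.
by rewrite ltn_sqr.
Qed.

Lemma ord_diff_sqr n (i j : 'I_n) : (i%:Z - j%:Z) ^+ 2 <= (n.-1 ^ 2)%N%:Z.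
Proof.
have h : `|i%:Z - j%:Z| <= n.-1%:Z.
  by have := ltn_ord i; have := ltn_ord j; move: (val i) (val j) => k l; lia.
by rewrite -mulnn PoszM -expr2 -real_normK ?num_real // lerXn2r // nnegrE.
Qed.

(** Three linear congruences modulo [a], [b], [c] make the form [f] divisible by each of them, hence
    by [a b c]. A box with more than [a b c] points contains two points satisfying the same
    congruences, and its side lengths confine [f] at their difference to 0, [a b c] and [2 a b c].
    The last value forces [y ^ 2 = a c], which gives the zero [(c, 0, y)]. *)
Theorem legendre_ternary (a b c : nat) (u v w : int) :
  (0 < a)%N -> (0 < b)%N -> (0 < c)%N ->
  coprime a b -> coprime b c -> coprime a c ->
  (a %| u ^+ 2 - (b * c)%N%:Z)%Z -> (b %| v ^+ 2 - (a * c)%N%:Z)%Z -> (c %| w ^+ 2 + (a * b)%N%:Z)%Z ->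
  exists x y z : int, [|| x != 0, y != 0 | z != 0] /\
    a%:Z * x ^+ 2 + b%:Z * y ^+ 2 = c%:Z * z ^+ 2.
Proof.
move=> a0 b0 c0 ab bc ac uP vP wP.
have [X X0 /andP[Xlo Xhi]] := exists_sqrt_floor (b * c).
have [Y Y0 /andP[Ylo Yhi]] := exists_sqrt_floor (a * c).
(* Taking the predecessor keeps [Z ^ 2 >= a b], enough for the count, and makes [z ^ 2 < a b]
   strict, which excludes the value [- a b c] of [f]. *)
have [Z Z0 /andP[Zlo Zhi]] := exists_sqrt_floor (a * b).-1.
have XYZ : (a * b * c < X * Y * Z)%N.
  rewrite -ltn_sqr !expnMn.
  have -> : (a ^ 2 * b ^ 2 * c ^ 2 = (b * c) * (a * c) * (a * b))%N by rewrite -!mulnn; ring.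
  apply: leq_trans (_ : X ^ 2 * Y ^ 2 * (a * b) <= _)%N.
    rewrite ltn_pmul2r ?muln_gt0 ?a0 //.
    by apply: ltn_mul.
  by rewrite leq_mul2l; apply/orP; right; move: Zhi; rewrite prednK ?muln_gt0 ?a0.
pose res (n : nat) (t : int) : 'I_n.-1.+1 := inord `|(t %% n)%Z|%N.
have resP n s t : (0 < n)%N -> res n s = res n t -> (n %| s - t)%Z.
  move=> n0; have nz : n%:Z != 0 by rewrite eqz_nat -lt0n.
  have ge x : 0 <= (x %% n)%Z by rewrite modz_ge0.
  have lt x : (`|(x %% n)%Z| < n.-1.+1)%N.
    by rewrite prednK // -ltz_nat (gez0_abs (ge x)) ltz_pmod.
  move=> /(congr1 val); rewrite /res /= (inordK (lt s)) (inordK (lt t)).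
  move=> /(congr1 Posz); rewrite (gez0_abs (ge s)) (gez0_abs (ge t)) => /eqP.
  by rewrite eqz_mod_dvd.
pose F (t : 'I_X * 'I_Y * 'I_Z) :=
  let: (x, y, z) := t in
  (res a (b%:Z * y%:Z - u * z%:Z), res b (a%:Z * x%:Z - v * z%:Z), res c (a%:Z * x%:Z - w * y%:Z)).
have [Finj|] := boolP (injectiveb F).
  have := leq_card F (injectiveP _ Finj).
  by rewrite !card_prod !card_ord !prednK // leqNgt XYZ.
case/injectivePn=> -[[x1 y1] z1] [[[x2 y2] z2] ne [E1 E2 E3]].
pose x : int := x1%:Z - x2%:Z; pose y : int := y1%:Z - y2%:Z; pose z : int := z1%:Z - z2%:Z.
have D1 : (a %| b%:Z * y - u * z)%Z.
  by have := resP _ _ _ a0 E1; congr (_ %| _)%Z; rewrite /y /z; ring.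
have D2 : (b %| a%:Z * x - v * z)%Z.
  by have := resP _ _ _ b0 E2; congr (_ %| _)%Z; rewrite /x /z; ring.
have D3 : (c %| a%:Z * x - w * y)%Z.
  by have := resP _ _ _ c0 E3; congr (_ %| _)%Z; rewrite /x /y; ring.
have nz : [|| x != 0, y != 0 | z != 0].
  rewrite -!negb_and; apply: contra ne => /and3P[].
  rewrite !subr_eq0 !eqz_nat => /eqP ex /eqP ey /eqP ez.
  by rewrite !xpair_eqE -!val_eqE /= ex ey ez !eqxx.
pose f : int := a%:Z * x ^+ 2 + b%:Z * y ^+ 2 - c%:Z * z ^+ 2.
have fa : (a %| f)%Z.
  rewrite -(@Gauss_dvdzr a b) //.
  have -> : b%:Z * f = a%:Z * (b%:Z * x ^+ 2) + (b%:Z * y - u * z) * (b%:Z * y + u * z)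
      + (u ^+ 2 - (b * c)%N%:Z) * z ^+ 2 by rewrite /f PoszM; ring.
  by rewrite !rpredD // ?dvdz_mulr.
have fb : (b %| f)%Z.
  rewrite -(@Gauss_dvdzr b a) 1?coprimez_sym //.
  have -> : a%:Z * f = b%:Z * (a%:Z * y ^+ 2) + (a%:Z * x - v * z) * (a%:Z * x + v * z)
      + (v ^+ 2 - (a * c)%N%:Z) * z ^+ 2 by rewrite /f PoszM; ring.
  by rewrite !rpredD // ?dvdz_mulr.
have fc : (c %| f)%Z.
  rewrite -(@Gauss_dvdzr c a) 1?coprimez_sym //.
  have -> : a%:Z * f = - (c%:Z * (a%:Z * z ^+ 2)) + (a%:Z * x - w * y) * (a%:Z * x + w * y)
      + (w ^+ 2 + (a * b)%N%:Z) * y ^+ 2 by rewrite /f PoszM; ring.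
  by rewrite !rpredD ?rpredN // ?dvdz_mulr.
have [k fk] : exists k : int, f = k * (a%:Z * b%:Z * c%:Z).
  apply/dvdzP; rewrite Gauss_dvdz ?Gauss_dvdz ?fa ?fb ?fc //.
  by rewrite coprimezE abszM /= coprimeMl ac bc.
have bx : x ^+ 2 <= (b * c)%N%:Z by apply: le_trans (ord_diff_sqr x1 x2) _; rewrite lez_nat.
have by_ : y ^+ 2 <= (a * c)%N%:Z by apply: le_trans (ord_diff_sqr y1 y2) _; rewrite lez_nat.
have bz : z ^+ 2 < (a * b)%N%:Z.
  apply: le_lt_trans (ord_diff_sqr z1 z2) _; rewrite ltz_nat.
  by apply: leq_ltn_trans Zlo _; rewrite prednK ?muln_gt0 ?a0.
have A0 : 0 < a%:Z by []. have B0 : 0 < b%:Z by []. have C0 : 0 < c%:Z by [].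
have sx := sqr_ge0 x; have sy := sqr_ge0 y; have sz := sqr_ge0 z.
rewrite !PoszM in bx by_ bz.
have T0 : 0 < a%:Z * b%:Z * c%:Z by rewrite !mulr_gt0.
have klo : -1 < k.
  rewrite -(ltr_pM2r T0) -fk /f mulN1r.
  have := ler_wpM2l (ltW A0) sx; have := ler_wpM2l (ltW B0) sy.
  have : c%:Z * z ^+ 2 < c%:Z * (a%:Z * b%:Z) by rewrite ltr_pM2l.
  clear; lra.
have khi : k <= 2.
  rewrite -(ler_pM2r T0) -fk /f.
  have := ler_wpM2l (ltW A0) bx; have := ler_wpM2l (ltW B0) by_.
  have := ler_wpM2l (ltW C0) sz; clear; lra.
have : [|| k == 0, k == 1 | k == 2] by move: klo khi; clear; lia.
case/or3P=> /eqP kE; rewrite kE in fk.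
- by exists x, y, z; split => //; apply/eqP; rewrite -subr_eq0 -/f fk mul0r.
(* Here [a x ^ 2 + b y ^ 2 = c (z ^ 2 + a b)]. Multiplying by [z ^ 2 + a b] makes the right side [c]
   times a square, and composition of forms rewrites the left side in the shape
   [a X ^ 2 + b Y ^ 2]. *)
- exists (x * z + b%:Z * y), (y * z - a%:Z * x), (z ^+ 2 + a%:Z * b%:Z); split.
    apply/or3P; constructor 3; apply/negP => /eqP E.
    have : 0 < a%:Z * b%:Z by rewrite mulr_gt0.
    by move: sz E; clear; lra.
  have -> : a%:Z * (x * z + b%:Z * y) ^+ 2 + b%:Z * (y * z - a%:Z * x) ^+ 2 =
     (f + c%:Z * z ^+ 2) * (z ^+ 2 + a%:Z * b%:Z) by rewrite /f; ring.
  by rewrite fk; ring.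
- exists c%:Z, 0, y; split; first by rewrite gt_eqF.
  have E : y ^+ 2 = a%:Z * c%:Z.
    apply/le_anti; rewrite by_ /= -(ler_pM2l B0).
    have := ler_wpM2l (ltW A0) bx; have := ler_wpM2l (ltW C0) sz.
    by move: fk; rewrite /f; clear; lra.
  by rewrite E; ring.
Qed.

(** * Quaternion algebras *)

Section Quaternions.
Variables (F : fieldType) (B : falgType F).

Definition quat (i j : B) (x0 x1 x2 x3 : F) : B :=
  x0%:A + x1 *: i + x2 *: j + x3 *: (i * j).

Definition qnorm (a b x0 x1 x2 x3 : F) : F :=
  x0 ^+ 2 - a * x1 ^+ 2 - b * x2 ^+ 2 + a * b * x3 ^+ 2.

Lemma quatD i j x0 x1 x2 x3 y0 y1 y2 y3 :
  quat i j x0 x1 x2 x3 + quat i j y0 y1 y2 y3 =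
  quat i j (x0 + y0) (x1 + y1) (x2 + y2) (x3 + y3).
Proof. by rewrite /quat !scalerDl (addrACA _ (x3 *: _)) (addrACA _ (x2 *: _)) (addrACA _ (x1 *: _)). Qed.

Lemma quatZ i j c x0 x1 x2 x3 :
  c *: quat i j x0 x1 x2 x3 = quat i j (c * x0) (c * x1) (c * x2) (c * x3).
Proof. by rewrite /quat !scalerDr !scalerA. Qed.

Lemma quatN i j x0 x1 x2 x3 :
  - quat i j x0 x1 x2 x3 = quat i j (- x0) (- x1) (- x2) (- x3).
Proof. by rewrite -scaleN1r quatZ !mulN1r. Qed.

Lemma quat_scalar i j c : quat i j c 0 0 0 = c%:A.
Proof. by rewrite /quat !scale0r !addr0. Qed.

Lemma quat_i i j : quat i j 0 1 0 0 = i.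
Proof. by rewrite /quat !scale0r scale1r !addr0 add0r. Qed.

Section Relations.
Variables (a b : F) (i j : B).
Hypotheses (ii : i * i = a%:A) (jj : j * j = b%:A) (ji : j * i = - (i * j)).
Local Notation q := (quat i j).

Let mul_iq x0 x1 x2 x3 : i * q x0 x1 x2 x3 = q (a * x1) x0 (a * x3) x2.
Proof.
rewrite /quat !mulrDr -!scalerAr mulr1 ii mulrA ii -!scalerAl mul1r !scalerA.
by rewrite [x1 * a]mulrC [x3 * a]mulrC [x0 *: i + _]addrC -!addrA; congr (_ + (_ + _)); rewrite addrC.
Qed.

Let mul_jq x0 x1 x2 x3 : j * q x0 x1 x2 x3 = q (b * x2) (- (b * x3)) x0 (- x1).
Proof.
rewrite /quat !mulrDr -!scalerAr mulr1 jj ji mulrA ji mulNr -mulrA jj -scalerAr mulr1.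
rewrite !scalerN !scalerA !scaleNr [x2 * b]mulrC [x3 * b]mulrC.
by rewrite [LHS](ACl (3 * 4 * 1 * 2)).
Qed.

Lemma quatM x0 x1 x2 x3 y0 y1 y2 y3 : q x0 x1 x2 x3 * q y0 y1 y2 y3 =
  q (x0 * y0 + a * x1 * y1 + b * x2 * y2 - a * b * x3 * y3)
    (x0 * y1 + x1 * y0 - b * x2 * y3 + b * x3 * y2)
    (x0 * y2 + x2 * y0 + a * x1 * y3 - a * x3 * y1)
    (x0 * y3 + x3 * y0 + x1 * y2 - x2 * y1).
Proof.
rewrite {1}/quat !mulrDl -!scalerAl mul1r -[i * j * _]mulrA mul_jq !mul_iq !quatZ !quatD.
by congr quat; ring.
Qed.

Lemma quat_normM x0 x1 x2 x3 :
  q x0 x1 x2 x3 * q x0 (- x1) (- x2) (- x3) = (qnorm a b x0 x1 x2 x3)%:A.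
Proof. by rewrite quatM -(quat_scalar i j); congr quat; rewrite /qnorm; ring. Qed.

Lemma quat_normMl x0 x1 x2 x3 :
  q x0 (- x1) (- x2) (- x3) * q x0 x1 x2 x3 = (qnorm a b x0 x1 x2 x3)%:A.
Proof. by rewrite quatM -(quat_scalar i j); congr quat; rewrite /qnorm; ring. Qed.

Lemma qnormM x0 x1 x2 x3 y0 y1 y2 y3 :
  qnorm a b (x0 * y0 + a * x1 * y1 + b * x2 * y2 - a * b * x3 * y3)
    (x0 * y1 + x1 * y0 - b * x2 * y3 + b * x3 * y2)
    (x0 * y2 + x2 * y0 + a * x1 * y3 - a * x3 * y1)
    (x0 * y3 + x3 * y0 + x1 * y2 - x2 * y1)
  = qnorm a b x0 x1 x2 x3 * qnorm a b y0 y1 y2 y3.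
Proof. by rewrite /qnorm; ring. Qed.

Lemma quat_trace x0 x1 x2 x3 :
  q x0 x1 x2 x3 * q x0 x1 x2 x3 =
  (2 * x0) *: q x0 x1 x2 x3 - (qnorm a b x0 x1 x2 x3)%:A.
Proof. by rewrite quatM quatZ -(quat_scalar i j) quatN quatD; congr quat; rewrite /qnorm; ring. Qed.

Hypotheses (F2 : 2%:R != 0 :> F) (a0 : a != 0) (b0 : b != 0).

Let natZ (x : F) : 2 * x = 0 -> x = 0.
Proof. by move=> /eqP; rewrite mulf_eq0 (negPf F2) => /eqP. Qed.

Let scalar0 (c : F) : c%:A = 0 :> B -> c = 0.
Proof. by move=> /eqP; rewrite scaler_eq0 oner_eq0 orbF => /eqP. Qed.

(* Conjugation by i, then by j, isolates the coordinates. *)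
Lemma quat_eq0 x0 x1 x2 x3 : q x0 x1 x2 x3 = 0 -> [/\ x0 = 0, x1 = 0, x2 = 0 & x3 = 0].
Proof.
have half y0 y1 : q y0 y1 0 0 = 0 -> y0 = 0 /\ y1 = 0.
  move=> E; have : q 0 0 1 0 * q y0 y1 0 0 * q 0 0 1 0 + b *: q y0 y1 0 0 = 0.
    by rewrite E mulr0 mul0r scaler0 addr0.
  rewrite !quatM quatZ quatD => E1.
  have y00 : y0 = 0.
    apply: natZ; apply: (mulfI b0); rewrite mulr0; apply: scalar0.
    by rewrite -(quat_scalar i j) -[RHS]E1; congr quat; ring.
  split => //; have : q 0 1 0 0 * q y0 y1 0 0 = 0 by rewrite E mulr0.
  rewrite quatM y00 => E2; apply: (mulfI a0); rewrite mulr0; apply: scalar0.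
  by rewrite -(quat_scalar i j) -[RHS]E2; congr quat; ring.
move=> E; have : q 0 1 0 0 * q x0 x1 x2 x3 * q 0 1 0 0 + a *: q x0 x1 x2 x3 = 0.
  by rewrite E mulr0 mul0r scaler0 addr0.
rewrite !quatM quatZ quatD => E1.
have [] : 2 * (a * x0) = 0 /\ 2 * (a * x1) = 0.
  by apply: half; rewrite -[RHS]E1; congr quat; ring.
move=> /natZ/eqP; rewrite mulf_eq0 (negPf a0) => /eqP x00.
move=> /natZ/eqP; rewrite mulf_eq0 (negPf a0) => /eqP x10.
have : q x0 x1 x2 x3 * q 0 0 1 0 = 0 by rewrite E mul0r.
rewrite quatM x00 x10 => E2.
have [] : b * x2 = 0 /\ b * x3 = 0 by apply: half; rewrite -[RHS]E2; congr quat; ring.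
move=> /eqP; rewrite mulf_eq0 (negPf b0) => /eqP x20.
move=> /eqP; rewrite mulf_eq0 (negPf b0) => /eqP x30.
by [].
Qed.

Lemma quat_inj x0 x1 x2 x3 y0 y1 y2 y3 :
  q x0 x1 x2 x3 = q y0 y1 y2 y3 -> [/\ x0 = y0, x1 = y1, x2 = y2 & x3 = y3].
Proof.
move=> /eqP; rewrite -subr_eq0 quatN quatD => /eqP /quat_eq0[] /subr0_eq -> /subr0_eq ->.
by move=> /subr0_eq -> /subr0_eq ->.
Qed.

(** Linear independence follows from the relations alone, so only the dimension is left to check. *)
Lemma quaternion_basis_of_relations : \dim {:B} = 4 -> quaternion_basis a b i j.
Proof.
move=> dimB; split => //; rewrite basisEfree subvf dimB leqnn !andbT.
change (free [tuple 1; i; j; i * j]); apply/freeP => k.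
rewrite !big_ord_recl big_ord0 addr0 /= => E.
have [|k0 k1 k2 k3] := @quat_eq0 (k ord0) (k (lift ord0 ord0))
  (k (lift ord0 (lift ord0 ord0))) (k (lift ord0 (lift ord0 (lift ord0 ord0)))).
  by rewrite /quat -!addrA.
move=> m; case: (unliftP ord0 m) => [m1|] -> //; case: (unliftP ord0 m1) => [m2|] -> //.
by case: (unliftP ord0 m2) => [m3|] -> //; case: (unliftP ord0 m3) => [[]|->].
Qed.

End Relations.

Lemma quaternion_basis_quat (a b : F) (i j : B) : quaternion_basis a b i j ->
  forall x, exists x0 x1 x2 x3, x = quat i j x0 x1 x2 x3.
Proof.
case=> /andP[/eqP sp _] _ _ _ x.
have : x \in span [tuple 1; i; j; i * j] by rewrite sp memvf.
move=> /coord_span; rewrite !big_ord_recl big_ord0 addr0 /= => ->.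
by do 4 eexists; rewrite /quat -!addrA.
Qed.

Lemma quaternion_basis_dim (a b : F) (i j : B) : quaternion_basis a b i j -> \dim {:B} = 4.
Proof. by case=> bB _ _ _; have := @size_basis _ _ _ _ [tuple 1; i; j; i * j] bB. Qed.

Definition has_quaternion_basis (a b : F) : Prop := exists i j : B, quaternion_basis a b i j.

(** Two pure quaternions anticommute when they are orthogonal for the norm form, which is the last
    hypothesis; their squares are the scalars [A'] and [B']. *)
Lemma change_quaternion_basis (a b x1 x2 x3 y1 y2 y3 : F) (A' B' : F) : 2%:R != 0 :> F ->
  has_quaternion_basis a b -> A' != 0 -> B' != 0 ->
  A' = a * x1 ^+ 2 + b * x2 ^+ 2 - a * b * x3 ^+ 2 ->
  B' = a * y1 ^+ 2 + b * y2 ^+ 2 - a * b * y3 ^+ 2 ->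
  a * x1 * y1 + b * x2 * y2 - a * b * x3 * y3 = 0 ->
  has_quaternion_basis A' B'.
Proof.
move=> F2 [i [j ij]] A0 B0 AE BE orth; have dimB := quaternion_basis_dim ij.
case: (ij) => _ ii jj ji.
exists (quat i j 0 x1 x2 x3), (quat i j 0 y1 y2 y3).
apply: quaternion_basis_of_relations => //.
- by rewrite (quatM ii jj ji) AE -(quat_scalar i j); congr quat; ring.
- by rewrite (quatM ii jj ji) BE -(quat_scalar i j); congr quat; ring.
rewrite !(quatM ii jj ji) quatN; congr quat; try ring.
by rewrite mul0r !add0r orth oppr0 -[RHS]orth; ring.
Qed.

End Quaternions.

(** * Bases with squarefree parameters of even product *)

Lemma squarefree_coprime m n : squarefree (m * n) -> coprime m n.
Proof.
move=> smn; have := squarefree_gt0 smn; rewrite muln_gt0 => /andP[m0 n0].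
have g0 : (0 < gcdn m n)%N by rewrite gcdn_gt0 m0.
rewrite /coprime eqn_leq g0 andbT leqNgt; apply/negP => /pdivP[p p_pr].
rewrite dvdn_gcd => /andP[pm pn].
by apply/negP: (smn p p_pr); rewrite negbK -mulnn dvdn_mul.
Qed.

Lemma squarefree_part n : (0 < n)%N -> exists s t, [/\ n = (s * t ^ 2)%N, (0 < t)%N & squarefree s].
Proof.
elim/ltn_ind: n => n IH n0.
case: (pselect (squarefree n)) => [sn|nsn]; first by exists n, 1%N; rewrite muln1.
have [p p_pr pn] : exists2 p, prime p & (p ^ 2 %| n)%N.
  apply: contrapT => H; apply: nsn => p p_pr; apply/negP => pn; apply: H.
  by exists p.
have [k nE] := dvdnP pn.
have k0 : (0 < k)%N by rewrite lt0n; apply: contraTneq n0 => k0; rewrite nE k0.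
have p2 : (1 < p ^ 2)%N by rewrite -(exp1n 2) ltn_sqr prime_gt1.
have [|s [t [kE t0 ss]]] := IH k _ k0; first by rewrite nE -{1}[k]muln1 ltn_pmul2l.
exists s, (t * p)%N; split => //; last by rewrite muln_gt0 t0 prime_gt0.
by rewrite nE kE expnMn mulnA.
Qed.

Lemma rat_squarefree_part (r : rat) : 0 < r ->
  exists s t, [/\ r = s%:R * t ^+ 2, t != 0 & squarefree s].
Proof.
move=> r0; have n0 : 0 < numq r by rewrite numq_gt0.
have N0 : (0 < `|numq r| * `|denq r|)%N by rewrite muln_gt0 !absz_gt0 gt_eqF ?gt_eqF.
have [s [t [E t0 ss]]] := squarefree_part N0.
have d0 : (denq r)%:~R != 0 :> rat by rewrite intr_eq0 denq_neq0.
exists s, (t%:R / (denq r)%:~R); split => //; last first.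
  by rewrite mulf_neq0 ?invr_eq0 // pnatr_eq0 -lt0n.
have : (numq r * denq r)%:~R = s%:R * t%:R ^+ 2 :> rat.
  rewrite -natrX -natrM -E -[RHS]/((_ : nat)%:Z%:~R) PoszM !gez0_abs ?denq_ge0 //.
  exact: ltW.
rewrite rmorphM /= => E'; rewrite expr_div_n mulrA -E' -{1}[r]divq_num_den.
by field.
Qed.

Section NormalForm.
Variable A : falgType rat.
Local Notation hasb := (has_quaternion_basis A).

Let rat2 : 2%:R != 0 :> rat. Proof. by []. Qed.
Let natr0 n : (0 < n)%N -> n%:R != 0 :> rat.
Proof. by rewrite pnatr_eq0 -lt0n. Qed.

Lemma has_basis_sym a b : a != 0 -> b != 0 -> hasb a b -> hasb b a.
Proof.
by move=> a0 b0 h; apply: (@change_quaternion_basis _ _ a b 0 1 0 1 0 0) => //; ring.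
Qed.

Lemma has_basis_scale a b s : a != 0 -> b != 0 -> s != 0 -> hasb (a * s ^+ 2) b -> hasb a b.
Proof.
move=> a0 b0 s0 h; apply: (@change_quaternion_basis _ _ (a * s ^+ 2) b s^-1 0 0 0 1 0) => //;
  by field.
Qed.

Lemma has_basis_squarefree a b : a < 0 -> b < 0 -> hasb a b ->
  exists u v, [/\ squarefree u, squarefree v & hasb (- u%:R) (- v%:R)].
Proof.
move=> a0 b0 h.
have na : 0 < - a by rewrite oppr_gt0.
have nb : 0 < - b by rewrite oppr_gt0.
have [u [s [uE s0 su]]] := rat_squarefree_part na.
have [v [t [vE t0 sv]]] := rat_squarefree_part nb.
have u0 := natr0 (squarefree_gt0 su); have v0 := natr0 (squarefree_gt0 sv).
exists u, v; split => //.
apply: (has_basis_scale (s := s)); rewrite ?oppr_eq0 // mulNr -uE opprK.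
apply: has_basis_sym; rewrite ?oppr_eq0 ?(lt_eqF a0) //.
apply: (has_basis_scale (s := t)); rewrite ?oppr_eq0 ?(lt_eqF a0) // mulNr -vE opprK.
by apply: has_basis_sym; rewrite ?(lt_eqF a0) ?(lt_eqF b0).
Qed.

(* The pure quaternions i, j, ij/g have squares -gh, -gk, -hk. *)
Lemma has_basis_rotate g h k : (0 < g)%N -> (0 < h)%N -> (0 < k)%N ->
  hasb (- (g * h)%:R) (- (g * k)%:R) -> hasb (- (h * g)%:R) (- (h * k)%:R).
Proof.
move=> g0 h0 k0 H; have [G Hh K] := And3 (natr0 g0) (natr0 h0) (natr0 k0).
apply: (@change_quaternion_basis _ _ _ _ 1 0 0 0 0 g%:R^-1 _ _ rat2 H).
- by rewrite oppr_eq0 natr0 // muln_gt0 h0.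
- by rewrite oppr_eq0 natr0 // muln_gt0 h0.
- by rewrite !natrM; field.
- by rewrite !natrM; field.
- by rewrite !natrM; field.
Qed.

(** The basis of [k i + g h j] and [i j / g]. It brings in the new factor [k + g ^ 2 h], which can
    be even when [g], [h] and [k] are all odd. *)
Lemma has_basis_shear g h k : (0 < g)%N -> (0 < h)%N -> (0 < k)%N ->
  hasb (- (g * h)%:R) (- (g * k)%:R) ->
  hasb (- (g * h * k * (k + g ^ 2 * h))%:R) (- (h * k)%:R).
Proof.
move=> g0 h0 k0 H; have [G Hh K] := And3 (natr0 g0) (natr0 h0) (natr0 k0).
apply: (@change_quaternion_basis _ _ _ _ k%:R (g * h)%:R 0 0 0 g%:R^-1 _ _ rat2 H).
- by rewrite oppr_eq0 natr0 // !muln_gt0 g0 h0 k0 addn_gt0 k0.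
- by rewrite oppr_eq0 natr0 // muln_gt0 h0.
- by rewrite !natrM natrD natrM natrX; ring.
- by rewrite !natrM; field.
- by rewrite !natrM; ring.
Qed.

(** The factor [m = k + g ^ 2 h] is coprime to [g h k], so its squarefree part [s] may be adjoined.
    If [g h k] is odd and [h = k] modulo 4, then [m = 2] modulo 4 and [s] is even. *)
Lemma has_basis_even_step g h k : squarefree (g * h) -> squarefree (g * k) -> coprime h k ->
  ~~ odd (g * h * k) || (h == k %[mod 4])%N ->
  hasb (- (g * h)%:R) (- (g * k)%:R) ->
  exists u v, [/\ squarefree (u * v), ~~ odd (u * v) & hasb (- (u * v)%:R) (- u%:R)].
Proof.
move=> sgh sgk chk ev H.
have := squarefree_gt0 sgh; rewrite muln_gt0 => /andP[g0 h0].
have := squarefree_gt0 sgk; rewrite muln_gt0 => /andP[_ k0].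
have cgh := squarefree_coprime sgh; have cgk := squarefree_coprime sgk.
pose m := (k + g ^ 2 * h)%N.
have m0 : (0 < m)%N by rewrite addn_gt0 k0.
have [s [t [mE t0 ss]]] := squarefree_part m0.
have H1 := has_basis_shear g0 h0 k0 H; rewrite -/m in H1.
have sg : squarefree g by apply: squarefree_dvdn sgh; rewrite dvdn_mulr.
have sh : squarefree h by apply: squarefree_dvdn sgh; rewrite dvdn_mull.
have sk : squarefree k by apply: squarefree_dvdn sgk; rewrite dvdn_mull.
have sghk : squarefree (g * h * k) by apply: squarefreeM => //; rewrite coprimeMl cgk.
have cmghk : coprime m (g * h * k).
  rewrite !coprimeMr -!andbA; apply/and3P; split; rewrite coprime_sym /coprime.
  - by rewrite (_ : m = g * h * g + k)%N ?gcdnMDl // /m -mulnn; ring.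
  - by rewrite (_ : m = g ^ 2 * h + k)%N ?gcdnMDl // /m addnC.
  - rewrite (_ : m = 1 * k + g ^ 2 * h)%N ?gcdnMDl /m ?mul1n //.
    by rewrite -/(coprime _ _) coprimeMr coprimeXr 1?coprime_sym // coprime_sym.
have sm : (s %| m)%N by rewrite mE dvdn_mulr.
exists (h * k)%N, (g * s)%N; split.
- rewrite mulnCA mulnA [(g * _)%N]mulnA; apply: squarefreeM => //.
  by rewrite coprime_sym; apply: coprime_dvdl cmghk.
- have [od|] := boolP (odd (g * h * k)); last by rewrite !oddM; lia.
  rewrite od /= in ev.
  have m2 : m = 2 %[mod 4].
    move: od ev; rewrite !oddM /m => /andP[/andP[og oh] ok] /eqP hk.
    rewrite -modnDm -modnMm hk -modnXm.
    have : (g %% 4 == 1)%N || (g %% 4 == 3)%N by lia.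
    have : (k %% 4 == 1)%N || (k %% 4 == 3)%N by lia.
    by do 2 case/orP=> /eqP ->.
  suff : ~~ odd s by rewrite !oddM; lia.
  apply/negP => os; have : ~~ odd m by lia.
  rewrite mE oddM os oddX /= => /even_halfK tE.
  by move: m2; rewrite mE -tE -mul2n expnMn mulnCA modnMr.
apply: (has_basis_scale (s := t%:R)); rewrite ?oppr_eq0 ?natr0 ?muln_gt0 ?h0 ?k0 ?g0 //.
  exact: squarefree_gt0 ss.
rewrite mulNr -natrX -natrM.
by rewrite (_ : _ * _ * _ = g * h * k * m)%N // mE; ring.
Qed.

Lemma has_basis_even a b : a < 0 -> b < 0 -> hasb a b ->
  exists u v, [/\ squarefree (u * v), ~~ odd (u * v) & hasb (- (u * v)%:R) (- u%:R)].
Proof.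
move=> a0 b0 hab; have [u [v [su sv H]]] := has_basis_squarefree a0 b0 hab.
have u0 := squarefree_gt0 su; have v0 := squarefree_gt0 sv.
pose g := gcdn u v; have g0 : (0 < g)%N by rewrite gcdn_gt0 u0.
have [h uE] := dvdnP (dvdn_gcdl u v); have [k vE] := dvdnP (dvdn_gcdr u v).
rewrite -/g mulnC in uE; rewrite -/g mulnC in vE.
have chk : coprime h k.
  by rewrite /coprime -(eqn_pmul2l g0) muln_gcdr -uE -vE muln1.
rewrite uE vE in su sv H.
have := squarefree_gt0 su; rewrite muln_gt0 => /andP[_ h0].
have := squarefree_gt0 sv; rewrite muln_gt0 => /andP[_ k0].
have sh : squarefree h by apply: squarefree_dvdn su; rewrite dvdn_mull.
have sk : squarefree k by apply: squarefree_dvdn sv; rewrite dvdn_mull.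
have shk := squarefreeM chk sh sk.
have cgh := squarefree_coprime su; have cgk := squarefree_coprime sv.
have [ev|] := boolP (~~ odd (g * h * k) || (h == k %[mod 4])%N).
  exact: has_basis_even_step ev H.
rewrite negb_or negbK !oddM => /andP[/andP[/andP[og oh] ok] hk].
(* Among three odd numbers two agree modulo 4; a rotation of the basis moves that pair into the
   places of [h] and [k]. *)
have : (g == k %[mod 4])%N || (g == h %[mod 4])%N by lia.
case/orP=> ev.
  apply: (@has_basis_even_step h g k) => //; first by rewrite mulnC.
    by rewrite ev orbT.
  exact: has_basis_rotate.
apply: (@has_basis_even_step k g h) => //; first by rewrite mulnC.
- by rewrite mulnC.
- by rewrite ev orbT.
apply: has_basis_rotate => //; apply: has_basis_sym H; rewrite oppr_eq0 natr0 ?muln_gt0 ?g0 //.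
Qed.
End NormalForm.

(** * The choice of D and q *)

Lemma dvdz_opp (d n : int) : (d %| - n)%Z = (d %| n)%Z.
Proof. by rewrite !dvdzE abszN. Qed.

Lemma legendre_prod p (s : seq nat) : prime p -> odd p ->
  legendre p (\prod_(r <- s) r)%N = \prod_(r <- s) legendre p r.
Proof.
move=> p_pr po; elim: s => [|r s IH]; first by rewrite !big_nil legendre1.
by rewrite !big_cons -IH -legendreM // -PoszM.
Qed.

Lemma prod_sign_count (T : eqType) (s : seq T) (f : T -> int) :
  (forall x, x \in s -> f x \in [:: 1; -1]) ->
  \prod_(x <- s) f x = (-1) ^+ count (fun x => f x == -1) s.
Proof.
elim: s => [|x s IH] sP; first by rewrite big_nil.
rewrite big_cons IH => [|y ys]; last by rewrite sP // inE ys orbT.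
have := sP x (mem_head _ _); rewrite !inE => /orP[] /eqP fx; rewrite /= fx.
  by rewrite mul1r.
by rewrite eqxx exprS.
Qed.

Lemma squarefree_prod_primes n : squarefree n -> n = (\prod_(p <- primes n) p)%N.
Proof.
move=> sn; have n0 := squarefree_gt0 sn.
rewrite {1}[n]prod_prime_decomp // prime_decompE big_map /=.
rewrite !big_seq; apply: eq_bigr => p pn.
have : prime p by move: pn; rewrite mem_primes => /andP[].
move=> p_pr; suff -> : logn p n = 1%N by rewrite expn1.
have := sn p p_pr; rewrite pfactor_dvdn // -ltnNge.
by move: pn; rewrite -logn_gt0; case: (logn p n) => [|[|]].
Qed.

(** In terms of the ring of integers of Q(sqrt(-q)): every prime dividing [D] is inert, and 2 splits
    when [D] is odd. The last condition makes -[D] a square in Z_q, so that the algebra splits at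
    [q]. *)
Definition admissible (D q : nat) : Prop :=
  [/\ squarefree D, prime q, (q %% 8 = if odd D then 7 else 3)%N,
      forall p, prime p -> odd p -> (p %| D)%N -> legendre p (- q%:Z) = -1
    & legendre q (- D%:Z) = 1].

Lemma legendre_opp p n : prime p -> odd p -> legendre p (- n) = legendre p (-1) * legendre p n.
Proof. by move=> p_pr po; rewrite -legendreM // mulN1r. Qed.

Lemma legendre_sign_neq0 p n : prime p -> odd p -> ~~ (p %| n)%Z -> legendre p n \in [:: 1; -1].
Proof.
move=> p_pr po; rewrite -legendre_eq0 //; have := legendre_sign p n; rewrite !inE.
by case/or3P=> /eqP ->.
Qed.

Section ChoiceOfParameters.
Variables (R : realType) (g h : nat).
Hypotheses (sgh : squarefree (g * h)) (egh : ~~ odd (g * h)).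

Let N := (g * h)%N.
Let N0 : (0 < N)%N. Proof. exact: squarefree_gt0. Qed.
Let cgh : coprime g h. Proof. exact: squarefree_coprime. Qed.
Let ps := [seq p <- primes N | odd p].
(** The Hilbert symbol of [- g h] and [- g] at an odd prime dividing [g h]: it is -1 where the
    algebra ramifies. *)
Let eps (p : nat) : int := if (p %| g)%N then legendre p (- h%:Z) else legendre p (- g%:Z).

Let ps_prime p : p \in ps -> [/\ prime p, odd p & (p %| N)%N].
Proof. by rewrite mem_filter mem_primes => /and3P[-> -> /andP[]]. Qed.

Let psP p : prime p -> odd p -> (p %| N)%N -> p \in ps.
Proof. by move=> p_pr po pN; rewrite mem_filter po mem_primes p_pr N0 pN. Qed.

Let eps_sign p : p \in ps -> eps p \in [:: 1; -1].
Proof.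
move=> /ps_prime[p_pr po pN]; rewrite /eps; case: ifPn => pg; apply: legendre_sign_neq0 => //.
  rewrite dvdz_opp; apply/negP => ph.
  have : (p %| gcdn g h)%N by rewrite dvdn_gcd pg.
  by rewrite (eqP cgh) dvdn1 => /eqP p1; rewrite p1 in p_pr.
by rewrite dvdz_opp.
Qed.

Let S := [seq p <- ps | eps p == -1].

Let prod_eps : \prod_(p <- ps) eps p = (-1) ^+ size S.
Proof. by rewrite prod_sign_count // size_filter. Qed.

Let prod_eps_S : \prod_(p <- S) eps p = (-1) ^+ size S.
Proof.
rewrite prod_sign_count; last by move=> p; rewrite mem_filter => /andP[/eqP ->].
by congr (_ ^+ _); apply/eqP; rewrite -all_count; apply: filter_all.
Qed.

Let NE : N = (2 * \prod_(p <- ps) p)%N.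
Proof.
rewrite [LHS](squarefree_prod_primes sgh) (bigID odd) /= mulnC /ps big_filter; congr (_ * _)%N.
have two : 2%N \in primes (g * h) by rewrite mem_primes N0 dvdn2.
rewrite -big_filter (perm_big [:: 2%N]) ?big_seq1 //; apply: uniq_perm => //.
  by rewrite filter_uniq ?primes_uniq.
move=> p; rewrite mem_filter inE; apply/andP/eqP => [[po]|-> //].
rewrite mem_primes => /and3P[p_pr _ _].
by case: (even_prime p_pr) => // pE; rewrite pE in po.
Qed.

(** [S] collects the odd ramified primes. Their number together with 2, if it ramifies, must be odd,
    which decides whether 2 belongs to [D]. *)
Let D := ((if odd (size S) then 1 else 2) * \prod_(p <- S) p)%N.

Let S_prime p : p \in S -> p \in ps /\ eps p = -1.
Proof. by rewrite mem_filter => /andP[/eqP]. Qed.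

Let prodS_odd : odd (\prod_(p <- S) p).
Proof.
rewrite big_seq; apply: (big_ind odd) => // [x y|p]; first by rewrite oddM => -> ->.
by move=> /S_prime[/ps_prime[]].
Qed.

Let oddD : odd D = odd (size S).
Proof. by rewrite /D oddM prodS_odd andbT; case: ifP. Qed.

Let DN : (D %| N)%N.
Proof.
have T (s : seq nat) : (forall p, p \in s -> prime p /\ (p %| N)%N) -> uniq s -> (\prod_(p <- s) p %| N)%N.
  move=> sP us; apply: dvdn_prod_primes => //; last by move=> p /sP[].
  by apply/allP => p /sP[].
have uS : uniq S by rewrite !filter_uniq ?primes_uniq.
have SP p : p \in S -> prime p /\ (p %| N)%N by move=> /S_prime[/ps_prime[]].
rewrite /D; case: ifP => _; first by rewrite mul1n T.
rewrite -(big_cons _ _ _ _ xpredT id) T //= => [p|].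
  by rewrite inE => /predU1P[->|/SP //]; rewrite dvdn2.
by rewrite uS andbT; apply/negP => /S_prime[/ps_prime[]].
Qed.

Let p_dvd_D p : prime p -> odd p -> (p %| D)%N -> p \in S.
Proof.
move=> p_pr po; rewrite /D Euclid_dvdM // => /orP[].
  case: ifP => _; first by rewrite dvdn1 => /eqP p1; rewrite p1 in p_pr.
  by rewrite dvdn_prime2 // => /eqP p2; rewrite p2 in po.
rewrite Euclid_dvd_prod // big_has => /hasP[r rS].
have [rps _] := S_prime rS; have [r_pr _ _] := ps_prime rps.
by rewrite dvdn_prime2 // => /eqP ->.
Qed.

(** Prescribing [(-q/p) = eps p] gives [(p/q) = eps p] by reciprocity. The product of these signs
    over [ps], as over [S], is [(-1) ^ size S], and [(-1/q) = -1]. The class of [q] modulo 8 fixes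
    [(2/q)] so that both [(-N/q)] and [(-D/q)] become 1; for [N] this relies on its factor 2. *)
Lemma exists_parameters : exists D' M q, [/\ admissible D' q, N = (D' * M)%N,
  forall p, prime p -> odd p -> (p %| N)%N ->
    legendre p (- q%:Z) = (if (p %| g)%N then legendre p (- h%:Z) else legendre p (- g%:Z)),
  forall p, prime p -> odd p -> (p %| M)%N -> legendre p (- q%:Z) = 1
  & legendre q (- N%:Z) = 1].
Proof.
pose c := (if odd (size S) then 7 else 3)%N.
pose delta (p : nat) := eps p * legendre p (-1).
have ups : uniq ps by rewrite filter_uniq ?primes_uniq.
have sq1 p : prime p -> odd p -> legendre p (-1) * legendre p (-1) = 1.
  by move=> p_pr po; rewrite -legendreM // mulrNN mulr1 legendre1.
have [q [q_pr qc qP]] : exists q, [/\ prime q, q = c %[mod 8] &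
    forall p, p \in ps -> legendre p q = delta p].
  apply: (exists_prime_residues R) => //.
  - by apply/allP => p /ps_prime[].
  - by apply/allP => p /ps_prime[].
  - by rewrite /c; case: ifP.
  move=> p pp; have [p_pr po _] := ps_prime pp; rewrite /delta.
  have : legendre p (-1) \in [:: 1; -1].
    have := legendre_sign p (-1); have := sq1 p p_pr po.
    by rewrite !inE => + /or3P[] /eqP E; rewrite E.
  have := eps_sign pp; rewrite !inE => /orP[] /eqP -> /orP[] /eqP ->.
  1-4: by rewrite ?mulrN ?mulNr ?mulr1 ?opprK.
have qeps p : p \in ps -> legendre p (- q%:Z) = eps p.
  move=> pp; have [p_pr po _] := ps_prime pp.
  by rewrite legendre_opp // qP // /delta mulrCA sq1 // mulr1.
have q3 : q = 3 %[mod 4].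
  by rewrite -(modn_dvdm q (isT : (4 %| 8)%N)) qc /c; case: ifP.
have qo : odd q by lia.
have qps : q \notin ps.
  apply/negP => qq; have := eps_sign qq; rewrite -qeps //.
  have [_ _ _] := ps_prime qq.
  have /eqP -> : legendre q (- q%:Z) == 0 by rewrite legendre_eq0 // dvdz_opp.
  by [].
have recip p : p \in ps -> legendre q p = eps p.
  move=> pp; have [p_pr po _] := ps_prime pp.
  rewrite quadratic_reciprocity3 // ?qeps //.
  by apply: contraNneq qps => <-.
have q2 : legendre q 2 = if odd (size S) then 1 else -1.
  by rewrite legendre2 // qc /c; case: (odd (size S)).
have qN1 : legendre q (-1) = -1 by rewrite legendreN1.
have signS : (-1) ^+ size S = (if odd (size S) then -1 else 1) :> int.
  by rewrite -signr_odd; case: odd.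
have legD : legendre q (- D%:Z) = 1.
  rewrite legendre_opp // qN1 /D PoszM legendreM // legendre_prod // big_seq.
  under eq_bigr => p pS do rewrite recip ?(proj1 (S_prime pS)) //.
  rewrite -big_seq prod_eps_S signS.
  by case: ifP => oS; rewrite ?legendre1 ?q2 ?oS.
have legN : legendre q (- N%:Z) = 1.
  rewrite legendre_opp // qN1 NE PoszM legendreM // legendre_prod // big_seq.
  under eq_bigr => p pS do rewrite recip //.
  by rewrite -big_seq prod_eps signS q2; case: ifP.
have [M NM] := dvdnP DN; rewrite mulnC in NM.
have sDM : squarefree (D * M) by rewrite -NM.
exists D, M, q; split => //.
- split => //; first by apply: squarefree_dvdn sDM; rewrite dvdn_mulr.
    by rewrite qc /c oddD; case: ifP.
  by move=> p p_pr po pD; have [pp eN] := S_prime (p_dvd_D p_pr po pD); rewrite qeps.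
- by move=> p p_pr po pN; rewrite qeps // psP.
move=> p p_pr po pM; have pp : p \in ps by apply: psP => //; rewrite NM dvdn_mull.
rewrite qeps //; have := eps_sign pp; rewrite !inE => /orP[] /eqP // eN.
have pS : p \in S by rewrite mem_filter eN eqxx.
have pD : (p %| D)%N by rewrite /D (big_rem p) //= mulnCA dvdn_mulr.
have := squarefree_coprime sDM; rewrite /coprime => /eqP g1.
have : (p %| gcdn D M)%N by rewrite dvdn_gcd pD.
by rewrite g1 dvdn1 => /eqP p1; rewrite p1 in p_pr.
Qed.

End ChoiceOfParameters.

(** A zero of [g x ^ 2 + h y ^ 2 = q z ^ 2] gives a pure quaternion of square -[q] orthogonal to the
    vector of square [- g h = - D M]. A zero of [x ^ 2 + q y ^ 2 = M z ^ 2] then removes the factor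
    [M]: the vector [(x i + y i j) / (M z)] has square -[D] and stays orthogonal to [j]. *)
Theorem normal_form (R : realType) (A : falgType rat) (a b : rat) :
  a < 0 -> b < 0 -> has_quaternion_basis A a b ->
  exists D q, admissible D q /\ has_quaternion_basis A (- D%:R) (- q%:R).
Proof.
move=> a0 b0 hab; have [g [h [sgh egh H]]] := has_basis_even a0 b0 hab.
have rat2 : 2%:R != 0 :> rat by [].
have natr0 n : (0 < n)%N -> n%:R != 0 :> rat by rewrite pnatr_eq0 -lt0n.
have [D [M [q [adm NE epsP MP legN]]]] := exists_parameters R sgh egh.
have [sD q_pr q8 _ legD] := adm.
have qo : odd q by move: q8; case: ifP; lia.
have q0 := prime_gt0 q_pr.
have D0 := squarefree_gt0 sD.
have := squarefree_gt0 sgh; rewrite muln_gt0 => /andP[g0 h0].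
have cgh := squarefree_coprime sgh.
have := squarefree_gt0 sgh; rewrite NE muln_gt0 => /andP[_ M0].
have sq1 p n : prime p -> odd p -> ~~ (p %| n)%Z -> legendre p n * legendre p n = 1.
  by move=> p_pr po pn; have := legendre_sign_neq0 p_pr po pn; rewrite !inE => /orP[] /eqP ->.
have qN : ~~ (q %| g * h)%N by rewrite -[(_ %| _)%N]/(q %| (g * h)%N%:Z)%Z -dvdz_opp -legendre_eq0 // legN.
exists D, q; split => //.
have sg : squarefree g by apply: squarefree_dvdn sgh; rewrite dvdn_mulr.
have sh : squarefree h by apply: squarefree_dvdn sgh; rewrite dvdn_mull.
have sM : squarefree M by apply: squarefree_dvdn sgh; rewrite NE dvdn_mull.
have cq n : ~~ (q %| n)%N -> coprime n q by rewrite coprime_sym prime_coprime.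
(* (hq / p) = (-h / p) (-q / p) = 1 for p | g, and likewise with g and h exchanged *)
have [u uP] : exists u : int, (g %| u ^+ 2 - (h * q)%N%:Z)%Z.
  apply: square_mod_squarefree => // p p_pr po pg; apply: legendre_sqr => //.
  have E := epsP p p_pr po (dvdn_mulr h pg); rewrite pg in E.
  rewrite PoszM -mulrNN legendreM // -E sq1 //.
  rewrite -legendre_eq0 // E legendre_eq0 // dvdz_opp; apply/negP => ph.
  have : (p %| gcdn g h)%N by rewrite dvdn_gcd pg.
  by rewrite (eqP cgh) dvdn1 => /eqP p1; rewrite p1 in p_pr.
have [v vP] : exists v : int, (h %| v ^+ 2 - (g * q)%N%:Z)%Z.
  apply: square_mod_squarefree => // p p_pr po ph; apply: legendre_sqr => //.
  have pg : ~~ (p %| g)%N.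
    apply/negP => pg; have : (p %| gcdn g h)%N by rewrite dvdn_gcd pg.
    by rewrite (eqP cgh) dvdn1 => /eqP p1; rewrite p1 in p_pr.
  have E := epsP p p_pr po (dvdn_mull g ph); rewrite (negPf pg) in E.
  by rewrite PoszM -mulrNN legendreM // -E sq1 // -legendre_eq0 // E legendre_eq0 // dvdz_opp.
have [w wP] : exists w : int, (q %| w ^+ 2 + (g * h)%N%:Z)%Z.
  by have [w wP] := legendre_sqr q_pr legN; exists w; rewrite opprK in wP.
have qg : ~~ (q %| g)%N by apply: contra qN => /dvdn_mulr ->.
have qh : ~~ (q %| h)%N by apply: contra qN => /dvdn_mull ->.
have [x [y [z [nz xyz]]]] := legendre_ternary g0 h0 q0 cgh (cq _ qh) (cq _ qg) uP vP wP.
have toQ (n m l : nat) (r s t : int) : n%:Z * r ^+ 2 + m%:Z * s ^+ 2 = l%:Z * t ^+ 2 ->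
    n%:R * r%:~R ^+ 2 + m%:R * s%:~R ^+ 2 = l%:R * t%:~R ^+ 2 :> rat.
  by move=> E; have := congr1 (fun k : int => k%:~R : rat) E; rewrite !expr2 rmorphD !rmorphM.
have z_neq0 (n m l : nat) (r s t : int) : (0 < n)%N -> (0 < m)%N ->
    [|| r != 0, s != 0 | t != 0] -> n%:Z * r ^+ 2 + m%:Z * s ^+ 2 = l%:Z * t ^+ 2 ->
    t%:~R != 0 :> rat.
  move=> n0 m0 nz' E; rewrite intr_eq0; apply/eqP => t0; move: E nz'.
  rewrite t0 expr0n mulr0 eqxx orbF => /eqP.
  have h1 : 0 <= n%:Z * r ^+ 2 by rewrite mulr_ge0 ?sqr_ge0.
  have h2 : 0 <= m%:Z * s ^+ 2 by rewrite mulr_ge0 ?sqr_ge0.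
  rewrite (paddr_eq0 h1 h2) !mulf_eq0 !orbb !eqz_nat.
  by rewrite !gtn_eqF //= => /andP[/eqP -> /eqP ->].
have zR := z_neq0 _ _ _ _ _ _ g0 h0 nz xyz; have xyzR := toQ _ _ _ _ _ _ xyz.
have gR := natr0 g g0; have hR := natr0 h h0; have qR := natr0 q q0.
have H1 : has_quaternion_basis A (- (g * h)%:R) (- q%:R).
  apply: (@change_quaternion_basis _ _ _ _ 1 0 0 0 (x%:~R / z%:~R) (y%:~R / (g%:R * z%:~R))
     _ _ rat2 H).
  - by rewrite oppr_eq0 natr0 // muln_gt0 g0.
  - by rewrite oppr_eq0.
  - ring.
  - have -> : q%:R = (g%:R * x%:~R ^+ 2 + h%:R * y%:~R ^+ 2) / z%:~R ^+ 2 :> rat.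
      by rewrite xyzR mulfK // sqrf_eq0.
    by rewrite natrM; field; rewrite gR zR.
  - ring.
have qD : ~~ (q %| D%:Z)%Z by rewrite -dvdz_opp -legendre_eq0 // legD.
have [v' v'P] : exists v' : int, (q %| v' ^+ 2 - (1 * M)%N%:Z)%Z.
  have : legendre q (D%:Z ^+ 2) * legendre q M = 1.
    rewrite -legendreM // (_ : _ * _ = - (g * h)%N%:Z * - D%:Z).
      by rewrite legendreM // legN legD.
    by rewrite NE PoszM; ring.
  rewrite legendre_square // mul1r mul1n => legM; exact: legendre_sqr.
have [w' w'P] : exists w' : int, (M %| w' ^+ 2 + (1 * q)%N%:Z)%Z.
  have [w' w'P] : exists w' : int, (M %| w' ^+ 2 - - q%:Z)%Z.
    apply: square_mod_squarefree => // p p_pr po pM; apply: legendre_sqr => //.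
    exact: MP.
  by exists w'; rewrite mul1n -[X in _ + X]opprK.
have qM : ~~ (q %| M)%N by apply: contra qN; rewrite NE; apply: dvdn_mull.
have u'P : (1 %| 0 ^+ 2 - (q * M)%N%:Z)%Z by rewrite dvd1z.
have cqM : coprime q M by rewrite coprime_sym cq.
have [x' [y' [z' [nz' xyz']]]] := legendre_ternary (ltn0Sn 0) q0 M0 (coprime1n q) cqM
  (coprime1n M) u'P v'P w'P.
have zR' := z_neq0 _ _ _ _ _ _ (ltn0Sn 0) q0 nz' xyz'.
have := toQ _ _ _ _ _ _ xyz'; rewrite mul1r => xyzR'.
have MR := natr0 M M0; have DR := natr0 D D0.
apply: (@change_quaternion_basis _ _ _ _ (x'%:~R / (M%:R * z'%:~R)) 0 (y'%:~R / (M%:R * z'%:~R))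
     0 1 0 _ _ rat2 H1).
- by rewrite oppr_eq0.
- by rewrite oppr_eq0.
- rewrite NE natrM.
  transitivity (- D%:R * ((x'%:~R ^+ 2 + q%:R * y'%:~R ^+ 2) / (M%:R * z'%:~R ^+ 2)) : rat).
    by rewrite xyzR' divff ?mulr1 // mulf_neq0 ?sqrf_eq0.
  by field; rewrite MR zR'.
- ring.
- ring.
Qed.

(** * The explicit maximal order *)

Section ReducedNorm.
Variables (F : fieldType) (B : falgType F) (a b : F) (i j : B).
Hypotheses (F2 : 2%:R != 0 :> F) (a0 : a != 0) (b0 : b != 0) (ij : quaternion_basis a b i j).

Let ii : i * i = a%:A. Proof. by case: ij. Qed.
Let jj : j * j = b%:A. Proof. by case: ij. Qed.
Let ji : j * i = - (i * j). Proof. by case: ij. Qed.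

Definition qcoord (k : 'I_4) (x : B) : F := coord [tuple 1; i; j; i * j] k x.

Let k0 : 'I_4 := ord0.
Let k1 : 'I_4 := lift ord0 ord0.
Let k2 : 'I_4 := lift ord0 (lift ord0 ord0).
Let k3 : 'I_4 := lift ord0 (lift ord0 (lift ord0 ord0)).

Lemma quat_qcoord x : x = quat i j (qcoord k0 x) (qcoord k1 x) (qcoord k2 x) (qcoord k3 x).
Proof.
case: ij => /andP[/eqP sp _] _ _ _.
have : x \in span [tuple 1; i; j; i * j] by rewrite sp memvf.
by move=> /coord_span {1}->; rewrite !big_ord_recl big_ord0 addr0 /= /quat -!addrA.
Qed.

Definition nrd (x : B) : F :=
  qnorm a b (qcoord k0 x) (qcoord k1 x) (qcoord k2 x) (qcoord k3 x).

Lemma nrd_quat x0 x1 x2 x3 : nrd (quat i j x0 x1 x2 x3) = qnorm a b x0 x1 x2 x3.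
Proof.
have /esym/(quat_inj ii jj ji F2 a0 b0)[] := quat_qcoord (quat i j x0 x1 x2 x3).
by rewrite /nrd => -> -> -> ->.
Qed.

Lemma nrdM x y : nrd (x * y) = nrd x * nrd y.
Proof.
by rewrite (quat_qcoord x) (quat_qcoord y) (quatM ii jj ji) !nrd_quat qnormM.
Qed.

Lemma nrd1 : nrd 1 = 1.
Proof. by rewrite -[X in nrd X]scale1r -(quat_scalar i j) nrd_quat /qnorm; ring. Qed.

Lemma nrdX x n : nrd (x ^+ n) = nrd x ^+ n.
Proof. by elim: n => [|n IH]; rewrite ?nrd1 // !exprS nrdM IH. Qed.

Lemma nrdZ c x : nrd (c *: x) = c ^+ 2 * nrd x.
Proof. by rewrite (quat_qcoord x) quatZ !nrd_quat /qnorm; ring. Qed.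

Lemma quaternion_basis_division : (forall x0 x1 x2 x3, qnorm a b x0 x1 x2 x3 = 0 ->
  [/\ x0 = 0, x1 = 0, x2 = 0 & x3 = 0]) -> is_division B.
Proof.
move=> aniso x x0; have [x0' [x1 [x2 [x3 xE]]]] := quaternion_basis_quat ij x.
pose n := qnorm a b x0' x1 x2 x3.
have n0 : n != 0.
  apply: contraNneq x0 => /aniso[E0 E1 E2 E3].
  by rewrite xE E0 E1 E2 E3 quat_scalar scale0r.
apply/unitrP; exists (n^-1 *: quat i j x0' (- x1) (- x2) (- x3)); split.
  by rewrite -scalerAl xE (quat_normMl ii jj ji) scalerA mulVf // scale1r.
by rewrite -scalerAr xE (quat_normM ii jj ji) scalerA mulVf // scale1r.
Qed.

Lemma quaternion_basis_not_division x0 x1 x2 x3 : qnorm a b x0 x1 x2 x3 = 0 ->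
  ~ [/\ x0 = 0, x1 = 0, x2 = 0 & x3 = 0] -> ~ is_division B.
Proof.
move=> n0 nz div; pose x := quat i j x0 x1 x2 x3.
have qz y0 y1 y2 y3 : quat i j y0 y1 y2 y3 = 0 -> [/\ y0 = 0, y1 = 0, y2 = 0 & y3 = 0].
  exact: (quat_eq0 ii jj ji).
have xu : x \is a GRing.unit by apply: div; apply/eqP => /qz.
have E : x * quat i j x0 (- x1) (- x2) (- x3) = 0.
  by rewrite (quat_normM ii jj ji) n0 scale0r.
have : quat i j x0 (- x1) (- x2) (- x3) = 0 by apply: (mulrI xu); rewrite mulr0.
move=> /qz[e0 /eqP e1 /eqP e2 /eqP e3]; apply: nz; rewrite e0.
by move: e1 e2 e3; rewrite !oppr_eq0 => /eqP -> /eqP -> /eqP ->.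
Qed.
End ReducedNorm.

(* The quotient group, carried by the indices of a system of representatives,
   has an element of order p. *)
Lemma index_torsion (V : zmodType) (L I : V -> Prop) n (r : 'I_n -> V) p :
  L 0 -> (forall x y, L x -> L y -> L (x - y)) ->
  I 0 -> (forall x y, I x -> I y -> I (x - y)) ->
  (forall k, L (r k)) -> (forall x, L x -> exists! k, I (x - r k)) ->
  prime p -> (p %| n)%N -> exists x, [/\ L x, ~ I x & I (x *+ p)].
Proof.
move=> L0 LB I0 IB Lr rP p_pr pn.
have IN x : I x -> I (- x) by move=> Ix; rewrite -sub0r; apply: IB.
have ID x y : I x -> I y -> I (x + y) by move=> Ix Iy; rewrite -[y]opprK; apply/IB/IN.
have LN x : L x -> L (- x) by move=> Lx; rewrite -sub0r; apply: LB.
have LD x y : L x -> L y -> L (x + y) by move=> Lx Ly; rewrite -[y]opprK; apply/LB/LN.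
pose idx x : 'I_n := if pselect (L x) is left Lx then sval (cid (rP x Lx)) else
  sval (cid (rP 0 L0)).
have idxP x : L x -> I (x - r (idx x)).
  by move=> Lx; rewrite /idx; case: pselect => // Lx'; case: cid => k [].
have idx_eq x y : L x -> L y -> I (x - y) -> idx x = idx y.
  move=> Lx Ly Ixy; have [k [_ kU]] := rP x Lx.
  rewrite -(kU (idx x)); last exact: idxP.
  by apply: kU; rewrite -(subrKA y); apply: ID => //; apply: idxP.
have eq_idx x y : L x -> L y -> idx x = idx y -> I (x - y).
  move=> Lx Ly E; have -> : x - y = (x - r (idx x)) - (y - r (idx y)).
    by rewrite E opprB addrA subrK.
  by apply: IB; apply: idxP.
pose mul (k l : 'I_n) := idx (r k + r l).
pose one := idx 0.
pose inv k := idx (- r k).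
have rI x : L x -> I (r (idx x) - x) by move=> Lx; rewrite -opprB; apply/IN/idxP.
have Lkl k l : L (r k + r l) by apply: LD.
have addl x y z : L x -> L y -> L z -> I (y - z) -> idx (x + y) = idx (x + z).
  move=> Lx Ly Lz Iyz; apply: idx_eq; [exact: LD|exact: LD|].
  by rewrite opprD addrACA subrr add0r.
have addr x y z : L x -> L y -> L z -> I (y - z) -> idx (y + x) = idx (z + x).
  by move=> Lx Ly Lz Iyz; rewrite ![_ + x]addrC; apply: addl.
have mulA : associative mul.
  move=> k l t; rewrite /mul (addl (r k) _ (r l + r t)) //; last exact: rI.
  by rewrite (addr (r t) _ (r k + r l)) ?addrA //; apply: rI.
have mul1 : left_id one mul.
  move=> k; rewrite /mul /one (addr (r k) _ 0) //; last by apply: rI.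
  rewrite add0r; have [l [_ lU]] := rP (r k) (Lr k).
  by rewrite -(lU (idx (r k))) ?(lU k) ?subrr //; apply: idxP.
have mulV : left_inverse one inv mul.
  move=> k; have LNk := LN _ (Lr k).
  by rewrite /mul /inv (addr (r k) _ (- r k)) ?addNr //; apply: rI.
pose mixin := Finite_isGroup.Build 'I_n mulA mul1 mulV.
pose gT : finGroupType := HB.pack 'I_n mixin.
have gn : (p %| #|[set: gT]|)%N by rewrite cardsT card_ord.
have [x _ ox] := Cauchy p_pr gn.
have Lk k : L (r x *+ k).
  by elim: k => [|l Ll]; rewrite ?mulr0n // mulrS; apply: LD.
have xX k : (x ^+ k)%g = idx (r x *+ k) :> 'I_n.
  elim: k => [|k IH]; first by rewrite expg0 mulr0n.
  rewrite expgS mulrS -[LHS]/(mul x (x ^+ k)%g) IH /mul.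
  by apply: addl => //; apply: rI.
exists (r x); split => // [Ix|].
  have : #[x]%g = 1%N; last by rewrite ox => p1; rewrite p1 in p_pr.
  apply/eqP; rewrite order_eq1 -(expg1 x); apply/eqP; rewrite -[RHS](expg0 x).
  by rewrite !xX; apply: idx_eq => //; rewrite mulr1n mulr0n subr0.
have := xX p; rewrite -ox expg_order -[LHS](expg0 x) xX ox mulr0n => /esym/eq_idx.
by rewrite subr0; apply.
Qed.

(** If [d] is the denominator of [N], all powers of [d] divide [K], so [d = 1]. *)
Lemma int_of_bounded_powers (N : rat) (K : nat) : (0 < K)%N ->
  (forall k, K%:R * N ^+ k \is a Num.int) -> N \is a Num.int.
Proof.
move=> K0 KN; rewrite Qint_def.
pose d := `|denq N|%N; have dE : denq N = d%:Z by rewrite gez0_abs ?denq_ge0.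
have d0 : (0 < d)%N by rewrite absz_gt0 denq_neq0.
have dK k : (d ^ k %| K)%N.
  have /intrP[z zE] := KN k.
  have E : (K%:Z * numq N ^+ k = z * (d%:Z ^+ k))%R.
    apply/eqP; rewrite -(eqr_int rat) !rmorphM /= !rmorphXn /= -zE -dE.
    rewrite -mulrA -exprMn -[X in (X * _) ^+ _]divq_num_den mulfVK //.
    by rewrite intr_eq0 denq_neq0.
  have : (d%:Z ^+ k %| K%:Z * numq N ^+ k)%Z by rewrite E dvdz_mull.
  rewrite Gauss_dvdzl; first by rewrite dvdzE abszX.
  rewrite coprimezE !abszX /= coprimeXl // coprimeXr // coprime_sym -[d]/`|denq N|%N.
  exact: coprime_num_den.
rewrite dE eqz_nat; case: (leqP d 1) => [d1|d2]; first by apply/eqP; lia.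
have := dvdn_leq K0 (dK K); have := ltn_expl K d2; lia.
Qed.

Section Integrality.
Variables (A : falgType rat) (a b : int) (i j : A).
Hypotheses (a0 : a != 0) (b0 : b != 0) (ij : quaternion_basis a%:~R b%:~R i j).

Definition int_quat (x : A) : Prop :=
  exists z0 z1 z2 z3 : int, x = quat i j z0%:~R z1%:~R z2%:~R z3%:~R.

Let int_quatD x y : int_quat x -> int_quat y -> int_quat (x + y).
Proof.
move=> [x0 [x1 [x2 [x3 ->]]]] [y0 [y1 [y2 [y3 ->]]]].
by exists (x0 + y0), (x1 + y1), (x2 + y2), (x3 + y3); rewrite quatD !rmorphD.
Qed.

Let int_quatZ (n : int) x : int_quat x -> int_quat (n%:~R *: x).
Proof.
move=> [x0 [x1 [x2 [x3 ->]]]].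
by exists (n * x0), (n * x1), (n * x2), (n * x3); rewrite quatZ !rmorphM.
Qed.

Let int_quat_denominator x : exists2 K : nat, (0 < K)%N & int_quat (K%:R *: x).
Proof.
have [x0 [x1 [x2 [x3 ->]]]] := quaternion_basis_quat ij x.
pose d (r : rat) := `|denq r|%N.
have dE r : (d r)%:R * r = (numq r)%:~R.
  have -> : (d r)%:R = (denq r)%:~R :> rat by rewrite -[RHS](_ : (d r)%:Z%:~R = _) // gez0_abs ?denq_ge0.
  by rewrite -{2}[r]divq_num_den mulrC divfK // intr_eq0 denq_neq0.
exists (d x0 * d x1 * d x2 * d x3)%N; first by rewrite !muln_gt0 !absz_gt0 !denq_neq0.
exists (numq x0 * (d x1 * d x2 * d x3)%N%:Z), (numq x1 * (d x0 * d x2 * d x3)%N%:Z),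
  (numq x2 * (d x0 * d x1 * d x3)%N%:Z), (numq x3 * (d x0 * d x1 * d x2)%N%:Z).
have nc (n : nat) : n%:Z%:~R = n%:R :> rat by [].
by rewrite quatZ !intrM -!dE !nc !natrM; congr quat; ring.
Qed.

Lemma lattice_denominator L : is_lattice L ->
  exists2 K : nat, (0 < K)%N & forall x, L x -> int_quat (K%:R *: x).
Proof.
move=> [n [s [_ ->]]].
have [K K0 KP] : exists2 K : nat, (0 < K)%N & forall x, x \in (s : seq A) -> int_quat (K%:R *: x).
  elim: (s : seq A) => [|y t [K K0 KP]]; first by exists 1%N.
  have [K' K'0 K'P] := int_quat_denominator y.
  exists (K * K')%N; first by rewrite muln_gt0 K0.
  move=> x; rewrite inE => /predU1P[->|xt]; rewrite natrM.
    by rewrite -scalerA; apply: (int_quatZ K%:Z).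
  by rewrite mulrC -scalerA; apply: (int_quatZ K'%:Z); apply: KP.
exists K => // x [c ->]; rewrite scaler_sumr.
apply: (big_ind int_quat) => [||l _]; last first.
- rewrite -scaler_int scalerA mulrC -scalerA; apply/int_quatZ/KP.
  by apply: mem_nth; rewrite size_tuple.
- exact: int_quatD.
by exists 0, 0, 0, 0; rewrite quat_scalar scale0r.
Qed.

(** An order contains all powers of [x] and has a common denominator [K], so by multiplicativity
    every power of the norm of [x] has a denominator dividing [K ^ 2]. *)
Lemma nrd_order_int Ord x : is_order Ord -> Ord x -> nrd a%:~R b%:~R i j x \is a Num.int.
Proof.
move=> [latO O1 OM] Ox; have [K K0 KP] := lattice_denominator latO.
have aR : a%:~R != 0 :> rat by rewrite intr_eq0.
have bR : b%:~R != 0 :> rat by rewrite intr_eq0.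
have rat2 : 2%:R != 0 :> rat by [].
have OX k : Ord (x ^+ k) by elim: k => [|k IH]; rewrite ?expr0 // exprS; apply: OM.
apply: (@int_of_bounded_powers _ (K ^ 2)); first by rewrite expn_gt0 K0.
move=> k; rewrite -nrdX // natrX -nrdZ //.
have [z0 [z1 [z2 [z3 ->]]]] := KP _ (OX k).
by rewrite nrd_quat // /qnorm -!rmorphXn -!rmorphM -!rmorphB -rmorphD /=; apply: intr_int.
Qed.

End Integrality.

Local Open Scope classical_set_scope.

(* With [w = w0 + w1 om] and [s = s0 + s1 om] in [Z[om]],
   this is the norm of [w + (r + i) j^-1 s], where [om = (1 + j) / 2], [q c = r ^ 2 + D]
   and [q = 4 m - 1]. *)
Definition order_norm (T : comNzRingType) (m c r w0 w1 s0 s1 : T) : T :=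
  w0 ^+ 2 + w0 * w1 + m * w1 ^+ 2 - r * (w1 * s0 - w0 * s1)
  + c * (s0 ^+ 2 + s0 * s1 + m * s1 ^+ 2).

Section ExplicitOrder.
Variables (A : falgType rat) (D q : nat) (m c r : int) (i j : A).
Hypotheses (adm : admissible D q) (mE : q%:Z = 4 * m - 1) (cE : D%:Z = q%:Z * c - r ^+ 2).
Hypothesis ij : quaternion_basis (- D%:R) (- q%:R) i j.

Let sD : squarefree D. Proof. by case: adm. Qed.
Let q_pr : prime q. Proof. by case: adm. Qed.
Let D0 : (0 < D)%N. Proof. exact: squarefree_gt0. Qed.
Let q0 : (0 < q)%N. Proof. exact: prime_gt0. Qed.
Let DR : - D%:R != 0 :> rat. Proof. by rewrite oppr_eq0 pnatr_eq0 -lt0n. Qed.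
Let qR : - q%:R != 0 :> rat. Proof. by rewrite oppr_eq0 pnatr_eq0 -lt0n. Qed.
Let rat2 : 2%:R != 0 :> rat. Proof. by []. Qed.
Let ii : i * i = (- D%:R)%:A. Proof. by case: ij. Qed.
Let jj : j * j = (- q%:R)%:A. Proof. by case: ij. Qed.
Let ji : j * i = - (i * j). Proof. by case: ij. Qed.

Local Notation "z ^q" := ((z : int)%:~R : rat) (at level 1, format "z ^q").

Let mEq : q%:R = 4 * m^q - 1 :> rat.
Proof. by rewrite -[q%:R]/(q%:Z^q) mE rmorphB rmorphM. Qed.
Let cEq : D%:R = q%:R * c^q - r^q ^+ 2 :> rat.
Proof. by rewrite -[D%:R]/(D%:Z^q) cE rmorphB rmorphM rmorphXn. Qed.
Let m4 : 4 * m^q - 1 != 0 :> rat.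
Proof. by rewrite -mEq pnatr_eq0 -lt0n. Qed.

(** The element [w + (r + i) j^-1 s] with [w = w0 + w1 om] and [s = s0 + s1 om], expanded in the
    basis 1, [i], [j], [i j]. *)
Definition order_elt (w0 w1 s0 s1 : rat) : A :=
  quat i j (w0 + w1 / 2 + r^q * s1 / 2) (s1 / 2)
    (w1 / 2 - r^q * (2 * s0 + s1) / (2 * q%:R)) (- (2 * s0 + s1) / (2 * q%:R)).

Local Notation nrdA := (nrd (- D%:R) (- q%:R) i j).
Local Notation onorm := (order_norm m c r).

Lemma nrd_order_elt w0 w1 s0 s1 :
  nrdA (order_elt w0 w1 s0 s1) = order_norm m^q c^q r^q w0 w1 s0 s1.
Proof.
by rewrite nrd_quat // /qnorm cEq mEq /order_norm; field; rewrite m4.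
Qed.

Lemma order_eltD w0 w1 s0 s1 w0' w1' s0' s1' :
  order_elt w0 w1 s0 s1 + order_elt w0' w1' s0' s1' =
  order_elt (w0 + w0') (w1 + w1') (s0 + s0') (s1 + s1').
Proof. by rewrite quatD; congr quat; rewrite ?mEq; field; rewrite ?m4. Qed.

Lemma order_eltZ k w0 w1 s0 s1 :
  k *: order_elt w0 w1 s0 s1 = order_elt (k * w0) (k * w1) (k * s0) (k * s1).
Proof. by rewrite quatZ; congr quat; rewrite ?mEq; field; rewrite ?m4. Qed.

Lemma order_eltM w0 w1 s0 s1 w0' w1' s0' s1' :
  order_elt w0 w1 s0 s1 * order_elt w0' w1' s0' s1' = order_elt
   (r^q * w1 * s0' + w0 * w0' - m^q * w1 * w1' - c^q * ((s0 + s1) * s0' + m^q * s1 * s1'))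
   (r^q * w1 * s1' + w0 * w1' + w1 * w0' + w1 * w1' - c^q * (s0 * s1' - s1 * s0'))
   (r^q * s1 * s0' + s0 * w0' - m^q * s1 * w1' + (w0 + w1) * s0' + m^q * w1 * s1')
   (r^q * s1 * s1' + s0 * w1' + s1 * w0' + s1 * w1' + w0 * s1' - w1 * s0').
Proof.
rewrite /order_elt (quatM ii jj ji) cEq mEq.
by congr quat; field; rewrite ?m4.
Qed.

Lemma order_elt_surj x : exists w0 w1 s0 s1, x = order_elt w0 w1 s0 s1.
Proof.
have [x0 [x1 [x2 [x3 ->]]]] := quaternion_basis_quat ij x.
exists (x0 - x2 + r^q * x3 - r^q * x1), (2 * (x2 - r^q * x3)),
  (- q%:R * x3 - x1), (2 * x1).
by rewrite /order_elt mEq; congr quat; field; rewrite ?m4.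
Qed.

Lemma order_elt_inj w0 w1 s0 s1 w0' w1' s0' s1' :
  order_elt w0 w1 s0 s1 = order_elt w0' w1' s0' s1' ->
  [/\ w0 = w0', w1 = w1', s0 = s0' & s1 = s1'].
Proof.
move=> /(quat_inj ii jj ji rat2 DR qR)[e0 e1 e2 e3].
have E1 : s1 = s1' by lra.
have E0 : s0 = s0'.
  have k0 : 2 * q%:R != 0 :> rat by rewrite mulf_neq0 // -oppr_eq0.
  by move: e3 => /(mulIf (invr_neq0 k0)); rewrite E1; lra.
have E2 : w1 = w1' by move: e2; rewrite E0 E1; lra.
by split => //; move: e0; rewrite E1 E2; lra.
Qed.

Lemma order_elt1 : order_elt 1 0 0 0 = 1.
Proof. by rewrite -[RHS]scale1r -(quat_scalar i j); congr quat; rewrite ?mEq; field; rewrite ?m4. Qed.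

Lemma order_elt_i w0 w1 s0 s1 : i * order_elt w0 w1 s0 s1 = order_elt
  (- r^q * w0 - c^q * (s0 + 2 * m^q * s1)) (- r^q * w1 + c^q * (2 * s0 + s1))
  (- w0 - 2 * m^q * w1 + r^q * s0) (2 * w0 + w1 + r^q * s1).
Proof.
rewrite -{1}(quat_i i j) /order_elt (quatM ii jj ji) cEq mEq.
by congr quat; field; rewrite ?m4.
Qed.

Definition explicit_order : set A := [set x | exists w0 w1 s0 s1 : int,
  x = order_elt w0^q w1^q s0^q s1^q].

Lemma explicit_order_lattice : is_lattice explicit_order.
Proof.
pose s := [tuple order_elt 1 0 0 0; order_elt 0 1 0 0; order_elt 0 0 1 0; order_elt 0 0 0 1].
have E w0 w1 s0 s1 : order_elt w0 w1 s0 s1 =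
   w0 *: s`_0 + (w1 *: s`_1 + (s0 *: s`_2 + s1 *: s`_3)).
  by rewrite /= !order_eltZ !order_eltD; congr order_elt; ring.
exists 4, s; split.
  apply/eqP; rewrite eqEsubv subvf /=; apply/subvP => x _.
  have [w0 [w1 [s0 [s1 ->]]]] := order_elt_surj x; rewrite E.
  have sP k : (k < 4)%N -> s`_k \in span s by move=> k4; apply/memv_span/mem_nth.
  by rewrite !rpredD ?rpredZ ?sP.
apply/seteqP; split=> x.
  move=> [w0 [w1 [s0 [s1 ->]]]] /=; exists [ffun k : 'I_4 => nth 0 [:: w0; w1; s0; s1] k].
  by rewrite !big_ord_recl big_ord0 !ffunE /= addr0 -!scaler_int E.
move=> /= [f ->]; exists (f ord0), (f (lift ord0 ord0)), (f (lift ord0 (lift ord0 ord0))),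
  (f (lift ord0 (lift ord0 (lift ord0 ord0)))).
by rewrite !big_ord_recl big_ord0 addr0 -!scaler_int E.
Qed.

Lemma explicit_order_order : is_order explicit_order.
Proof.
split; first exact: explicit_order_lattice.
  by exists 1, 0, 0, 0; rewrite order_elt1.
move=> _ _ [w0 [w1 [s0 [s1 ->]]]] [w0' [w1' [s0' [s1' ->]]]].
rewrite order_eltM.
exists (r * w1 * s0' + w0 * w0' - m * w1 * w1' - c * ((s0 + s1) * s0' + m * s1 * s1')),
  (r * w1 * s1' + w0 * w1' + w1 * w0' + w1 * w1' - c * (s0 * s1' - s1 * s0')),
  (r * s1 * s0' + s0 * w0' - m * s1 * w1' + (w0 + w1) * s0' + m * w1 * s1'),
  (r * s1 * s1' + s0 * w1' + s1 * w0' + s1 * w1' + w0 * s1' - w1 * s0').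
by rewrite !(rmorphD, rmorphN, rmorphM).
Qed.

End ExplicitOrder.

(** * Divisibility of the norm form by divisors of D *)

Lemma Euclid_dvdzM p (x y : int) : prime p -> (p %| x * y)%Z = (p %| x)%Z || (p %| y)%Z.
Proof. by move=> p_pr; rewrite !dvdzE abszM Euclid_dvdM. Qed.

Lemma Euclid_dvdz_sqr p (x : int) : prime p -> (p %| x ^+ 2)%Z = (p %| x)%Z.
Proof. by move=> p_pr; rewrite expr2 Euclid_dvdzM // orbb. Qed.

Lemma dvdz_squarefree (n : nat) (x : int) : squarefree n ->
  (forall p, prime p -> (p %| n)%N -> (p %| x)%Z) -> (n %| x)%Z.
Proof.
move=> sn nP; rewrite dvdzE /= (squarefree_prod_primes sn); apply: dvdn_prod_primes.
- exact: primes_uniq.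
- by apply/allP => p; rewrite mem_primes => /andP[].
by move=> p; rewrite mem_primes => /and3P[p_pr _ pn]; have := nP p p_pr pn; rewrite dvdzE.
Qed.

Lemma admissible_odd D q : admissible D q -> odd q.
Proof. by case=> _ _ + _ _; case: ifP => _; lia. Qed.

Lemma admissible_coprime D q : admissible D q -> coprime D q.
Proof.
move=> adm; have qo := admissible_odd adm; have [_ q_pr _ _ leg] := adm.
rewrite coprime_sym prime_coprime //.
by rewrite -[(_ %| _)%N]/(q %| D%:Z)%Z -dvdz_opp -legendre_eq0 // leg.
Qed.

Section Divisibility.
Variables (D q : nat) (m c r : int).
Hypotheses (adm : admissible D q) (mE : q%:Z = 4 * m - 1) (cE : D%:Z = q%:Z * c - r ^+ 2).
Local Notation onorm := (order_norm m c r).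
Local Notation N := (fun x0 x1 : int => x0 ^+ 2 + x0 * x1 + m * x1 ^+ 2).

Let sD : squarefree D. Proof. by case: adm. Qed.
Let q_pr : prime q. Proof. by case: adm. Qed.

(** The discriminant of [N] is [1 - 4 m = - q], a non-residue at odd [p]. At 2 the condition [q = 3]
    modulo 8 makes [m] odd, and [x0 ^ 2 + x0 x1 + x1 ^ 2] has no nontrivial zero modulo 2. *)
Lemma norm_form_anisotropic p (x0 x1 : int) : prime p -> (p %| D)%N ->
  (p %| N x0 x1)%Z -> (p %| x0)%Z /\ (p %| x1)%Z.
Proof.
move=> p_pr pD pN; have [po|pe] := boolP (odd p).
  have leg : legendre p (- q%:Z) = -1 by case: adm => _ _ _ + _; apply.
  have E : (2 * x0 + x1) ^+ 2 - - q%:Z * x1 ^+ 2 = 4 * N x0 x1 by rewrite mE; ring.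
  have pE : (p %| (2 * x0 + x1) ^+ 2 - - q%:Z * x1 ^+ 2)%Z by rewrite E dvdz_mull.
  have p2 : ~~ (p %| 2)%Z.
    by rewrite dvdzE /= dvdn_prime2 //; apply: contraL po => /eqP ->.
  have px1 : (p %| x1)%Z.
    apply/negPn/negP => nx1; have sx1 := legendre_square p_pr po nx1.
    have : legendre p ((2 * x0 + x1) ^+ 2) = -1.
      have <- : legendre p (- q%:Z * x1 ^+ 2) = -1 by rewrite legendreM // leg sx1 mulr1.
      by apply: legendre_mod => //; apply/eqP; rewrite eqz_mod_dvd.
    have [pX|pX] := boolP (p %| 2 * x0 + x1)%Z; last by rewrite legendre_square.
    have /eqP -> // : legendre p ((2 * x0 + x1) ^+ 2) == 0.
    by rewrite legendre_eq0 // Euclid_dvdz_sqr.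
  split => //; rewrite -Euclid_dvdz_sqr //.
  rewrite (_ : x0 ^+ 2 = N x0 x1 - x1 * (x0 + m * x1)); last by ring.
  by rewrite rpredB // dvdz_mulr.
have p2 : p = 2%N by case: (even_prime p_pr) => // po; rewrite po in pe.
rewrite {p}p2 in pN pD p_pr pe *.
have q3 : (q %% 8)%N = 3%N.
  by case: adm => _ _ + _ _; move: pD; rewrite dvdn2 => /negPf ->.
have [k mk] : exists k, m = 2 * k + 1 by exists (m %/ 2)%Z; move: mE q3; clear; lia.
have par (x : int) : exists2 h : int, (x = 2 * h \/ x = 2 * h + 1) & true.
  by exists (x %/ 2)%Z => //; lia.
have [h0 E0 _] := par x0; have [h1 E1 _] := par x1.
have odd_absurd (l : int) : ~ (2 %| 2 * l + 1)%Z by lia.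
case: E0 => E0; case: E1 => E1; rewrite E0 E1 in pN *.
- by rewrite !dvdz_mulr.
- case: (odd_absurd (2 * h0 ^+ 2 + h0 * (2 * h1 + 1) + m * (2 * h1 ^+ 2 + 2 * h1) + k)).
  by move: pN; congr (_ %| _)%Z; rewrite mk; ring.
- case: (odd_absurd (2 * h0 ^+ 2 + 2 * h0 + h1 * (2 * h0 + 1) + 2 * m * h1 ^+ 2)).
  by move: pN; congr (_ %| _)%Z; ring.
- case: (odd_absurd (2 * h0 ^+ 2 + 2 * h0 + 2 * h0 * h1 + h0 + h1 + 1
     + m * (2 * h1 ^+ 2 + 2 * h1) + k)).
  by move: pN; congr (_ %| _)%Z; rewrite mk; ring.
Qed.

(** Modulo [D] the four-variable form, multiplied by the unit [q], is the binary form [N] at two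
    linear forms. These are the last two coordinates of the product of [i] with the element. *)
Lemma order_norm_eq w0 w1 s0 s1 : q%:Z * onorm w0 w1 s0 s1 =
  N (- w0 - 2 * m * w1 + r * s0) (2 * w0 + w1 + r * s1) + D%:Z * N s0 s1.
Proof. by rewrite cE mE /order_norm; ring. Qed.

Lemma order_norm_prime_dvd p w0 w1 s0 s1 : prime p -> (p %| D)%N ->
  (p %| onorm w0 w1 s0 s1)%Z ->
  (p %| - w0 - 2 * m * w1 + r * s0)%Z /\ (p %| 2 * w0 + w1 + r * s1)%Z.
Proof.
move=> p_pr pD pn; apply: norm_form_anisotropic => //.
rewrite (_ : N _ _ = q%:Z * onorm w0 w1 s0 s1 - D%:Z * N s0 s1); last first.
  by rewrite order_norm_eq addrK.
by apply: rpredB; [rewrite dvdz_mull | rewrite dvdz_mulr].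
Qed.

(** Both linear forms are divisible by [p], so [p ^ 2] divides [D * N s0 s1]; as [D] is squarefree,
    [p] divides [N s0 s1], and anisotropy applies a second time. This is the descent step for
    anisotropy over Z_p. *)
Lemma order_norm_aniso p w0 w1 s0 s1 : prime p -> (p %| D)%N ->
  ((p ^ 2)%N %| onorm w0 w1 s0 s1)%Z ->
  [/\ (p %| w0)%Z, (p %| w1)%Z, (p %| s0)%Z & (p %| s1)%Z].
Proof.
move=> p_pr pD p2n.
have pn : (p %| onorm w0 w1 s0 s1)%Z by apply: dvdz_trans p2n; rewrite dvdzE /= dvdn_exp.
have [pg0 pg1] := order_norm_prime_dvd p_pr pD pn.
set g0 := - w0 - _ + _ in pg0; set g1 := 2 * w0 + _ + _ in pg1.
have [D' DE] := dvdnP pD.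
have pD' : ~~ (p %| D'%:Z)%Z.
  by apply/negP => pD'; have := sD p_pr; rewrite DE -mulnn dvdn_mul.
have pN : (p %| N s0 s1)%Z.
  have p0 : p%:Z != 0 by rewrite eqz_nat -lt0n prime_gt0.
  suff : (p%:Z * p%:Z %| p%:Z * (D'%:Z * N s0 s1))%Z.
    by rewrite dvdz_mul2l // Euclid_dvdzM // (negPf pD').
  have := order_norm_eq w0 w1 s0 s1; rewrite -/g0 -/g1 => H.
  have -> : p%:Z * (D'%:Z * N s0 s1) = q%:Z * onorm w0 w1 s0 s1 - N g0 g1.
    by rewrite H DE PoszM; ring.
  rewrite -PoszM mulnn; apply: rpredB; first by rewrite dvdz_mull.
  have [/dvdzP[h0 ->] /dvdzP[h1 ->]] := conj pg0 pg1.
  by rewrite -mulnn PoszM (_ : _ + _ = p%:Z * p%:Z * N h0 h1); [rewrite dvdz_mulr | ring].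
have [ps0 ps1] := norm_form_anisotropic p_pr pD pN.
have pq : coprimez p q.
  by rewrite coprimezE /=; apply: coprime_dvdl (admissible_coprime adm).
have pw1 : (p %| w1)%Z.
  rewrite -(Gauss_dvdzr _ pq).
  rewrite (_ : q%:Z * w1 = - 2 * g0 - g1 + (2 * r * s0 + r * s1)); last by rewrite mE /g0 /g1; ring.
  by rewrite !rpredD ?rpredN // ?dvdz_mull.
have pw0 : (p %| w0)%Z.
  rewrite (_ : w0 = - g0 - 2 * m * w1 + r * s0); last by rewrite /g0; ring.
  by rewrite !rpredD ?rpredN // ?dvdz_mull.
by [].
Qed.

(* The right-hand sides are the coordinates of i times the element with
   coordinates w0', w1', s0', s1'. *)
Lemma order_norm_dvd w0 w1 s0 s1 : (D %| onorm w0 w1 s0 s1)%Z ->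
  exists w0' w1' s0' s1', [/\ w0 = - r * w0' - c * (s0' + 2 * m * s1'),
    w1 = - r * w1' + c * (2 * s0' + s1'), s0 = - w0' - 2 * m * w1' + r * s0'
    & s1 = 2 * w0' + w1' + r * s1'].
Proof.
move=> Dn; have Dz : D%:Z != 0 by rewrite eqz_nat -lt0n squarefree_gt0.
pose g0 := - w0 - 2 * m * w1 + r * s0; pose g1 := 2 * w0 + w1 + r * s1.
have [Dg0 Dg1] : (D %| g0)%Z /\ (D %| g1)%Z.
  have pp p : prime p -> (p %| D)%N -> (p %| g0)%Z /\ (p %| g1)%Z.
    by move=> p_pr pD; apply: order_norm_prime_dvd => //; apply: dvdz_trans Dn; rewrite dvdzE.
  by split; apply: dvdz_squarefree => // p p_pr pD; have [] := pp p p_pr pD.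
(* For the element [x] with the given coordinates, [i x] has coordinates [- h0], [- h1], [g0], [g1].
   Since [i ^ 2 = - D], the quotient sought is [- i x / D], which explains the witnesses below. *)
pose h0 := r * w0 + c * (s0 + 2 * m * s1); pose h1 := r * w1 - c * (2 * s0 + s1).
have Dq : coprimez D q := admissible_coprime adm.
have Dh0 : (D %| h0)%Z.
  rewrite -(Gauss_dvdzr _ Dq).
  rewrite (_ : q%:Z * h0 = - r * (- g0 - 2 * m * g1) + D%:Z * (s0 + 2 * m * s1)).
    apply: rpredD; last exact: dvdz_mulr.
    by apply/dvdz_mull/rpredB; [rewrite rpredN | apply: dvdz_mull].
  by rewrite cE mE /h0 /g0 /g1; ring.
have Dh1 : (D %| h1)%Z.
  rewrite -(Gauss_dvdzr _ Dq).
  rewrite (_ : q%:Z * h1 = - r * (2 * g0 + g1) - D%:Z * (2 * s0 + s1)).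
    apply: rpredB; last exact: dvdz_mulr.
    by apply/dvdz_mull/rpredD => //; apply: dvdz_mull.
  by rewrite cE mE /h1 /g0 /g1; ring.
have [t0 g0E] := dvdzP Dg0; have [t1 g1E] := dvdzP Dg1.
have [v0 h0E] := dvdzP Dh0; have [v1 h1E] := dvdzP Dh1.
exists v0, v1, (- t0), (- t1); split; apply: (mulIf Dz).
- rewrite [RHS](_ : _ = - r * (v0 * D%:Z) + c * (t0 * D%:Z + 2 * m * (t1 * D%:Z))); last ring.
  by rewrite -g0E -g1E -h0E /g0 /g1 /h0 cE mE; ring.
- rewrite [RHS](_ : _ = - r * (v1 * D%:Z) - c * (2 * (t0 * D%:Z) + t1 * D%:Z)); last ring.
  by rewrite -g0E -g1E -h1E /g0 /g1 /h1 cE mE; ring.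
- rewrite [RHS](_ : _ = - (v0 * D%:Z) - 2 * m * (v1 * D%:Z) - r * (t0 * D%:Z)); last ring.
  by rewrite -h0E -h1E -g0E /g0 /h0 /h1 cE mE; ring.
rewrite [RHS](_ : _ = 2 * (v0 * D%:Z) + v1 * D%:Z - r * (t1 * D%:Z)); last ring.
by rewrite -h0E -h1E -g1E /g1 /h0 /h1 cE mE; ring.
Qed.

End Divisibility.

(** * Maximality and the ideal of norm D *)

Lemma latticeB (A : falgType rat) (L : set A) x y : is_lattice L -> L x -> L y -> L (x - y).
Proof.
move=> [n [s [_ ->]]] /= [f ->] [g ->]; exists [ffun k => f k - g k].
by rewrite -sumrB; apply: eq_bigr => k _; rewrite ffunE mulrzBr.
Qed.

Lemma lattice0 (A : falgType rat) (L : set A) : is_lattice L -> L 0.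
Proof.
move=> [n [s [_ ->]]] /=; exists [ffun => 0].
by rewrite big1 // => k _; rewrite ffunE mulr0z.
Qed.

Lemma latticeD (A : falgType rat) (L : set A) x y : is_lattice L -> L x -> L y -> L (x + y).
Proof.
move=> lL Lx Ly; rewrite -[y]opprK; apply: latticeB => //.
by rewrite -sub0r; apply: latticeB => //; apply: lattice0.
Qed.

(** Classes modulo [I] map onto classes modulo [J]; a surjection between sets of [n] elements is
    injective, so the class of 0 is not enlarged. *)
Lemma eq_index_subset (A : falgType rat) (Ord I J : set A) n :
  has_index Ord I n -> has_index Ord J n ->
  I 0 -> (forall x y, I x -> I y -> I (x - y)) -> (forall x y, J x -> J y -> J (x - y)) ->
  I `<=` J -> J `<=` Ord -> I = J.
Proof.
move=> [r [rO rP]] [s [sO sP]] I0 IB JB IJ JO; apply/seteqP; split=> // x Jx.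
have J0 : J 0 by apply: IJ.
pose f k := sval (cid (sP _ (rO k))).
have fP k : J (r k - s (f k)) by rewrite /f; case: cid => l [].
have fE k l : J (r k - s l) -> f k = l.
  move=> Jkl; have [l' [_ lU]] := sP _ (rO k).
  by rewrite -(lU _ Jkl) -(lU _ (fP k)).
have f_inj : injective f.
  pose h l := sval (cid (rP _ (sO l))).
  have hK : cancel h f.
    move=> l; apply: fE; rewrite /h; case: cid => k [/= Ik _].
    by rewrite -opprB -sub0r; apply/JB/IJ.
  have [g _ gK] := injF_bij (can_inj hK).
  by apply: (can_inj (g := h)) => k; rewrite -[k in f k]gK hK gK.
have [k [Ik _]] := rP x (JO _ Jx).
have [k0 [Ik0 _]] := rP 0 (JO _ J0).
have Jr l y : J y -> I (y - r l) -> J (r l).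
  by move=> Jy Iy; rewrite -[r l](subKr y); apply/JB/IJ.
have Js l : J (r l) -> J (s (f l)).
  by move=> Jl; rewrite -[s _](subKr (r l)); apply: JB.
have ff : f k = f k0.
  have [l [_ lU]] := sP 0 (JO _ J0).
  by rewrite -(lU (f k)) ?(lU (f k0)) // sub0r -sub0r; apply: JB => //; apply: Js;
     [apply: (Jr _ 0)|apply: (Jr _ x)].
have kk := f_inj _ _ ff; subst k0.
by rewrite sub0r in Ik0; rewrite -[x](addrK (- r k)); apply: IB.
Qed.

Section Different.
Variables (A : falgType rat) (D q : nat) (m c r : int) (i j : A).
Hypotheses (adm : admissible D q) (mE : q%:Z = 4 * m - 1) (cE : D%:Z = q%:Z * c - r ^+ 2).
Hypothesis ij : quaternion_basis (- D%:R) (- q%:R) i j.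

Let sD : squarefree D. Proof. by case: adm. Qed.
Let q_pr : prime q. Proof. by case: adm. Qed.
Let D0 : (0 < D)%N. Proof. exact: squarefree_gt0. Qed.
Let q0 : (0 < q)%N. Proof. exact: prime_gt0. Qed.
Let DR : - D%:R != 0 :> rat. Proof. by rewrite oppr_eq0 pnatr_eq0 -lt0n. Qed.
Let qR : - q%:R != 0 :> rat. Proof. by rewrite oppr_eq0 pnatr_eq0 -lt0n. Qed.
Let rat2 : 2%:R != 0 :> rat. Proof. by []. Qed.
Let ii : i * i = (- D%:R)%:A. Proof. by case: ij. Qed.
Local Notation "z ^q" := ((z : int)%:~R : rat) (at level 1, format "z ^q").
Local Notation nrdA := (nrd (- D%:R) (- q%:R) i j).
Local Notation onorm := (order_norm m c r).
Local Notation E := (order_elt q r i j).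
Local Notation O := (explicit_order q r i j).

Let OP (w0 w1 s0 s1 : int) : O (E w0^q w1^q s0^q s1^q).
Proof. by exists w0, w1, s0, s1. Qed.

Let OM x y : O x -> O y -> O (x * y).
Proof. by case: (explicit_order_order adm mE cE ij) => _ _; apply. Qed.

Let latO : is_lattice O.
Proof. exact: (explicit_order_lattice r adm mE ij). Qed.

Let Ei (w0 w1 s0 s1 : int) : i * E w0^q w1^q s0^q s1^q = E
  (- r * w0 - c * (s0 + 2 * m * s1))^q (- r * w1 + c * (2 * s0 + s1))^q
  (- w0 - 2 * m * w1 + r * s0)^q (2 * w0 + w1 + r * s1)^q.
Proof. by rewrite (order_elt_i adm mE cE ij) !(rmorphD, rmorphN, rmorphM). Qed.

Let nrdE (w0 w1 s0 s1 : int) : nrdA (E w0^q w1^q s0^q s1^q) = (onorm w0 w1 s0 s1)^q.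
Proof.
by rewrite (nrd_order_elt adm mE cE ij) /order_norm !(rmorphD, rmorphN, rmorphM, rmorphXn).
Qed.

Let ur : i \is a GRing.unit.
Proof.
apply/unitrP; exists ((- D%:R)^-1 *: i).
by rewrite -scalerAl -scalerAr ii scalerA mulVf // scale1r.
Qed.

Let Ok (k : int) : O (k^q%:A).
Proof.
exists k, 0, 0, 0; rewrite -(order_elt1 r i j adm mE) (order_eltZ r i j adm mE).
by rewrite mulr1 !mulr0.
Qed.

Let Oi : O i.
Proof.
exists (- r), 0, (- 1), 2.
rewrite -[LHS]mulr1 -(order_elt1 r i j adm mE) (order_elt_i adm mE cE ij) !rmorphN /=.
by congr order_elt; ring.
Qed.

Definition order_different : set A := [set i * x | x in O].
Local Notation I := order_different.

Lemma order_differentP (w0 w1 s0 s1 : int) : (D %| onorm w0 w1 s0 s1)%Z ->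
  I (E w0^q w1^q s0^q s1^q).
Proof.
move=> /(order_norm_dvd adm mE cE)[w0' [w1' [s0' [s1' [-> -> -> ->]]]]].
by exists (E w0'^q w1'^q s0'^q s1'^q); rewrite ?Ei.
Qed.

(** Membership becomes the vanishing of two linear forms modulo [D], from which the index is
    computed. *)
Lemma order_different_dvd (w0 w1 s0 s1 : int) :
  I (E w0^q w1^q s0^q s1^q) <->
  (D %| - w0 - 2 * m * w1 + r * s0)%Z && (D %| 2 * w0 + w1 + r * s1)%Z.
Proof.
split=> [[x [v0 [v1 [t0 [t1 ->]]]]]|/andP[]].
  rewrite Ei => /(order_elt_inj adm ij)[/intr_inj <- /intr_inj <- /intr_inj <- /intr_inj <-].
  apply/andP; split; apply/dvdzP.
    by exists (- t0); rewrite cE mE; ring.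
  by exists (- t1); rewrite cE mE; ring.
set g0 := (X in (D %| X)%Z -> _); set g1 := (X in _ -> (D %| X)%Z -> _) => /dvdzP[h0 E0] /dvdzP[h1 E1].
apply: order_differentP.
have Dq : coprimez D q := admissible_coprime adm.
rewrite -(Gauss_dvdzr _ Dq) (order_norm_eq mE cE) -/g0 -/g1 E0 E1.
apply: rpredD; last exact: dvdz_mulr.
apply/dvdzP; exists (D%:Z * (h0 ^+ 2 + h0 * h1 + m * h1 ^+ 2)); ring.
Qed.

Lemma explicit_order_maximal : is_maximal_order O.
Proof.
split=> [|O' ordO' OO']; first exact: (explicit_order_order adm mE cE ij).
have [latO' _ OM'] := ordO'.
apply/seteqP; split => // x O'x.
have nP y : O' y -> nrdA y \is a Num.int.
  move=> O'y; have E' (n : nat) : - n%:R = (- n%:Z)%:~R :> rat by rewrite rmorphN.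
  move: ij; rewrite !E' => ij'; apply: (nrd_order_int _ _ ij' ordO' O'y);
  by rewrite oppr_eq0 eqz_nat -lt0n.
have [w0 [w1 [s0 [s1 xE]]]] := order_elt_surj r adm mE ij x.
have pol v0 v1 t0 t1 : O (E v0 v1 t0 t1) ->
  order_norm m^q c^q r^q (w0 + v0) (w1 + v1) (s0 + t0) (s1 + t1)
  - order_norm m^q c^q r^q w0 w1 s0 s1 - order_norm m^q c^q r^q v0 v1 t0 t1 \is a Num.int.
  move=> Oy; rewrite -!(nrd_order_elt adm mE cE ij) -(order_eltD r i j adm mE) -xE.
  by rewrite !rpredB ?nP //; [apply: latticeD|]; rewrite //; apply: OO'.
have [n nE] := intrP (nP _ O'x).
(* The polarised norms of [x] against the four basis elements are, up to sign and order, the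
   coordinates of [i x]: the dual of [O] under the trace form is [i^-1 O]. *)
have /intrP[e0 E0] := pol 1 0 0 0 (OP 1 0 0 0).
have /intrP[e1 E1] := pol 0 1 0 0 (OP 0 1 0 0).
have /intrP[e2 E2] := pol 0 0 1 0 (OP 0 0 1 0).
have /intrP[e3 E3] := pol 0 0 0 1 (OP 0 0 0 1).
have ix : i * x = E (- e3)^q e2^q (- e1)^q e0^q.
  rewrite xE (order_elt_i adm mE cE ij) !rmorphN /= -E0 -E1 -E2 -E3 /order_norm.
  by congr order_elt; ring.
have /order_differentP [y Oy yE] : (D %| onorm (- e3) e2 (- e1) e0)%Z.
  have : (onorm (- e3) e2 (- e1) e0)^q = (D%:Z * n)^q.
    rewrite -nrdE -ix (nrdM rat2 DR qR ij) nE rmorphM /=; congr (_ * _).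
    have : nrdA (quat i j 0 1 0 0) = D%:R by rewrite (nrd_quat rat2 DR qR ij) /qnorm; ring.
    by rewrite quat_i.
  by move=> /intr_inj ->; rewrite dvdz_mulr.
by rewrite (mulrI ur (etrans ix (esym yE))).
Qed.

Lemma order_different_ideal : is_right_ideal O I.
Proof.
split.
- by move=> _ [x Ox <-]; apply: OM.
- by exists 0; rewrite ?mulr0 //; apply: lattice0.
- move=> _ _ [x Ox <-] [y Oy <-]; exists (x - y); rewrite ?mulrBr //.
  exact: latticeB.
by move=> _ y [x Ox <-] Oy; exists (x * y); rewrite ?mulrA //; apply: OM.
Qed.

Lemma order_different_index : has_index O I (D ^ 2).
Proof.
have Dq : coprimez D q := admissible_coprime adm.
(* The representatives are [a0 + a1 om] with [a0] and [a1] below [D]; the index [k] encodes the pair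
   in base [D]. *)
exists (fun k => E (k %/ D)%N%:Z^q (k %% D)%N%:Z^q 0^q 0^q); split=> [k|x]; first exact: OP.
move=> [w0 [w1 [s0 [s1 ->]]]].
have EB (v0 v1 : int) : E w0^q w1^q s0^q s1^q - E v0^q v1^q 0^q 0^q =
    E (w0 - v0)^q (w1 - v1)^q s0^q s1^q.
  rewrite -scaleN1r (order_eltZ r i j adm mE) (order_eltD r i j adm mE) !rmorphB /=.
  by rewrite !mulN1r oppr0 !addr0.
pose g0 := - w0 - 2 * m * w1 + r * s0; pose g1 := 2 * w0 + w1 + r * s1.
have [u [v uvE]] := Bezoutz D q; rewrite (eqP Dq) in uvE.
have {}uvE : v * q%:Z = 1 - u * D%:Z by rewrite -uvE; ring.
(* The representative must solve [a0 + 2 m a1 = - g0] and [2 a0 + a1 = g1] modulo [D]. The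
   determinant is [1 - 4 m = - q], and [v] is the inverse of [q] modulo [D]. *)
pose b1 := v * (- 2 * g0 - g1); pose a1 := (b1 %% D)%Z; pose a0 := ((- g0 - 2 * m * a1) %% D)%Z.
have Dz : D%:Z != 0 by rewrite eqz_nat -lt0n.
have mod_lt z : exists2 n : nat, (n < D)%N & (z %% D)%Z = n.
  have := modz_ge0 z Dz; have := ltz_pmod z (_ : 0 < D%:Z).
  case: (z %% D)%Z => n // H _; exists n => //; exact: H.
have [n0 n0D a0E] := mod_lt (- g0 - 2 * m * a1); have [n1 n1D a1E] := mod_lt b1.
have nD : (n0 * D + n1 < D ^ 2)%N by rewrite -mulnn -(ltn_divLR _ _ D0) divnMDl // divn_small // addn0.
have div0 k0 k1 : (k1 < D)%N -> ((k0 * D + k1) %/ D = k0)%N by move=> k; rewrite divnMDl // divn_small ?addn0.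
have mod0 k0 k1 : (k1 < D)%N -> ((k0 * D + k1) %% D = k1)%N by move=> k; rewrite modnMDl modn_small.
have modE z : exists t, z = (z %% D)%Z + t * D%:Z by exists (z %/ D)%Z; rewrite addrC -divz_eq.
have [t0 T0] := modE (- g0 - 2 * m * a1); have [t1 T1] := modE b1.
rewrite -/a0 in T0; rewrite -/a1 in T1.
exists (Ordinal nD); split.
  rewrite /= div0 // mod0 // EB; apply/order_different_dvd.
  rewrite -a0E -a1E -/a0 -/a1; apply/andP; split; apply/dvdzP.
    exists (- t0); have -> : a0 = - g0 - 2 * m * a1 - t0 * D%:Z by rewrite T0 addrK.
    by rewrite /g0; ring.
  exists (2 * t0 - q%:Z * t1 + u * (2 * g0 + g1)); have -> : a0 = - g0 - 2 * m * a1 - t0 * D%:Z by rewrite T0 addrK.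
  have -> : a1 = b1 - t1 * D%:Z by rewrite T1 addrK.
  have : q%:Z * b1 = (1 - u * D%:Z) * (- 2 * g0 - g1) by rewrite -uvE /b1; ring.
  move=> H; clearbody b1.
  rewrite [LHS](_ : _ = 2 * g0 + g1 + q%:Z * b1 + (2 * t0 - q%:Z * t1) * D%:Z); last first.
    by rewrite mE /g0 /g1; ring.
  by rewrite H; ring.
move=> k; rewrite EB => /order_different_dvd.
set k0 := (k %/ D)%N; set k1 := (k %% D)%N => /andP[/dvdzP[l0 L0] /dvdzP[l1 L1]].
have k1D : (k1 < D)%N by rewrite ltn_mod.
have k0D : (k0 < D)%N by rewrite ltn_divLR // mulnn.
have qk : q%:Z * k1%:Z = - 2 * g0 - g1 + (2 * l0 + l1) * D%:Z.
  rewrite (_ : _ * D%:Z = 2 * (l0 * D%:Z) + l1 * D%:Z); last by ring.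
  by rewrite -L0 -L1 mE /g0 /g1; ring.
have kE1 : k1%:Z = a1.
  have -> : a1 = (k1%:Z %% D)%Z.
    apply/eqP; rewrite eqz_mod_dvd -(Gauss_dvdzr _ Dq) /b1.
    rewrite (_ : _ * _ = v * q%:Z * (- 2 * g0 - g1) - q%:Z * k1%:Z); last by ring.
    by rewrite uvE qk; apply/dvdzP; exists (- u * (- 2 * g0 - g1) - (2 * l0 + l1)); ring.
  by rewrite modz_small // lez_nat ltz_nat.
have kE0 : k0%:Z = a0.
  have -> : a0 = (k0%:Z %% D)%Z.
    apply/eqP; rewrite eqz_mod_dvd -kE1; apply/dvdzP; exists (- l0).
    by rewrite mulNr -L0 /g0; ring.
  by rewrite modz_small // lez_nat ltz_nat.
apply: val_inj => /=; rewrite (divn_eq k D) -/k0 -/k1.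
by move: kE0 kE1; rewrite /a0 a0E /a1 a1E => -[->] [->].
Qed.

(** The multiplier is the quaternion conjugate, whose coordinates are integral because the trace
    [2 w0 + w1 + r s1] is. *)
Lemma order_norm_scalar_ideal J w0 w1 s0 s1 : is_right_ideal O J ->
  J (E w0^q w1^q s0^q s1^q) -> J ((onorm w0 w1 s0 s1)^q%:A).
Proof.
case=> _ _ _ JM /JM /(_ (OP (w0 + w1 + r * s1) (- w1) (- s0) (- s1))).
rewrite (order_eltM adm mE cE ij) -(order_elt1 r i j adm mE) (order_eltZ r i j adm mE).
congr (J (order_elt _ _ _ _ _ _ _ _)); rewrite /order_norm !(rmorphD, rmorphN, rmorphM, rmorphXn) /=; ring.
Qed.

Lemma order_different_uniq J : is_right_ideal O J -> has_index O J (D ^ 2) -> J = I.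
Proof.
move=> idJ indJ; have [JO J0 JB JM] := idJ.
have [IO _ IB _] := order_different_ideal.
apply: (eq_index_subset indJ order_different_index) => // x Jx.
have [w0 [w1 [s0 [s1 xE]]]] := JO _ Jx.
rewrite xE; apply: order_differentP; apply: dvdz_squarefree => // p p_pr pD.
apply/negPn/negP => np.
have [rr [rO rP]] := indJ.
have pD2 : (p %| D ^ 2)%N by rewrite -mulnn dvdn_mulr.
have [y [Oy nJy pJy]] := index_torsion (lattice0 latO) (fun x y => @latticeB _ _ x y latO)
  J0 JB rO rP p_pr pD2.
apply: nJy; set n := onorm _ _ _ _ in np.
have pn : coprimez p n by rewrite coprimezE /= prime_coprime // -dvdzE.
have [u [v uv]] := Bezoutz p n; rewrite (eqP pn) in uv.
have JZ z (k : int) : J z -> J (k^q *: z).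
  by move=> Jz; rewrite -mulr_algr; apply: JM.
have Jn : J (n^q *: y).
  by rewrite -mulr_algl; apply: JM => //; apply: order_norm_scalar_ideal => //; rewrite -xE.
have -> : y = (u^q *: (y *+ p)) - ((- v)^q *: (n^q *: y)).
  rewrite rmorphN scaleNr opprK -scaler_nat !scalerA -scalerDl.
  by rewrite -[p%:R]/(p^q) -!intrM -intrD uv scale1r.
by apply: JB; apply: JZ.
Qed.

Lemma explicit_order_principal_different : reduced_disc A = D -> has_principal_different O.
Proof.
move=> dE; exists I; last by exists i.
rewrite /is_different dE; split=> [|J [idJ indJ]].
  by split; [apply: order_different_ideal | apply: order_different_index].
by rewrite (order_different_uniq idJ indJ).
Qed.

End Different.

Lemma quaternion_basis_conj (F : fieldType) (A : falgType F) (a b : F) (i j u : A) :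
  2%:R != 0 :> F -> a != 0 -> b != 0 ->
  quaternion_basis a b i j -> u \is a GRing.unit ->
  quaternion_basis a b (u * i * u^-1) (u * j * u^-1).
Proof.
move=> F2 a0 b0 ij uu; have [_ ii jj ji] := ij.
have M x y : u * x * u^-1 * (u * y * u^-1) = u * (x * y) * u^-1.
  by rewrite !mulrA mulrVK.
have S k : u * k%:A * u^-1 = k%:A :> A.
  by rewrite -scalerAr -scalerAl mulr1 mulrV.
apply: quaternion_basis_of_relations => //; rewrite ?M.
- by rewrite ii S.
- by rewrite jj S.
- by rewrite ji mulrN mulNr.
- exact: (quaternion_basis_dim ij).
Qed.

Lemma conjugate_explicit_order (A : falgType rat) q r (i j u : A) : u \is a GRing.unit ->
  conjugate_set u (explicit_order q r i j) = explicit_order q r (u * i * u^-1) (u * j * u^-1).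
Proof.
move=> uu.
have qE w0 w1 s0 s1 : u * order_elt q r i j w0 w1 s0 s1 * u^-1 =
    order_elt q r (u * i * u^-1) (u * j * u^-1) w0 w1 s0 s1.
  rewrite /order_elt /quat !mulrDr !mulrDl -!scalerAr -!scalerAl mulr1 mulrV //.
  by rewrite !mulrA mulrVK.
apply/seteqP; split=> [_ [_ [w0 [w1 [s0 [s1 ->]]]] <-]|_ [w0 [w1 [s0 [s1 ->]]]]].
  by exists w0, w1, s0, s1; rewrite qE.
by exists (order_elt q r i j w0%:~R w1%:~R s0%:~R s1%:~R) => //; exists w0, w1, s0, s1.
Qed.

Lemma admissible_params D q : admissible D q -> exists m c r : int,
  q%:Z = 4 * m - 1 /\ D%:Z = q%:Z * c - r ^+ 2.
Proof.
move=> adm; have [_ q_pr q8 _ leg] := adm.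
have [r /dvdzP[c cE]] := legendre_sqr q_pr leg.
exists ((q%:Z + 1) %/ 4)%Z, c, r; split.
  by move: q8; case: ifP => _ q8; clear -q8; lia.
by rewrite mulrC -cE; ring.
Qed.

Lemma maximal_class_principal_different (A : falgType rat) (D q : nat) (i j : A) :
  admissible D q -> quaternion_basis (- D%:R) (- q%:R) i j -> reduced_disc A = D ->
  exists C : set (set A), is_maximal_order_class C /\
    forall Ord : set A, C Ord -> has_principal_different Ord.
Proof.
move=> adm ij dE; have [m [c [r [mE cE]]]] := admissible_params adm.
have [sD q_pr _ _ _] := adm.
exists [set conjugate_set u (explicit_order q r i j) | u in [set u | u \is a GRing.unit]].
split; first by exists (explicit_order q r i j) => //; exact: (explicit_order_maximal adm mE cE ij).
move=> _ [u /= uu <-]; rewrite conjugate_explicit_order //.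
apply: (explicit_order_principal_different adm mE cE) => //.
apply: quaternion_basis_conj => //; rewrite oppr_eq0 pnatr_eq0 -lt0n.
  exact: squarefree_gt0.
exact: prime_gt0.
Qed.

(** * Ramified primes *)

Section ScalarExtension.
Variables (F K : fieldType) (iota : {rmorphism F -> K}) (A : falgType F).
Local Notation AK := (scalar_ext A iota).
Local Notation inK := (@scalar_ext_in F K iota A : A -> AK).

Lemma scalar_ext_inN (x : A) : inK (- x) = - inK x.
Proof. by apply/rowP => k; rewrite !mxE linearN rmorphN. Qed.

Lemma scalar_ext_in_scalar (c : F) : inK c%:A = (iota c)%:A.
Proof. by rewrite -[RHS]/(iota c *: inK 1); apply/rowP => k; rewrite !mxE linearZ rmorphM. Qed.

Lemma dim_scalar_ext : \dim {:AK} = \dim {:A}.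
Proof. by rewrite dimvf /dim /= mul1n. Qed.

Lemma scalar_ext_quaternion_basis (a b : F) (i j : A) :
  2%:R != 0 :> F -> a != 0 -> b != 0 -> quaternion_basis a b i j ->
  quaternion_basis (iota a) (iota b) (inK i) (inK j).
Proof.
move=> F2 a0 b0 ij; have [_ ii jj ji] := ij.
have inM (x y : A) : inK x * inK y = inK (x * y) by rewrite scalar_ext_inM.
apply: quaternion_basis_of_relations; rewrite ?fmorph_eq0 ?inM //.
- by rewrite ii scalar_ext_in_scalar.
- by rewrite jj scalar_ext_in_scalar.
- by rewrite ji scalar_ext_inN.
- by rewrite -(rmorph_nat iota) fmorph_eq0.
- by rewrite dim_scalar_ext; apply: quaternion_basis_dim ij.
Qed.

End ScalarExtension.

(** Anticommuting with a nonzero [y] keeps [x] from being a scalar. A non-scalar with scalar square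
    has trace 0, and the square of a pure Hamilton quaternion is minus a sum of three squares. *)
Lemma hamilton_square_lt0 (R : realFieldType) (B : falgType R) (a b : R) (x y : B) :
  is_hamilton B -> a != 0 -> b != 0 ->
  x * x = a%:A -> y * y = b%:A -> y * x = - (x * y) -> a < 0.
Proof.
move=> [i [j ij]] a0 b0 xx yy yx; have [_ ii jj ji] := ij.
have R2 : 2%:R != 0 :> R by rewrite pnatr_eq0.
have N1 : -1 != 0 :> R by rewrite oppr_eq0 oner_eq0.
have B1 : 1 != 0 :> B by rewrite oner_eq0.
have nscal (k : R) : x <> k%:A.
  move=> xk; have y0 : y != 0.
    by apply: contra_neq b0 => y0; move: yy; rewrite y0 mul0r => /esym/eqP;
      rewrite scaler_eq0 (negPf B1) orbF => /eqP.
  have k0 : k != 0.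
    by apply: contra_neq a0 => k0; move: xx; rewrite xk k0 scale0r mul0r => /esym/eqP;
      rewrite scaler_eq0 (negPf B1) orbF => /eqP.
  move: yx; rewrite xk mulr_algr mulr_algl => /eqP; rewrite -addr_eq0 -mulr2n -scaler_nat scalerA.
  by rewrite scaler_eq0 mulf_eq0 (negPf R2) (negPf k0) (negPf y0).
have [x0 [x1 [x2 [x3 xE]]]] := quaternion_basis_quat ij x.
have tr := quat_trace ii jj ji x0 x1 x2 x3; rewrite -xE xx in tr.
have x00 : x0 = 0.
  apply/eqP/negPn/negP => x00; case: (nscal ((a + qnorm (-1) (-1) x0 x1 x2 x3) / (2 * x0))).
  have t0 : 2 * x0 != 0 by rewrite mulf_neq0.
  apply: (scalerI t0); rewrite scalerA mulrCA mulfV // mulr1 scalerDl tr.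
  by rewrite subrK.
move: tr; rewrite x00 mulr0 scale0r sub0r -scaleNr => /eqP.
rewrite -subr_eq0 -scalerBl scaler_eq0 (negPf B1) orbF subr_eq0 => /eqP aE.
rewrite lt_neqAle a0 aE oppr_le0 /qnorm.
rewrite (_ : _ + _ = x1 ^+ 2 + x2 ^+ 2 + x3 ^+ 2); last by ring.
by rewrite !addr_ge0 ?sqr_ge0.
Qed.

Lemma definite_quaternion_basis (R : realType) (A : falgType rat) (a b : rat) :
  is_definite A R -> a != 0 -> b != 0 -> has_quaternion_basis A a b -> a < 0 /\ b < 0.
Proof.
move=> defA a0 b0 [i [j ij]].
have [_ ii jj ji] := scalar_ext_quaternion_basis (ratr : {rmorphism rat -> R}) (isT : 2%:R != 0 :> rat) a0 b0 ij.
have aR : ratr a != 0 :> R by rewrite fmorph_eq0.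
have bR : ratr b != 0 :> R by rewrite fmorph_eq0.
split; rewrite -(ltrq0 R).
  exact: (hamilton_square_lt0 defA aR bR ii jj ji).
by apply: (hamilton_square_lt0 defA bR aR jj ii); rewrite ji opprK.
Qed.

Lemma fraction_common_denom (T : idomainType) (xs : seq {fraction T}) :
  exists2 d : T, d != 0 & exists ns : seq T,
    [seq x * FracField.tofrac d | x <- xs] = [seq FracField.tofrac n | n <- ns].
Proof.
elim: xs => [|x xs [d d0 [ns nsE]]]; first by exists 1; rewrite ?oner_neq0 //; exists [::].
have [n [e [e0 xE]]] : exists n e : T, e != 0 /\ x * FracField.tofrac e = FracField.tofrac n.
  elim/quotW: x => y; exists (frac y).1, (frac y).2; split; first exact: denom_ratioP.
  unlock FracField.tofrac; rewrite -[LHS]FracField.pi_mul; apply/eqmodP => /=.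
  rewrite FracField.equivfE /FracField.mulf !numden_Ratio ?mulf_neq0 ?oner_neq0 ?denom_ratioP //.
  by rewrite !mulr1 mulrC.
exists (e * d); first by rewrite mulf_neq0.
exists ((n * d) :: map (fun k => e * k) ns) => /=; congr (_ :: _).
  by rewrite !tofracM mulrA xE.
rewrite -map_comp.
have -> : [seq x * FracField.tofrac (e * d) | x <- xs] =
    [seq FracField.tofrac e * y | y <- [seq x * FracField.tofrac d | x <- xs]].
  by rewrite -map_comp; apply: eq_map => y /=; rewrite tofracM mulrCA.
by rewrite nsE -map_comp; apply: eq_map => y /=; rewrite tofracM.
Qed.

(** * Integer approximations of p-adic integers *)

Section PadicResidues.
Variables (p : nat) (p_pr : prime p).
Local Notation Zp := (padic_int p_pr).
Local Notation pn n := ((p ^ n)%N%:Z).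

Definition pcong n (x : Zp) (z : int) : Prop := (residue x n = z %[mod pn n])%Z.

Lemma pcong_residue n x : pcong n x (residue x n).
Proof. by []. Qed.

Lemma pcongD n x y u v : pcong n x u -> pcong n y v -> pcong n (x + y) (u + v).
Proof.
by rewrite /pcong {3}/residue /= => xu yv; rewrite modz_mod -modzDm xu yv modzDm.
Qed.

Lemma pcongM n x y u v : pcong n x u -> pcong n y v -> pcong n (x * y) (u * v).
Proof.
by rewrite /pcong {3}/residue /= => xu yv; rewrite modz_mod -modzMm xu yv modzMm.
Qed.

Lemma pcongN n x u : pcong n x u -> pcong n (- x) (- u).
Proof.
by rewrite /pcong {2}/residue /= => xu; rewrite modz_mod -modzNm xu modzNm.
Qed.

Lemma pcong1 n : pcong n 1 1.
Proof. by rewrite /pcong /residue /= modz_mod. Qed.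

Lemma pcong0 n : pcong n 0 0.
Proof. by rewrite /pcong /residue /= modz_mod. Qed.

Lemma pcongX n x u k : pcong n x u -> pcong n (x ^+ k) (u ^+ k).
Proof.
by move=> xu; elim: k => [|k IH]; [rewrite !expr0; apply: pcong1 | rewrite !exprS; apply: pcongM].
Qed.

Lemma pcong_nat n k : pcong n k%:R k.
Proof.
elim: k => [|k IH]; first exact: pcong0.
by rewrite -addn1 natrD PoszD; apply: pcongD => //; apply: pcong1.
Qed.

Lemma pcong_int n z : pcong n z%:~R z.
Proof.
case: z => k; first exact: pcong_nat.
by rewrite NegzE rmorphN; apply/pcongN/pcong_nat.
Qed.

Lemma residueS (x : Zp) n : (residue x n.+1 = residue x n %[mod pn n])%Z.
Proof. by rewrite [residue x n](asboolW (valP x)) modz_mod. Qed.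

Lemma residue_addn (x : Zp) n k : (residue x (n + k) = residue x n %[mod pn n])%Z.
Proof.
elim: k => [|k IH]; first by rewrite addn0.
rewrite -IH addnS; have /eqP := residueS x (n + k).
rewrite !eqz_mod_dvd => dvd; apply/eqP; rewrite eqz_mod_dvd.
by apply: dvdz_trans dvd; rewrite expnD PoszM dvdz_mulr.
Qed.

Lemma pcong_eq0 (x : Zp) : (forall n, pcong n x 0) -> x = 0.
Proof.
move=> x0; apply: val_inj; apply/funext => n; rewrite -!/(residue _ n).
have rm (y : Zp) : residue y n = (residue y n %% pn n)%Z.
  by rewrite [residue y n](asboolW (valP y)) modz_mod.
by rewrite rm x0 -(pcong0 n) -rm.
Qed.

Lemma pcong_dvd n x z : pcong n x z -> x = 0 -> (pn n %| z)%Z.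
Proof.
by move=> xz x0; rewrite -[z]subr0 -eqz_mod_dvd -xz x0; apply/eqP/pcong0.
Qed.

Lemma pcong_order_norm n m c r w0 w1 s0 s1 :
  pcong n (order_norm m%:~R c%:~R r%:~R w0 w1 s0 s1)
    (order_norm m c r (residue w0 n) (residue w1 n) (residue s0 n) (residue s1 n)).
Proof.
by rewrite /order_norm; do ![exact: pcong_residue | exact: pcong_int | apply: pcongD
  | apply: pcongN | apply: pcongM | apply: pcongX].
Qed.

End PadicResidues.

Definition norm_form (T : comNzRingType) (D q : nat) (x0 x1 x2 x3 : T) : T :=
  x0 ^+ 2 + D%:R * x1 ^+ 2 + q%:R * x2 ^+ 2 + D%:R * q%:R * x3 ^+ 2.

Lemma qnorm_norm_form (F : fieldType) (D q : nat) (x0 x1 x2 x3 : F) :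
  qnorm (- D%:R) (- q%:R) x0 x1 x2 x3 = norm_form D q x0 x1 x2 x3.
Proof. by rewrite /qnorm /norm_form; ring. Qed.

Lemma rmorph_norm_form (T T' : comNzRingType) (f : {rmorphism T -> T'}) D q x0 x1 x2 x3 :
  f (norm_form D q x0 x1 x2 x3) = norm_form D q (f x0) (f x1) (f x2) (f x3).
Proof. by rewrite /norm_form !(rmorphD, rmorphM, rmorphXn, rmorph_nat). Qed.

(** * Ramification at the primes dividing D *)

Section LocalAnisotropy.
Variables (D q : nat) (m c r : int).
Hypotheses (adm : admissible D q) (mE : q%:Z = 4 * m - 1) (cE : D%:Z = q%:Z * c - r ^+ 2).
Variables (p : nat) (p_pr : prime p) (pD : (p %| D)%N).
Local Notation Zp := (padic_int p_pr).
Local Notation onorm := (order_norm m c r).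

Lemma order_norm_descent k w0 w1 s0 s1 : ((p ^ k.*2)%N %| onorm w0 w1 s0 s1)%Z ->
  [/\ ((p ^ k)%N %| w0)%Z, ((p ^ k)%N %| w1)%Z, ((p ^ k)%N %| s0)%Z & ((p ^ k)%N %| s1)%Z].
Proof.
elim: k w0 w1 s0 s1 => [|k IH] w0 w1 s0 s1 dv; first by rewrite !dvd1z.
have p2 : ((p ^ 2)%N %| onorm w0 w1 s0 s1)%Z.
  by apply: dvdz_trans dv; rewrite dvdzE /= dvdn_exp2l.
have [/dvdzP[w0' E0] /dvdzP[w1' E1] /dvdzP[s0' E2] /dvdzP[s1' E3]] :=
  order_norm_aniso adm mE cE p_pr pD p2.
have p0 : p%:Z != 0 by rewrite eqz_nat -lt0n prime_gt0.
have : ((p ^ k.*2)%N %| onorm w0' w1' s0' s1')%Z.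
  have pp : (p ^ 2)%N%:Z != 0 by rewrite eqz_nat -lt0n expn_gt0 prime_gt0.
  rewrite -(dvdz_mul2l pp) -PoszM -expnD add2n -doubleS.
  move: dv; congr (_ %| _)%Z; rewrite E0 E1 E2 E3 /order_norm -mulnn PoszM; ring.
move=> /IH[d0 d1 d2 d3]; rewrite E0 E1 E2 E3 expnSr PoszM.
by rewrite !(dvdz_mul2r p0) ?d0 ?d1 ?d2 ?d3.
Qed.

(** Approximation modulo [p ^ (2 k)] yields, after [k] descent steps, coordinates divisible by
    [p ^ k], for every [k]. *)
Lemma padic_order_norm_eq0 (w0 w1 s0 s1 : Zp) :
  order_norm m%:~R c%:~R r%:~R w0 w1 s0 s1 = 0 ->
  [/\ w0 = 0, w1 = 0, s0 = 0 & s1 = 0].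
Proof.
move=> n0; have H k := order_norm_descent (pcong_dvd (pcong_order_norm k.*2 m c r w0 w1 s0 s1) n0).
have res0 (x : Zp) : (forall k, ((p ^ k)%N %| residue x k.*2)%Z) -> x = 0.
  move=> xk; apply: pcong_eq0 => k; rewrite /pcong -(residue_addn x k k) addnn.
  by apply/eqP; rewrite eqz_mod_dvd subr0.
by split; apply: res0 => k; have [] := H k.
Qed.

Lemma padic_norm_form_eq0 (x0 x1 x2 x3 : Zp) : norm_form D q x0 x1 x2 x3 = 0 ->
  [/\ x0 = 0, x1 = 0, x2 = 0 & x3 = 0].
Proof.
move=> n0.
have qE : q%:R = 4 * m%:~R - 1 :> Zp by rewrite -[q%:R]/(q%:Z%:~R) mE rmorphB rmorphM.
have DE : D%:R = q%:R * c%:~R - r%:~R ^+ 2 :> Zp.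
  by rewrite -[D%:R]/(D%:Z%:~R) cE rmorphB rmorphM rmorphXn.
(* These are the coordinates of the quaternion [(x0, x1, x2, x3)] with respect to the basis of the
   order, as in [order_elt_surj]; they are integral, so no denominators arise. *)
have /padic_order_norm_eq0[] : order_norm m%:~R c%:~R r%:~R
    (x0 - x2 + r%:~R * x3 - r%:~R * x1) (2 * (x2 - r%:~R * x3)) (- q%:R * x3 - x1) (2 * x1) = 0.
  by rewrite -[RHS]n0 /order_norm /norm_form DE qE; ring.
have Z2 (y : Zp) : 2 * y = 0 -> y = 0.
  by move/eqP; rewrite mulf_eq0 padic_int_char0 /= => /eqP.
have qz (y : Zp) : q%:R * y = 0 -> y = 0.
  have q0 : q == 0%N = false by apply/negbTE; rewrite -lt0n prime_gt0 //; case: adm.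
  by move/eqP; rewrite mulf_eq0 padic_int_char0 q0 /= => /eqP.
move=> e0 /Z2 e1 e2 /Z2 e3 {n0}; rewrite {x1}e3 in e0 e2 *.
have e3 : x3 = 0 by apply: qz; move/eqP: e2; rewrite subr0 mulNr oppr_eq0 => /eqP.
rewrite {e2 x3}e3 mulr0 !subr0 in e0 e1 *; rewrite {x2}e1 in e0 *.
by split=> //; move: e0; rewrite subr0 addr0.
Qed.

Lemma dvd_ramified (A : falgType rat) (i j : A) :
  quaternion_basis (- D%:R) (- q%:R) i j -> ramified A p.
Proof.
move=> ij; exists p_pr.
have [sD q_pr _ _ _] := adm.
have D0 : - D%:R != 0 :> rat by rewrite oppr_eq0 pnatr_eq0 -lt0n squarefree_gt0.
have q0 : - q%:R != 0 :> rat by rewrite oppr_eq0 pnatr_eq0 -lt0n prime_gt0.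
have ijK := scalar_ext_quaternion_basis (rat_to_padic p_pr : {rmorphism rat -> padic p_pr})
  (isT : 2%:R != 0 :> rat) D0 q0 ij.
apply: (quaternion_basis_division ijK).
move=> x0 x1 x2 x3; rewrite !rmorphN !rmorph_nat qnorm_norm_form => n0.
have [d d0 [ns]] := fraction_common_denom [:: x0; x1; x2; x3].
case: ns => [|y0 [|y1 [|y2 [|y3 [|]]]]] //= [E0 E1 E2 E3].
have /padic_norm_form_eq0[z0 z1 z2 z3] : norm_form D q y0 y1 y2 y3 = 0.
  apply/eqP; rewrite -tofrac_eq0; apply/eqP.
  have -> : FracField.tofrac (norm_form D q y0 y1 y2 y3) = norm_form D q
     (FracField.tofrac y0) (FracField.tofrac y1) (FracField.tofrac y2) (FracField.tofrac y3).
    exact: (rmorph_norm_form (@FracField.tofrac Zp)).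
  rewrite -E0 -E1 -E2 -E3.
  rewrite [LHS](_ : _ = norm_form D q x0 x1 x2 x3 * FracField.tofrac d ^+ 2).
    by rewrite n0 mul0r.
  by rewrite /norm_form; ring.
have dF : FracField.tofrac d != 0 by rewrite tofrac_eq0.
have x_0 (x : padic p_pr) (y : Zp) : x * FracField.tofrac d = FracField.tofrac y -> y = 0 -> x = 0.
  by move=> /[swap] ->; rewrite tofrac0 => /eqP; rewrite mulf_eq0 (negPf dF) orbF => /eqP.
by split; [exact: x_0 E0 z0|exact: x_0 E1 z1|exact: x_0 E2 z2|exact: x_0 E3 z3].
Qed.

End LocalAnisotropy.

(** * Splitting at the primes not dividing D *)

Section Hensel.
Variables (p : nat) (p_pr : prime p) (b k : int).
Local Notation Zp := (padic_int p_pr).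
Local Notation f := (fun y : int => y ^+ 2 + b * y + k).

Lemma hensel_quadratic (y0 : int) : (p %| f y0)%Z -> coprimez p (2 * y0 + b) ->
  exists2 y : Zp, y ^+ 2 + b%:~R * y + k%:~R = 0 & pcong 1 y y0.
Proof.
move=> py0 cop; have [u [v uv]] := Bezoutz p (2 * y0 + b); rewrite (eqP cop) in uv.
(* Newton's iteration with the derivative frozen: [v] inverts [2 y0 + b] modulo [p] once and for
   all, and each step gains one power of [p]. *)
pose y n := iter n (fun y => y - v * f y) y0.
have yP n : (p %| y n - y0)%Z /\ ((p ^ n.+1)%N %| f (y n))%Z.
  elim: n => [|n [yn /dvdzP[t tE]]]; first by rewrite subrr dvdz0 expn1.
  have fp : (p %| f (y n))%Z by rewrite tE expnS PoszM dvdz_mull // dvdz_mulr.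
  have yS : y n.+1 = y n - v * f (y n) by [].
  split; first by rewrite yS addrAC rpredB // dvdz_mull.
  have [a aE] := dvdzP yn.
  have E : f (y n.+1) = f (y n) * (1 - v * (2 * y n + b)) + v ^+ 2 * f (y n) ^+ 2.
    by rewrite yS; ring.
  apply/dvdzP; exists (t * (u - 2 * v * a) + v ^+ 2 * t ^+ 2 * (p ^ n)%N%:Z).
  rewrite E; have -> : 1 - v * (2 * y n + b) = (u - 2 * v * a) * p%:Z.
    rewrite -[X in X - _]uv (_ : y n = y0 + a * p%:Z); last by rewrite -aE addrC subrK.
    by ring.
  by rewrite tE !expnS !PoszM; ring.
have yS n : (y n.+1 = y n %[mod (p ^ n)%N])%Z.
  apply/eqP; rewrite eqz_mod_dvd; have [_ fy] := yP n.
  rewrite -[y n.+1]/(y n - v * f (y n)) addrAC subrr sub0r dvdz_opp dvdz_mull //.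
  by apply: dvdz_trans fy; rewrite dvdzE /= dvdn_exp2l.
pose Y : Zp := mk_padic p_pr yS.
have YP n : pcong n Y (y n) by rewrite /pcong /residue /= modz_mod.
exists Y.
  apply: pcong_eq0 => n.
  have : pcong n (Y ^+ 2 + b%:~R * Y + k%:~R) (f (y n)).
    by do ![exact: YP | exact: pcong_int | apply: pcongD | apply: pcongM | apply: pcongX].
  rewrite /pcong => ->; apply/eqP; rewrite eqz_mod_dvd subr0; have [_ fy] := yP n.
  by apply: dvdz_trans fy; rewrite dvdzE /= dvdn_exp2l.
rewrite /pcong YP; apply/eqP; rewrite expn1 eqz_mod_dvd.
by have [] := yP 1%N.
Qed.

End Hensel.

(** The expressions [z ^ 2] and [- D - q y ^ 2] each take [(p + 1) / 2] distinct values modulo [p]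
    as the variable runs below [h], so by counting they share one. *)
Lemma exists_ternary_zero p (q D : int) : prime p -> odd p -> ~~ (p %| q)%Z ->
  exists z y : int, (p %| z ^+ 2 + q * y ^+ 2 + D)%Z.
Proof.
move=> p_pr po pq; set h := (p.+1)./2.
have hp : (h + h = p.+1)%N by rewrite addnn /h even_halfK //= po.
have charp : p \in [pchar 'F_p] by apply: pchar_Fp.
pose g (x : 'I_h + 'I_h) : 'F_p :=
  match x with inl z => (z%:Z ^+ 2)%:~R | inr y => (- D - q * y%:Z ^+ 2)%:~R end.
have sq_inj (z w : 'I_h) : (p %| z%:Z ^+ 2 - w%:Z ^+ 2)%Z -> z = w.
  have zh := ltn_ord z; have wh := ltn_ord w.
  rewrite subr_sqr Euclid_dvdzM // => /orP[] /dvdzP[t tE]; apply: val_inj => /=.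
    have : t = 0 by clear -tE zh wh hp; nia.
    by move=> t0; move: tE; rewrite t0 mul0r => /subr0_eq[].
  have : t = 0 \/ t = 1 \/ t = -1 by clear -tE zh wh hp; nia.
  by move=> H; clear -tE zh wh hp H; lia.
have /injectivePn[x [x' xx']] : ~~ injectiveb g.
  apply/negP => /injectiveP/leq_card; rewrite card_sum card_Fp // !card_ord hp.
  by rewrite ltnn.
have eqF (u v : int) : u%:~R = v%:~R :> 'F_p -> (p %| u - v)%Z.
  by move=> uv; rewrite -Fp_int_eq0 // rmorphB /= uv subrr.
case: x x' xx' => [z|y] [z'|y'] xx' /= /eqF.
- by move=> /sq_inj E; rewrite E eqxx in xx'.
- move=> H; exists z, y'; move: H; congr (_ %| _)%Z; ring.
- move=> H; exists z', y; rewrite -dvdz_opp; move: H; congr (_ %| _)%Z; ring.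
move=> H; case/eqP: xx'; congr inr; apply: sq_inj.
have : (p %| q * (y%:Z ^+ 2 - y'%:Z ^+ 2))%Z.
  by rewrite -dvdz_opp; move: H; congr (_ %| _)%Z; ring.
by rewrite Euclid_dvdzM // (negPf pq).
Qed.

Section LocalSplitting.
Variables (D q : nat).
Hypotheses (adm : admissible D q).
Variables (p : nat) (p_pr : prime p) (pD : ~~ (p %| D)%N).
Local Notation Zp := (padic_int p_pr).

Lemma padic_isotropic : exists x0 x1 x2 x3 : Zp,
  norm_form D q x0 x1 x2 x3 = 0 /\ ~ [/\ x0 = 0, x1 = 0, x2 = 0 & x3 = 0].
Proof.
have [sD q_pr q8 _ leg] := adm.
have [m [c [r [mE cE]]]] := admissible_params adm.
have qE : q%:R = 4 * m%:~R - 1 :> Zp by rewrite -[q%:R]/(q%:Z%:~R) mE rmorphB rmorphM.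
have one_nz (x1 x0 x3 : Zp) : ~ [/\ x0 = 0, x1 = 0, 1 = 0 :> Zp & x3 = 0].
  by case=> _ _ /eqP; rewrite oner_eq0.
have one_nz' (x2 x0 x3 : Zp) : ~ [/\ x0 = 0, 1 = 0 :> Zp, x2 = 0 & x3 = 0].
  by case=> _ /eqP; rewrite oner_eq0.
have copp x : ~~ (p %| x)%Z -> coprimez p x.
  by rewrite coprimezE dvdzE /= prime_coprime.
have [p2|p2] := eqVneq p 2%N.
  have Dodd : odd D by move: pD; rewrite p2 dvdn2 negbK.
  rewrite Dodd in q8.
  (* As [q = 7] modulo 8, [m] is even and 0 is a simple root of [Y ^ 2 - Y + m] modulo 2; the lifted
     root satisfies [(2 Y - 1) ^ 2 = - q]. *)
  have [||Y YE _] := @hensel_quadratic p p_pr (- 1) m 0.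
  - by rewrite p2; clear -mE q8; lia.
  - by rewrite p2.
  exists (2 * Y - 1), 0, 1, 0; split; last exact: one_nz.
  rewrite [LHS](_ : _ = 4 * (Y ^+ 2 + (- 1)%:~R * Y + m%:~R)); first by rewrite YE mulr0.
  by rewrite /norm_form qE rmorphN; ring.
have po : odd p by case: (even_prime p_pr) p2 => // ->.
have p2' : ~~ (p %| 2)%Z by rewrite dvdzE /= dvdn_prime2.
have [pq|pq] := eqVneq p q.
  have [||Y YE _] := @hensel_quadratic p p_pr 0 D r.
  - by rewrite cE mul0r addr0 pq addrC subrK dvdz_mulr.
  - apply: copp; rewrite addr0 Euclid_dvdzM // (negPf p2') /=.
    apply/negP => pr; case/negP: pD; rewrite -[(_ %| _)%N]/(p %| D%:Z)%Z cE.
    by rewrite -pq; apply: rpredB; [apply: dvdz_mulr | rewrite Euclid_dvdz_sqr].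
  exists Y, 1, 0, 0; split; last exact: one_nz'.
  by rewrite -[RHS]YE /norm_form -[D%:Z%:~R]/(D%:R); ring.
have pq' : ~~ (p %| q%:Z)%Z by rewrite dvdzE /= dvdn_prime2.
have [z [y zy]] := exists_ternary_zero D%:Z p_pr po pq'.
have [pz|pz] := boolP (p %| z)%Z; last first.
  have [||Y YE _] := @hensel_quadratic p p_pr 0 (q%:Z * y ^+ 2 + D%:Z) z.
  - by rewrite mul0r addr0 addrA.
  - by apply: copp; rewrite addr0 Euclid_dvdzM // (negPf p2').
  exists Y, 1, y%:~R, 0; split; last exact: one_nz'.
  rewrite -[RHS]YE /norm_form rmorphD rmorphM rmorphXn /= -[D%:Z%:~R]/(D%:R) -[q%:Z%:~R]/(q%:R).
  by ring.
have py : ~~ (p %| y)%Z.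
  apply/negP => py; case/negP: pD; rewrite -[(_ %| _)%N]/(p %| D%:Z)%Z.
  rewrite (_ : D%:Z = z ^+ 2 + q%:Z * y ^+ 2 + D%:Z - (z * z + q%:Z * y * y)); last by ring.
  by rewrite rpredB // rpredD // dvdz_mull.
(* When [p] divides [z] the zero is singular in [z] and is lifted in [y] instead. Multiplying by [q]
   makes the polynomial in [Y = q y] monic, whence the factors [q] in the zero below. *)
have [||Y YE _] := @hensel_quadratic p p_pr 0 (q%:Z * (z ^+ 2 + D%:Z)) (q%:Z * y).
- rewrite (_ : _ + _ = q%:Z * (z ^+ 2 + q%:Z * y ^+ 2 + D%:Z)); last by ring.
  by rewrite dvdz_mull.
- by apply: copp; rewrite addr0 !Euclid_dvdzM // (negPf p2') (negPf pq').
exists (q%:R * z%:~R), q%:R, Y, 0; split.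
  rewrite (_ : norm_form _ _ _ _ _ _ = q%:R * (Y ^+ 2 + 0%:~R * Y + (q%:Z * (z ^+ 2 + D%:Z))%:~R)).
    by rewrite YE mulr0.
  rewrite /norm_form rmorphM rmorphD rmorphXn /= -[D%:Z%:~R]/(D%:R) -[q%:Z%:~R]/(q%:R); ring.
by case=> _ /eqP; rewrite padic_int_char0 eqn0Ngt prime_gt0.
Qed.

Lemma ndvd_not_ramified (A : falgType rat) (i j : A) :
  quaternion_basis (- D%:R) (- q%:R) i j -> ~ ramified A p.
Proof.
move=> ij [p_pr']; rewrite (bool_irrelevance p_pr' p_pr).
have [sD q_pr _ _ _] := adm.
have D0 : - D%:R != 0 :> rat by rewrite oppr_eq0 pnatr_eq0 -lt0n squarefree_gt0.
have q0 : - q%:R != 0 :> rat by rewrite oppr_eq0 pnatr_eq0 -lt0n prime_gt0.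
have ijK := scalar_ext_quaternion_basis (rat_to_padic p_pr : {rmorphism rat -> padic p_pr})
  (isT : 2%:R != 0 :> rat) D0 q0 ij.
have [x0 [x1 [x2 [x3 [n0 nz]]]]] := padic_isotropic.
pose F : {rmorphism Zp -> padic p_pr} := @FracField.tofrac Zp.
apply: (quaternion_basis_not_division (x0 := F x0) (x1 := F x1) (x2 := F x2) (x3 := F x3) _ _ _ ijK);
  rewrite ?fmorph_eq0 ?padic_char0 //.
  by rewrite !rmorphN !rmorph_nat qnorm_norm_form -(rmorph_norm_form F) n0 rmorph0.
have F0 x : F x = 0 -> x = 0 by move/eqP; rewrite tofrac_eq0 => /eqP.
by move=> [/F0 e0 /F0 e1 /F0 e2 /F0 e3]; apply: nz.
Qed.

End LocalSplitting.

Lemma reduced_disc_admissible (A : falgType rat) (D q : nat) (i j : A) :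
  admissible D q -> quaternion_basis (- D%:R) (- q%:R) i j -> reduced_disc A = D.
Proof.
move=> adm ij; have [sD _ _ _ _] := adm.
have [m [c [r [mE cE]]]] := admissible_params adm.
rewrite /reduced_disc.
have -> : [set p | ramified A p]%classic = [set` primes D]%classic; last first.
  by rewrite -fsbig_seq ?primes_uniq // -squarefree_prod_primes.
apply/seteqP; split=> p /=.
  move=> pR; have [p_pr _] := pR.
  rewrite mem_primes p_pr squarefree_gt0 //=; apply/negPn/negP => pD.
  exact: (ndvd_not_ramified adm p_pr pD ij).
rewrite mem_primes => /and3P[p_pr _ pD].
exact: (dvd_ramified adm mE cE p_pr pD ij).
Qed.

Theorem proposition23 (R : realType) (A : falgType rat)
    (quatA : is_quaternion_algebra A) (defA : is_definite A R) :
  exists C : set (set A), is_maximal_order_class C /\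
    forall Ord : set A, C Ord -> has_principal_different Ord.
Proof.
have [a [b [a0 b0 ij]]] := quatA.
have [a_lt0 b_lt0] := definite_quaternion_basis defA a0 b0 ij.
have [D [q [adm [i' [j' ij']]]]] := normal_form R a_lt0 b_lt0 ij.
exact: maximal_class_principal_different adm ij' (reduced_disc_admissible adm ij').
Qed.
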